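(* Let $f_1,f_2$ be entire functions, let $q,\tilde q\in L_2(0,\pi)$ be complex-valued, and let $\{\lambda_n\}_{n=1}^\infty$ and $\{\tilde\lambda_n\}_{n=1}^\infty$ be subspectra of the problems $L(q)$ and $L(\tilde q)$ (with the same $f_1,f_2$), respectively. Put $\omega:=\frac12\int_0^\pi q(x)\,dx$ and $\tilde\omega:=\frac12\int_0^\pi\tilde q(x)\,dx$. Suppose that the sequence $\{v_n\}_{n=0}^\infty$ constructed from $f_1,f_2$ and $\{\lambda_n\}_{n=0}^\infty$ (with $\lambda_0:=0$) is complete in $\mathcal H$, and that $\lambda_n=\tilde\lambda_n$ for all $n\ge 1$ and $\omega=\tilde\omega$. Then $q=\tilde q$ in $L_2(0,\pi)$.
   Context: For entire functions $f_1,f_2$ and complex-valued $q\in L_2(0,\pi)$, $L(q)$ denotes the boundary value problem $-y''(x)+q(x)y(x)=\lambda y(x)$, $x\in(0,\pi)$, with $y(0)=0$, $f_1(\lambda)y'(\pi)+f_2(\lambda)y(\pi)=0$. Prime is the derivative in $x$; for derivatives in $\lambda$ write $f^{<j>}(\lambda)=\frac1{j!}\frac{d^j}{d\lambda^j}f(\lambda)$, $j\ge0$. Let $S(x,\lambda)$ be the solution of the equation with $S(0,\lambda)=0$, $S'(0,\lambda)=1$. The eigenvalues of $L(q)$ are the zeros of the entire characteristic function $\Delta(\lambda)=f_1(\lambda)S'(\pi,\lambda)+f_2(\lambda)S(\pi,\lambda)$, and the multiplicity of an eigenvalue is its multiplicity as a zero of $\Delta$. A sequence $\{\lambda_n\}_{n=1}^\infty$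 of complex numbers is a subspectrum of $L(q)$ if it consists of eigenvalues, each repeated at most as many times as its multiplicity; i.e. if a value $\mu$ occurs $k$ times among $\{\lambda_n\}_{n\ge1}$, then $\Delta^{<j>}(\mu)=0$ for $0\le j\le k-1$. Put $\lambda_0:=0$, $I:=\{n\ge0:\lambda_n\ne\lambda_k\ \forall k,\ 0\le k<n\}$, $m_n:=\#\{k\ge0:\lambda_k=\lambda_n\}$. Equal values in $\{\lambda_n\}_{n=0}^\infty$ are numbered consecutively: $\lambda_n=\lambda_{n+1}=\dots=\lambda_{n+m_n-1}$ for $n\in I$. Let $s(x,\lambda)=\sqrt\lambda\sin(\sqrt\lambda x)$, $c(x,\lambda)=\cos(\sqrt\lambda x)$ (entire in $\lambda$). $\mathcal H=L_2(0,\pi)\oplus L_2(0,\pi)$ is the complex Hilbert space of $h=[h_1,h_2]$ with $(g,h)_{\mathcal H}=\int_0^\pi(\overline{g_1(t)}h_1(t)+\overline{g_2(t)}h_2(t))\,dt$. Let $v(t,\lambda)=[f_1(\lambda)s(t,\lambda),\,f_2(\lambda)c(t,\lambda)]$, $v_{n+\nu}(t):=v^{<\nu>}(t,\lambda_n)$ for $n\in I$, $\nu=0,\dots,m_n-1$, $n+\nu\ge1$, and $v_0(t):=[0,1]$. This defines $\{v_n\}_{n=0}^\infty\subset\mathcal H$. *)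

(* Defs.v *)
From HB Require Import structures.
From mathcomp Require Import all_boot all_order all_algebra.
From mathcomp Require Import all_classical all_reals all_analysis.
From mathcomp.real_closed Require Export complex.
Set Implicit Arguments.
Unset Strict Implicit.
Unset Printing Implicit Defensive.
Import Order.TTheory GRing.Theory Num.Theory.
Import numFieldNormedType.Exports.
Local Open Scope classical_set_scope.
Local Open Scope ring_scope.
Local Open Scope complex_scope.

Section Holomorphic.
Variable K : numFieldType.

Definition entire (f : K -> K) := forall z, derivable f z 1.

(* f^{<j>}(z) = f^{(j)}(z) / j! *)
Definition taylor_coef (j : nat) (f : K -> K) (z : K) : K :=
  derive1n j f z / (j`!)%:R.

End Holomorphic.

Section Defs.
Variable R : realType.
Local Notation C := R[i].
Local Notation Re := (@complex.Re R).
Local Notation Im := (@complex.Im R).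
Local Notation ii := (0 +i* 1 : C).
Local Notation mu := (@lebesgue_measure R).
Implicit Types (q y : R -> C) (h : R -> C * C).

Definition cexp (z : C) : C :=
  (expR (Re z) * cos (Im z)) +i* (expR (Re z) * sin (Im z)).

Definition ccos (z : C) : C := (cexp (ii * z) + cexp (- (ii * z))) / 2.
Definition csin (z : C) : C := (cexp (ii * z) - cexp (- (ii * z))) / (2 * ii).

(* Neither function depends on the choice of the square root. *)
Definition s_fun (x : R) (lam : C) : C := sqrtc lam * csin (sqrtc lam * x%:C).
Definition c_fun (x : R) (lam : C) : C := ccos (sqrtc lam * x%:C).

Definition sqnorm (z : C) : R := Re z ^+ 2 + Im z ^+ 2.

Definition Cmeasurable (D : set R) y :=
  measurable_fun D (fun x => Re (y x)) /\ measurable_fun D (fun x => Im (y x)).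

Definition Cintegral (D : set R) y : C :=
  (Rintegral mu D (fun x => Re (y x))) +i* (Rintegral mu D (fun x => Im (y x))).

Definition sqL2 y : \bar R := (\int[mu]_(x in `]0%R, pi[) (sqnorm (y x))%:E)%E.

Definition L2 y := Cmeasurable `]0, pi[ y /\ (sqL2 y < +oo)%E.

Definition eqL2 (y z : R -> C) := {ae mu, forall x : R, x \in `]0, pi[ -> y x = z x}.

(* y belongs to W_2^2[0, pi] with derivative y' = y1, i.e. y and y1 are
   absolutely continuous and y1 has an L_2 derivative y2, and it satisfies
   -y'' + q y = lam y almost everywhere on (0, pi). *)
Definition SL_solution q (lam : C) y (y1 : R -> C) := exists y2 : R -> C,
  [/\ L2 y2,
      forall x : R, x \in `[0, pi] -> y x = y 0 + Cintegral `]0, x[ y1,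
      forall x : R, x \in `[0, pi] -> y1 x = y1 0 + Cintegral `]0, x[ y2 &
      {ae mu, forall x : R, x \in `]0, pi[ -> - y2 x + q x * y x = lam * y x}].

(* S x lam = S(x, lam) and S1 x lam = S'(x, lam). *)
Definition is_S q (S S1 : R -> C -> C) := forall lam,
  [/\ SL_solution q lam (S ^~ lam) (S1 ^~ lam), S 0 lam = 0 & S1 0 lam = 1].

Definition Delta (f1 f2 : C -> C) (S S1 : R -> C -> C) (lam : C) : C :=
  f1 lam * S1 pi lam + f2 lam * S pi lam.

(* If a value z occurs at least k times (at the distinct positive indices
   listed in s, k = size s), then z is a zero of D of order at least k. *)
Definition subspectrum (D : C -> C) (lam : nat -> C) :=
  forall (z : C) (s : seq nat), uniq s ->
    (forall n : nat, n \in s -> (0 < n)%N /\ lam n = z) ->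
    forall j, (j < size s)%N -> taylor_coef j D z = 0.

Definition numbered_consecutively (lam : nat -> C) :=
  forall i j k, (i <= j <= k)%N -> lam i = lam k -> lam j = lam i.

Definition omega q : C := Cintegral `]0, pi[ q / 2.

(* The least index n, i.e. the element n of I, with lam n = lam k. *)
Definition first_index (lam : nat -> C) (k : nat) : nat :=
  index (lam k) (mkseq lam k.+1).

(* Under consecutive numbering, each k > 0 is n + nu with
   n = first_index lam k in I and 0 <= nu < m_n; the lambda-derivatives of the
   H-valued function are taken for each fixed t. *)
Definition vseq (f1 f2 : C -> C) (lam : nat -> C) (k : nat) (t : R) : C * C :=
  if k is 0%N then (0, 1) else
    let n := first_index lam k in
    let nu := (k - n)%N in
    (taylor_coef nu (fun z => f1 z * s_fun t z) (lam n),
     taylor_coef nu (fun z => f2 z * c_fun t z) (lam n)).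

Definition inH h := L2 (fun t => (h t).1) /\ L2 (fun t => (h t).2).

Definition sqnormH h : \bar R :=
  (\int[mu]_(t in `]0%R, pi[) (sqnorm (h t).1 + sqnorm (h t).2)%:E)%E.

Definition lincomb (n : nat) (a : 'I_n -> C) (v : nat -> R -> C * C) (t : R)
    : C * C :=
  (\sum_(k < n) a k * (v k t).1, \sum_(k < n) a k * (v k t).2).

(* The linear span of the v k is dense in H. *)
Definition completeH (v : nat -> R -> C * C) :=
  forall h, inH h -> forall eps : R, 0 < eps ->
    exists (n : nat) (a : 'I_n -> C),
      (sqnormH (fun t => ((h t).1 - (lincomb a v t).1,
                          (h t).2 - (lincomb a v t).2)%R) < (eps ^+ 2)%:E)%E.

End Defs.

(* Main.v *)
Require Import Defs.
From HB Require Import structures.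
From mathcomp Require Import all_boot all_order all_algebra.
From mathcomp Require Import all_classical all_reals all_analysis.
From mathcomp Require Import measurable_realfun ring lra.

(** Extend the potentials by zero and let b be a kernel for Q on the triangle
    0 <= s <= x <= pi, that is, a solution of the Volterra equation [kernel_of]. With
    nu = 2 i sqrt lam, the function nu e^{-nu x/2} S(x, lam) is the transform
    1 - e^{-nu x} + int_0^x b(x, y) e^{-nu y} dy of exponentials, because both functions
    satisfy the same integral equation ([Wker_eq], [Y_eq], [solution_kernel]). At x = pi this
    expresses lam S(pi, lam) and lam S'(pi, lam) by trigonometric terms, which depend on the
    mean of Q only, and by integrals of cos and sin of sqrt lam (pi - 2 y) against the density
    z(y) = Q(y) - int_y^pi Q(u) b(u, y) du ([solves_char]).

    The means of the two potentials agree. Hence the difference D of the two characteristic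
    functions satisfies lam D(lam) = <(N, K), v(., lam)>, where N and K are the odd and the
    even part of the difference of the two densities about pi/2, written in t = |pi - 2 y|
    ([lam_D]). Both characteristic functions vanish on the subspectrum with multiplicities, and
    the factor lam accounts for the additional value lam_0 = 0. Taking Taylor coefficients of
    lam D(lam) therefore shows that (N, K) is orthogonal to all v_n ([orthogonal]); by
    completeness the two densities coincide ([density_diff_eq0]).

    Taylor coefficients are treated as Cauchy integrals over unit circles, which commute with
    the integral over t ([taylor_coefE], [Tc_CI]). This rests on Goursat's theorem and on the
    fact that both characteristic functions are entire ([ent_S]).

    It remains to recover the potential from the density. The difference r of the potentials
    is r(y) = int_y^pi (Q b - Qt bt)(u, y) du. The kernel equations express b - bt by integrals
    of the same function Q b - Qt bt = r b + Qt (b - bt), and the antisymmetry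
    b(x, x - s) = - b(x, s), which can be imposed on the kernels ([antisymmetric_kernel]),
    removes the boundary terms at x = pi ([db_back]). So r and b - bt solve a homogeneous Volterra
    system from pi downwards, and both vanish ([potential_eq_ae]). *)

Set Implicit Arguments.
Unset Strict Implicit.
Unset Printing Implicit Defensive.
Import Order.TTheory GRing.Theory Num.Theory.
Import numFieldNormedType.Exports.
Local Open Scope classical_set_scope.
Local Open Scope ring_scope.
Local Open Scope complex_scope.

(** * Complex numbers: modulus and measurability *)

Section ComplexBasics.
Variable R : realType.
Local Notation C := R[i].
Local Notation Re := (@complex.Re R).
Local Notation Im := (@complex.Im R).
Local Notation nc := (@Normc.normc R).

Lemma complex_ext (z w : C) : Re z = Re w -> Im z = Im w -> z = w.
Proof. by case: z w => [a b] [c d] /= -> ->. Qed.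
Lemma cReD (z w : C) : Re (z + w) = Re z + Re w.
Proof. by case: z w => [a b] [c d]. Qed.
Lemma cImD (z w : C) : Im (z + w) = Im z + Im w.
Proof. by case: z w => [a b] [c d]. Qed.
Lemma cReN (z : C) : Re (- z) = - Re z.
Proof. by case: z => [a b]. Qed.
Lemma cImN (z : C) : Im (- z) = - Im z.
Proof. by case: z => [a b]. Qed.
Lemma cReB (z w : C) : Re (z - w) = Re z - Re w.
Proof. by rewrite cReD cReN. Qed.
Lemma cImB (z w : C) : Im (z - w) = Im z - Im w.
Proof. by rewrite cImD cImN. Qed.
Lemma cReM (z w : C) : Re (z * w) = Re z * Re w - Im z * Im w.
Proof. by case: z w => [a b] [c d]. Qed.
Lemma cImM (z w : C) : Im (z * w) = Re z * Im w + Im z * Re w.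
Proof. by case: z w => [a b] [c d]. Qed.

Lemma nc_ge0 z : 0 <= nc z.
Proof. by case: z => a b; exact: sqrtr_ge0. Qed.
Lemma nc_sqr z : nc z ^+ 2 = sqnorm z.
Proof. by case: z => a b; rewrite /= sqr_sqrtr // addr_ge0 // sqr_ge0. Qed.
Lemma nc0 : nc 0 = 0.
Proof. exact: Normc.normc0. Qed.
Lemma nc1 : nc 1 = 1.
Proof. exact: Normc.normc1. Qed.
Lemma nc_eq0 z : nc z = 0 -> z = 0.
Proof. exact: Normc.eq0_normc. Qed.
Lemma ncM z w : nc (z * w) = nc z * nc w.
Proof. exact: Normc.normcM. Qed.
Lemma ncD z w : nc (z + w) <= nc z + nc w.
Proof. exact: le_normcD. Qed.
Lemma ncN z : nc (- z) = nc z.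
Proof. exact: normcN. Qed.
Lemma ncB z w : nc (z - w) <= nc z + nc w.
Proof. by rewrite -(ncN w) ncD. Qed.
Lemma ncV z : nc z^-1 = (nc z)^-1.
Proof. exact: Normc.normcV. Qed.
Lemma nc_gt0 z : z != 0 -> 0 < nc z.
Proof. by move=> z0; rewrite lt_neqAle nc_ge0 andbT eq_sym; apply/contra_neq: z0 => /nc_eq0. Qed.
Lemma ncX z n : nc (z ^+ n) = nc z ^+ n.
Proof. by elim: n => [|n IH]; rewrite ?expr0 ?nc1 // !exprS ncM IH. Qed.

Lemma nc_real (x : R) : nc x%:C = `|x|.
Proof. by rewrite /= expr0n /= addr0 sqrtr_sqr. Qed.
Lemma nc_Re z : `|Re z| <= nc z.
Proof.
case: z => a b /=; rewrite -sqrtr_sqr ler_wsqrtr // lerDl sqr_ge0 //.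
Qed.
Lemma nc_Im z : `|Im z| <= nc z.
Proof.
case: z => a b /=; rewrite -sqrtr_sqr ler_wsqrtr // lerDr sqr_ge0 //.
Qed.
Lemma nc_ReIm z : nc z <= `|Re z| + `|Im z|.
Proof.
have h : 0 <= `|Re z| + `|Im z| by rewrite addr_ge0.
rewrite -(@ler_pXn2r _ 2) ?nnegrE ?nc_ge0 // nc_sqr /sqnorm.
rewrite -[Re z ^+ 2]real_normK ?num_real // -[Im z ^+ 2]real_normK ?num_real //.
have := normr_ge0 (Re z); have := normr_ge0 (Im z); nra.
Qed.
Lemma nc_bool (b : bool) : nc b%:R <= 1.
Proof. by case: b; rewrite ?nc1 ?nc0. Qed.
Lemma ReV_conj z : Re (z^*%C * z) = nc z ^+ 2.
Proof. by rewrite nc_sqr; case: z => a b; rewrite /sqnorm /= ; ring. Qed.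
Lemma nc_norm z : `|z| = (nc z)%:C.
Proof. by case: z. Qed.
Lemma nc_nat n : nc n%:R = n%:R.
Proof.
have -> : n%:R = (n%:R : R)%:C :> C by rewrite rmorph_nat.
by rewrite nc_real normr_nat.
Qed.
Lemma nc_conj z : nc z^*%C = nc z.
Proof. by case: z => a b /=; rewrite sqrrN. Qed.
Lemma Re_real (x : R) : Re x%:C = x. Proof. by []. Qed.
Lemma Im_real (x : R) : Im x%:C = 0. Proof. by []. Qed.
Lemma Re_bool (b : bool) : Re b%:R = b%:R. Proof. by case: b. Qed.
Lemma Im_bool (b : bool) : Im b%:R = 0. Proof. by case: b. Qed.

End ComplexBasics.

Section CMeasurable.
Context {R : realType}.
Local Notation C := R[i].
Local Notation Re := (@complex.Re R).
Local Notation Im := (@complex.Im R).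
Local Notation nc := (@Normc.normc R).

Definition Cmeas {d} {T : measurableType d} (f : T -> C) :=
  measurable_fun setT (Re \o f) /\ measurable_fun setT (Im \o f).

Context {d : measure_display} {T : measurableType d}.
Implicit Types f g : T -> C.

Lemma Cmeas_cst (z : C) : Cmeas (fun _ : T => z).
Proof. by split; exact: measurable_cst. Qed.
Lemma Cmeas_eq f g : f =1 g -> Cmeas f -> Cmeas g.
Proof. by move=> /funext ->. Qed.
Lemma CmeasD f g : Cmeas f -> Cmeas g -> Cmeas (fun x => f x + g x).
Proof.
move=> [a b] [a' b']; split.
  by apply: eq_measurable_fun (measurable_funD a a') => x _ /=; rewrite cReD.
by apply: eq_measurable_fun (measurable_funD b b') => x _ /=; rewrite cImD.
Qed.
Lemma CmeasN f : Cmeas f -> Cmeas (fun x => - f x).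
Proof.
move=> [a b]; split.
  by apply: eq_measurable_fun (measurable_funN a) => x _ /=; rewrite cReN.
by apply: eq_measurable_fun (measurable_funN b) => x _ /=; rewrite cImN.
Qed.
Lemma CmeasB f g : Cmeas f -> Cmeas g -> Cmeas (fun x => f x - g x).
Proof. by move=> a b; apply: CmeasD => //; exact: CmeasN. Qed.
Lemma CmeasM f g : Cmeas f -> Cmeas g -> Cmeas (fun x => f x * g x).
Proof.
move=> [a b] [a' b']; split.
  by apply: eq_measurable_fun (measurable_funB (measurable_funM a a') (measurable_funM b b'))
    => x _ /=; rewrite cReM.
by apply: eq_measurable_fun (measurable_funD (measurable_funM a b') (measurable_funM b a'))
    => x _ /=; rewrite cImM.
Qed.
Lemma Cmeas_real (f : T -> R) : measurable_fun setT f -> Cmeas (fun x => (f x)%:C).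
Proof. by move=> h; split => //; exact: measurable_cst. Qed.
Lemma Cmeas_bool (b : T -> bool) : measurable_fun setT b -> Cmeas (fun x => (b x)%:R).
Proof.
move=> mb; split.
  apply: (@eq_measurable_fun _ _ _ _ _ (fun x => if b x then 1 else 0 : R)).
    by move=> x _ /=; case: (b x).
  by apply: measurable_fun_ifT => //; exact: measurable_cst.
apply: (@eq_measurable_fun _ _ _ _ _ (fun=> 0 : R)); last exact: measurable_cst.
by move=> x _ /=; case: (b x).
Qed.
Lemma measurable_nc f : Cmeas f -> measurable_fun setT (fun x => nc (f x)).
Proof.
move=> [a b].
have h : measurable_fun setT (fun x => Num.sqrt ((Re \o f) x ^+ 2 + (Im \o f) x ^+ 2)).
  apply: (@measurable_comp _ _ _ _ _ _ setT (@Num.sqrt R)) => //.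
    apply: continuous_measurable_fun; exact: sqrt_continuous.
  by apply: measurable_funD; exact: measurable_funX.
by apply: eq_measurable_fun h => x _ /=; case: (f x).
Qed.
Lemma Cmeas_conj f : Cmeas f -> Cmeas (fun x => (f x)^*%C).
Proof.
move=> [a b]; split.
  by apply: eq_measurable_fun a => x _ /=; case: (f x).
by apply: eq_measurable_fun (measurable_funN b) => x _ /=; case: (f x).
Qed.
Lemma Cmeas_cexp f : Cmeas f -> Cmeas (fun x => cexp (f x)).
Proof.
move=> [a b].
have mc : measurable_fun setT (@cos R) by apply: continuous_measurable_fun; exact: continuous_cos.
have ms : measurable_fun setT (@sin R) by apply: continuous_measurable_fun; exact: continuous_sin.
have me : measurable_fun setT (fun x => expR (Re (f x))).
  exact: (@measurable_comp _ _ _ _ _ _ setT (@expR R)) (@measurable_expR R) a.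
have mcb : measurable_fun setT (fun x => cos (Im (f x))) by exact: (@measurable_comp _ _ _ _ _ _ setT (@cos R)) mc b.
have msb : measurable_fun setT (fun x => sin (Im (f x))) by exact: (@measurable_comp _ _ _ _ _ _ setT (@sin R)) ms b.
by split; [exact: measurable_funM me mcb | exact: measurable_funM me msb].
Qed.
End CMeasurable.

Lemma Cmeas_comp {R : realType} d d' (T : measurableType d) (T' : measurableType d')
   (f : T' -> R[i]) (g : T -> T') :
  Cmeas f -> measurable_fun setT g -> Cmeas (fun x => f (g x)).
Proof. by move=> [a b] mg; split; [exact: (measurableT_comp a mg) | exact: (measurableT_comp b mg)]. Qed.

(** * Real integrals over the line and affine substitutions *)

Section AffineChange.
Variable R : realType.
Local Notation mu := (@lebesgue_measure R).

Lemma measurable_affine (c d : R) : measurable_fun setT (fun x : R => c * x + d).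
Proof.
by apply: measurable_funD => //; apply: measurable_funM.
Qed.

Lemma lebesgue_affine_itv (c d : R) (c0 : c != 0) (X : set R) : ocitv X ->
  mu X = (`|c|%:E * mu ((fun x : R => (c * x + d)%R) @^-1` X))%E.
Proof.
move=> [[a b] /= _ <-].
have [ab|ba] := ltP a b; last first.
  rewrite set_itv_ge ?bnd_simp -?leNgt // preimage_set0 measure0 mule0 //.
rewrite lebesgue_measure_itv /= lte_fin ab.
have [cp|cn|/eqP] := ltgtP c 0; last by rewrite (negPf c0).
- have -> : (fun x : R => c * x + d) @^-1` `]a, b] = `[(b - d) / c, (a - d) / c[%classic.
    apply/seteqP; split => x /=; rewrite !in_itv /= => /andP[h1 h2]; apply/andP; split.
    + by rewrite ler_ndivrMr // mulrC; lra.
    + by rewrite ltr_ndivlMr // mulrC; lra.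
    + by move: h2; rewrite ltr_ndivlMr // mulrC; lra.
    + by move: h1; rewrite ler_ndivrMr // mulrC; lra.
  rewrite lebesgue_measure_itv /= lte_fin ifT; last first.
    by rewrite ltr_nM2r ?invr_lt0 //; lra.
  by rewrite ltr0_norm // -!EFinB -EFinM; congr EFin; field.
- have -> : (fun x : R => c * x + d) @^-1` `]a, b] = `](a - d) / c, (b - d) / c]%classic.
    apply/seteqP; split => x /=; rewrite !in_itv /= => /andP[h1 h2]; apply/andP; split.
    + by rewrite ltr_pdivrMr // mulrC; lra.
    + by rewrite ler_pdivlMr // mulrC; lra.
    + by move: h1; rewrite ltr_pdivrMr // mulrC; lra.
    + by move: h2; rewrite ler_pdivlMr // mulrC; lra.
  rewrite lebesgue_measure_itv /= lte_fin ifT; last first.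
    by rewrite ltr_pM2r ?invr_gt0 //; lra.
  by rewrite gtr0_norm // -!EFinB -EFinM; congr EFin; field.
Qed.

(** Lebesgue measure agrees on half-open intervals, hence everywhere, with its image
    under the affine map scaled by |c|. *)
Lemma ge0_integral_affine (c d : R) (f : R -> \bar R) : c != 0 ->
  measurable_fun setT f -> (forall x, (0 <= f x)%E) ->
  (\int[mu]_x f x = `|c|%:E * \int[mu]_x f (c * x + d)%R)%E.
Proof.
move=> c0 mf f0.
pose phi := fun x : R => c * x + d.
have mphi : measurable_fun setT (phi : measurableTypeR R -> measurableTypeR R).
  exact: measurable_affine.
pose pf : {measure set (measurableTypeR R) -> \bar R} :=
  measure_function_pushforward__canonical__measure_function_Measure mu mphi.
pose nu := mscale (NngNum (normr_ge0 c)) pf.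
have munu A : measurable A -> mu A = nu A.
  apply: (@lebesgue_measure_unique R nu) => X oX.
  by rewrite /nu /mscale /=; exact: lebesgue_affine_itv.
rewrite (@eq_measure_integral _ _ _ _ nu); last by move=> A mA _; exact: munu.
rewrite (@ge0_integral_mscale _ _ _ pf setT measurableT (NngNum (normr_ge0 c))) //=.
by rewrite ge0_integral_pushforward.
Qed.

End AffineChange.

Section RealIntegral.
Variable R : realType.
Local Notation mu := (@lebesgue_measure R).
Implicit Types f g : R -> R.

(** Integrals are taken over the whole line and intervals are encoded by indicator
    factors of the integrand, so that Fubini's theorem and substitutions carry no
    conditions on domains. *)
Definition Rable f := mu.-integrable setT (EFin \o f).
Definition RI f : R := \int[mu]_x f x.

Lemma Rable_meas f : Rable f -> measurable_fun setT f.
Proof. by move=> /integrableP[/measurable_EFinP]. Qed.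
Lemma Rable_eq f g : f =1 g -> Rable f -> Rable g.
Proof. by move=> /funext ->. Qed.
Lemma RableD f g : Rable f -> Rable g -> Rable (fun x => f x + g x).
Proof. move=> hf hg; exact: (@integrableD _ _ _ mu _ measurableT _ _ hf hg). Qed.
Lemma RableZ c f : Rable f -> Rable (fun x => c * f x).
Proof. move=> hf; exact: (@integrableZl _ _ _ mu _ measurableT c _ hf). Qed.
Lemma RableN f : Rable f -> Rable (fun x => - f x).
Proof. by move/(RableZ (-1)); apply: Rable_eq => x; rewrite mulN1r. Qed.
Lemma RableB f g : Rable f -> Rable g -> Rable (fun x => f x - g x).
Proof. by move=> hf hg; apply: RableD => //; exact: RableN. Qed.
Lemma Rable_dom f g : measurable_fun setT f -> Rable g ->
  (forall x, `|f x| <= g x) -> Rable f.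
Proof.
move=> mf ig fg; apply: (@le_integrable _ _ _ mu _ measurableT _ _ _ _ ig).
  exact/measurable_EFinP.
by move=> x _ /=; rewrite lee_fin (le_trans (fg x)) // ler_norm.
Qed.
Lemma Rable0 : Rable (fun=> 0).
Proof. exact: integrable0. Qed.
Lemma Rable_abs f : Rable f -> Rable (fun x => `|f x|).
Proof.
move=> hf; apply: (@le_integrable _ _ _ mu _ measurableT _ _ _ _ hf).
  by apply/measurable_EFinP; apply: measurableT_comp => //; exact: Rable_meas.
by move=> x _ /=; rewrite lee_fin normr_id.
Qed.
Lemma RID f g : Rable f -> Rable g -> RI (fun x => f x + g x) = RI f + RI g.
Proof. by move=> hf hg; rewrite /RI RintegralD. Qed.
Lemma RIZ c f : Rable f -> RI (fun x => c * f x) = c * RI f.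
Proof. by move=> hf; rewrite /RI RintegralZl. Qed.
Lemma RIB f g : Rable f -> Rable g -> RI (fun x => f x - g x) = RI f - RI g.
Proof. by move=> hf hg; rewrite /RI RintegralB. Qed.
Lemma RI_le f g : Rable f -> Rable g -> (forall x, f x <= g x) -> RI f <= RI g.
Proof. by move=> hf hg fg; apply: le_Rintegral. Qed.
Lemma RI_ge0 f : (forall x, 0 <= f x) -> 0 <= RI f.
Proof. by move=> h; apply: Rintegral_ge0. Qed.
Lemma RI_fin f : Rable f -> (RI f)%:E = (\int[mu]_x (f x)%:E)%E.
Proof. by move=> h; rewrite fineK //; exact: integrable_fin_num. Qed.
Lemma RI0 : RI (fun=> 0) = 0.
Proof. by rewrite /RI /Rintegral integral0. Qed.
Lemma Rable_ge0 f : measurable_fun setT f -> (forall x, 0 <= f x) ->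
  (\int[mu]_x (f x)%:E < +oo)%E -> Rable f.
Proof.
move=> mf f0 h; apply/integrableP; split; first exact/measurable_EFinP.
by under eq_integral do rewrite gee0_abs ?lee_fin //.
Qed.

Lemma Rable_affine c d f : c != 0 -> Rable f -> Rable (fun x => f (c * x + d)).
Proof.
move=> c0 hf; have mf := Rable_meas hf.
have mfa : measurable_fun setT (fun x => f (c * x + d)).
  by apply: (measurableT_comp mf); exact: measurable_affine.
apply/integrableP; split; first exact/measurable_EFinP.
have h := Rable_abs hf.
have mabs : measurable_fun setT (fun x => `|f x|%:E).
  by apply/measurable_EFinP; exact: Rable_meas.
have e := ge0_integral_affine d c0 mabs (fun x => @normr_ge0 _ _ (f x) : (0 <= `|f x|%:E)%E).
have -> : (\int[mu]_x `|(EFin \o (fun x0 : R => f (c * x0 + d)%R)) x|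
         = \int[mu]_x `|f (c * x + d)%R|%:E)%E by [].
have -> : (+oo = `|c|^-1%:E * +oo)%E.
  by rewrite gt0_muley // lte_fin invr_gt0 normr_gt0.
rewrite lte_pdivlMl ?normr_gt0 // -e.
by rewrite -RI_fin // ltry.
Qed.

Lemma RI_affine c d f : c != 0 -> Rable f ->
  RI f = `|c| * RI (fun x => f (c * x + d)).
Proof.
move=> c0 hf; apply: EFin_inj.
have hfa := Rable_affine d c0 hf.
rewrite EFinM !RI_fin //.
have mf : measurable_fun setT (EFin \o f) by apply/measurable_EFinP; exact: Rable_meas.
rewrite integralE [X in (_ = _ * X)%E]integralE.
rewrite (@ge0_integral_affine R c d (fun x => (EFin \o f)^\+ x)%E) //; last exact: measurable_funepos.
rewrite (@ge0_integral_affine R c d (fun x => (EFin \o f)^\- x)%E) //; last exact: measurable_funeneg.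
rewrite [RHS]muleBr; [congr (_ * _ - _ * _)%E; apply: eq_integral => x _; rewrite ?funeposE ?funenegE //|by []|].
apply: fin_num_adde_defl.
by rewrite fin_numN; exact: (@integrable_neg_fin_num _ _ _ mu _ measurableT _ hfa).
Qed.

End RealIntegral.

(** * Complex integrals over the line *)

Section ComplexIntegral.
Variable R : realType.
Local Notation C := R[i].
Local Notation Re := (@complex.Re R).
Local Notation Im := (@complex.Im R).
Local Notation nc := (@Normc.normc R).
Local Notation mu := (@lebesgue_measure R).
Implicit Types f g : R -> C.

Definition Cable f := Rable (fun x => Re (f x)) /\ Rable (fun x => Im (f x)).
Definition CI f : C := Cintegral setT f.

Lemma Re_CI f : Re (CI f) = RI (fun x => Re (f x)). Proof. by []. Qed.
Lemma Im_CI f : Im (CI f) = RI (fun x => Im (f x)). Proof. by []. Qed.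

Lemma Cable_meas f : Cable f -> Cmeas f.
Proof. by move=> [a b]; split; exact: Rable_meas. Qed.
Lemma Cable_dom f (g : R -> R) : Cmeas f -> Rable g -> (forall x, nc (f x) <= g x) ->
  Cable f.
Proof.
move=> [a b] ig h; split; apply: (Rable_dom _ ig) => // x.
  exact: le_trans (nc_Re _) (h x).
exact: le_trans (nc_Im _) (h x).
Qed.
Lemma Cable_nc f : Cable f -> Rable (fun x => nc (f x)).
Proof.
move=> cf; have [a b] := cf.
apply: (Rable_dom _ (RableD (Rable_abs a) (Rable_abs b))).
  by apply: measurable_nc; exact: Cable_meas.
by move=> x; rewrite ger0_norm ?nc_ge0 // nc_ReIm.
Qed.
Lemma Cable_eq f g : f =1 g -> Cable f -> Cable g.
Proof. by move=> /funext ->. Qed.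
Lemma CableD f g : Cable f -> Cable g -> Cable (fun x => f x + g x).
Proof.
move=> [a b] [a' b']; split.
  by apply: Rable_eq (RableD a a') => x; rewrite cReD.
by apply: Rable_eq (RableD b b') => x; rewrite cImD.
Qed.
Lemma CableZ (c : C) f : Cable f -> Cable (fun x => c * f x).
Proof.
move=> [a b]; split.
  by apply: Rable_eq (RableB (RableZ (Re c) a) (RableZ (Im c) b)) => x; rewrite cReM.
by apply: Rable_eq (RableD (RableZ (Re c) b) (RableZ (Im c) a)) => x; rewrite cImM.
Qed.
Lemma CableN f : Cable f -> Cable (fun x => - f x).
Proof. by move/(CableZ (-1)); apply: Cable_eq => x; rewrite mulN1r. Qed.
Lemma CableB f g : Cable f -> Cable g -> Cable (fun x => f x - g x).
Proof. by move=> a b; apply: CableD => //; exact: CableN. Qed.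
Lemma CableM (h : R -> C) f (B : R) : Cmeas h -> (forall x, nc (h x) <= B) ->
  Cable f -> Cable (fun x => h x * f x).
Proof.
move=> mh hB cf; apply: (Cable_dom _ (RableZ B (Cable_nc cf))).
  by apply: CmeasM => //; exact: Cable_meas.
by move=> x; rewrite ncM ler_wpM2r ?nc_ge0.
Qed.
Lemma Cable0 : Cable (fun=> 0).
Proof. by split; exact: Rable0. Qed.

Lemma CID f g : Cable f -> Cable g -> CI (fun x => f x + g x) = CI f + CI g.
Proof.
move=> [a b] [a' b']; apply: complex_ext.
  by rewrite cReD !Re_CI -RID //; congr RI; apply/funext => x; rewrite cReD.
by rewrite cImD !Im_CI -RID //; congr RI; apply/funext => x; rewrite cImD.
Qed.
Lemma CIZ (c : C) f : Cable f -> CI (fun x => c * f x) = c * CI f.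
Proof.
move=> [a b]; apply: complex_ext.
  rewrite cReM !Re_CI Im_CI -!RIZ // -RIB; [|exact: RableZ|exact: RableZ].
  by congr RI; apply/funext => x; rewrite cReM.
rewrite cImM Re_CI !Im_CI -!RIZ // -RID; [|exact: RableZ|exact: RableZ].
by congr RI; apply/funext => x; rewrite cImM.
Qed.
Lemma CIN f : Cable f -> CI (fun x => - f x) = - CI f.
Proof.
move=> cf; rewrite -mulN1r -CIZ //; congr CI; apply/funext => x.
by rewrite mulN1r.
Qed.
Lemma CIB f g : Cable f -> Cable g -> CI (fun x => f x - g x) = CI f - CI g.
Proof. by move=> cf cg; rewrite CID ?CIN //; exact: CableN. Qed.
Lemma CI0 : CI (fun=> 0) = 0.
Proof. by apply: complex_ext; rewrite ?Re_CI ?Im_CI /= RI0. Qed.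
Lemma eq_CI f g : f =1 g -> CI f = CI g.
Proof. by move=> /funext ->. Qed.

(** Multiplying the integral by its own conjugate reduces the bound to the real part of
    an integrand. *)
Lemma CI_le f : Cable f -> nc (CI f) <= RI (fun x => nc (f x)).
Proof.
move=> cf; set z := CI f.
have [->|z0] := eqVneq z 0; first by rewrite nc0; apply: RI_ge0 => x; exact: nc_ge0.
have zp := nc_gt0 z0.
rewrite -(ler_pM2l zp) -expr2 -ReV_conj -CIZ // Re_CI -RIZ; last exact: Cable_nc.
apply: RI_le.
- by case: (CableZ (z^*%C) cf).
- by apply: RableZ; exact: Cable_nc.
- by move=> x; apply: le_trans (ler_norm _) (le_trans (nc_Re _) _); rewrite ncM nc_conj.
Qed.
Lemma CI_le_dom f (g : R -> R) : Cmeas f -> Rable g -> (forall x, nc (f x) <= g x) ->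
  nc (CI f) <= RI g.
Proof.
move=> mf ig h; have cf := Cable_dom mf ig h.
by apply: le_trans (CI_le cf) _; apply: RI_le => //; exact: Cable_nc.
Qed.

Lemma RI_ae (f g : R -> R) : measurable_fun setT f -> measurable_fun setT g ->
  {ae mu, forall x, f x = g x} -> RI f = RI g.
Proof.
move=> mf mg h; rewrite /RI /Rintegral; congr fine.
apply: ae_eq_integral => //; try exact/measurable_EFinP.
by apply: (@filterS _ _ (ae_filter_ringOfSetsType mu) _ _ _ h) => x /= -> _.
Qed.
Lemma CI_ae f g : Cmeas f -> Cmeas g -> {ae mu, forall x, f x = g x} -> CI f = CI g.
Proof.
move=> [a b] [a' b'] h; apply: complex_ext; rewrite ?Re_CI ?Im_CI; apply: RI_ae => //.
  by apply: (@filterS _ _ (ae_filter_ringOfSetsType mu) _ _ _ h) => x /= ->.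
by apply: (@filterS _ _ (ae_filter_ringOfSetsType mu) _ _ _ h) => x /= ->.
Qed.
Lemma Cable_affine c d f : c != 0 -> Cable f -> Cable (fun x => f (c * x + d)).
Proof. by move=> c0 [a b]; split; [exact: Rable_affine a|exact: Rable_affine b]. Qed.
Lemma CI_affine c d f : c != 0 -> Cable f ->
  CI f = `|c|%:C * CI (fun x => f (c * x + d)).
Proof.
move=> c0 [a b]; apply: complex_ext.
  by rewrite cReM Re_CI Im_real mul0r subr0 Re_CI (RI_affine d c0 a).
by rewrite cImM Im_CI Im_real mul0r addr0 Im_CI (RI_affine d c0 b).
Qed.
Lemma CI_shift d f : Cable f -> CI (fun x => f (x + d)) = CI f.
Proof.
move=> cf; rewrite [RHS](CI_affine d (@oner_neq0 R)) // normr1 mul1r.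
by apply: eq_CI => x; rewrite mul1r.
Qed.
Lemma CI_reflect d f : Cable f -> CI (fun x => f (d - x)) = CI f.
Proof.
have h : -1 != 0 :> R by rewrite oppr_eq0 oner_neq0.
move=> cf; rewrite [RHS](CI_affine d h) // normrN1 mul1r.
by apply: eq_CI => x; rewrite mulN1r addrC.
Qed.
Lemma measurable_oo (a b : R) : measurable_fun setT (fun x : R => (a < x) && (x < b)).
Proof. by apply: measurable_and; apply: measurable_fun_ltr. Qed.
Lemma RI_oo (a b : R) : a <= b -> RI (fun x => ((a < x) && (x < b))%:R) = b - a.
Proof.
move=> ab.
have -> : (fun x => ((a < x) && (x < b))%:R) = ((fun=> 1 : R) \_ `]a, b[%classic).
  apply/funext => x; rewrite /patch; case: ifP => [|].
    by rewrite inE /= in_itv /= => ->.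
  by move/negP; rewrite inE /= in_itv /= => /negP/negPf ->.
rewrite /RI -Rintegral_mkcond Rintegral_cst // mul1r.
have mE := lebesgue_measure_itv `]a, b[%R.
rewrite /= lte_fin in mE.
apply: (etrans (congr1 fine mE)).
by case: ltP => // ba; rewrite (le_anti (introT andP (conj ab ba))) subrr.
Qed.
Lemma Rable_oo (a b : R) : Rable (fun x => ((a < x) && (x < b))%:R).
Proof.
have mE := lebesgue_measure_itv `]a, b[%R.
rewrite /= lte_fin in mE.
apply: Rable_ge0 => //.
  have [h _] := @Cmeas_bool R _ _ _ (measurable_oo a b).
  by apply: eq_measurable_fun h => x _ /=; rewrite Re_bool.
have e : (\int[mu]_x (((a < x)%R && (x < b)%R)%:R%R)%:E = mu `]a, b[%classic)%E.
  rewrite -(setIT `]a, b[%classic) -integral_indic //; apply: eq_integral => x _.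
  by rewrite indicE mem_setE in_itv.
rewrite mE in e.
apply: (@le_lt_trans _ _ (if a < b then (b%:E - a%:E)%E else 0%E)).
  by rewrite le_eqVlt; apply/orP; left; apply/eqP; exact: e.
by case: ifP; rewrite ?ltry // => _; rewrite -EFinB ltry.
Qed.
Lemma nc_boolE (b : bool) : nc b%:R = b%:R.
Proof. by case: b; rewrite ?nc1 ?nc0. Qed.
Lemma Cmeas_oo (a b : R) : Cmeas (fun x => ((a < x) && (x < b))%:R : C).
Proof. exact: (Cmeas_bool (measurable_oo a b)). Qed.
Lemma Cable_oo (a b : R) : Cable (fun x => ((a < x) && (x < b))%:R).
Proof.
apply: (Cable_dom (Cmeas_oo a b) (Rable_oo a b)) => x.
by rewrite nc_boolE.
Qed.
Lemma Cable_ooM (a b : R) f : Cable f -> Cable (fun x => ((a < x) && (x < b))%:R * f x).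
Proof. by apply: CableM (Cmeas_oo a b) _ => x; exact: nc_bool. Qed.
Lemma Cable_bd (a b B : R) f : Cmeas f ->
  (forall x, a < x -> x < b -> nc (f x) <= B) ->
  Cable (fun x => ((a < x) && (x < b))%:R * f x).
Proof.
move=> mf hB; apply: (Cable_dom _ (RableZ B (Rable_oo a b))).
  by apply: CmeasM => //; exact: Cmeas_oo.
move=> x; rewrite ncM nc_boolE mulrC; case: (ltP a x) => ax; case: (ltP x b) => xb;
  rewrite ?mulr0 ?mulr1 ?hB //.
Qed.

Lemma Cintegral_oo (a b : R) f :
  Cintegral `]a, b[ f = CI (fun x => ((a < x) && (x < b))%:R * f x).
Proof.
have h (u : R -> R) : Rintegral mu `]a, b[ u = RI (fun x => ((a < x) && (x < b))%:R * u x).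
  rewrite /RI Rintegral_mkcond; congr Rintegral; apply/funext => x.
  rewrite /patch; case: ifP => [|].
    by rewrite inE /= in_itv /= => ->; rewrite mul1r.
  by move/negP; rewrite inE /= in_itv /= => /negP/negPf ->; rewrite mul0r.
apply: complex_ext; rewrite /= ?h ?Re_CI ?Im_CI; congr RI; apply/funext => x.
  by rewrite cReM Re_bool Im_bool mul0r subr0.
by rewrite cImM Re_bool Im_bool mul0r addr0.
Qed.

End ComplexIntegral.

(** * Fubini's theorem *)

Section Fubini.
Variable R : realType.
Local Notation C := R[i].
Local Notation Re := (@complex.Re R).
Local Notation Im := (@complex.Im R).
Local Notation nc := (@Normc.normc R).
Local Notation mu := (@lebesgue_measure R).

Lemma measurable_RI d (T : measurableType d) (f : T * R -> R) :
  measurable_fun setT f -> measurable_fun setT (fun t => RI (fun x => f (t, x))).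
Proof.
move=> mf; rewrite /RI /Rintegral.
have mE : measurable_fun setT (EFin \o f) by apply/measurable_EFinP.
have hp : measurable_fun setT (fun t : T => \int[mu]_x (EFin \o f)^\+ (t, x))%E.
  apply: (@measurable_fun_fubini_tonelli_F _ _ _ _ _ mu) => //.
  exact: measurable_funepos.
have hm : measurable_fun setT (fun t : T => \int[mu]_x (EFin \o f)^\- (t, x))%E.
  apply: (@measurable_fun_fubini_tonelli_F _ _ _ _ _ mu) => //.
  exact: measurable_funeneg.
have h := emeasurable_funB hp hm.
have : measurable_fun setT (fun t : T => \int[mu]_x (f (t, x))%:E)%E.
  by apply: eq_measurable_fun h => t _ /=; rewrite [RHS]integralE; congr (_ - _)%E; apply: eq_integral => x _; rewrite ?funeposE ?funenegE.
move=> h'; exact: (@measurableT_comp _ _ _ _ _ _ fine) h'.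
Qed.

Lemma Cmeas_CI d (T : measurableType d) (F : T * R -> C) :
  Cmeas F -> Cmeas (fun t => CI (fun x => F (t, x))).
Proof.
move=> [a b]; split.
  exact: (measurable_RI a).
exact: (measurable_RI b).
Qed.

(** Domination by a product of integrable functions makes F integrable on the plane, by
    Tonelli's theorem. *)
Lemma RI_fubini (F : R * R -> R) (g h : R -> R) : measurable_fun setT F ->
  Rable g -> Rable h -> (forall x y, `|F (x, y)| <= g x * h y) ->
  RI (fun x => RI (fun y => F (x, y))) = RI (fun y => RI (fun x => F (x, y))).
Proof.
move=> mF ig ih dom.
have i1 x : Rable (fun y => F (x, y)).
  apply: (Rable_dom _ (RableZ (g x) ih)) => //.
  exact: (measurable_fun_pair2 x mF).
have i2 y : Rable (fun x => F (x, y)).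
  apply: (Rable_dom _ (RableZ (h y) ig)) => [|x]; last by rewrite mulrC.
  exact: (measurable_fun_pair1 y mF).
have e1 x : (RI (fun y => F (x, y)))%:E = (\int[mu]_y (EFin \o F) (x, y))%E.
  exact: RI_fin.
have e2 y : (RI (fun x => F (x, y)))%:E = (\int[mu]_x (EFin \o F) (x, y))%E.
  exact: RI_fin.
rewrite {1 3}/RI /Rintegral; congr fine.
under eq_integral do rewrite e1.
under [RHS]eq_integral do rewrite e2.
apply: (@Fubini _ _ _ _ R mu mu (EFin \o F)).
apply/integrable12ltyP; first exact/measurable_EFinP.
apply: (@le_lt_trans _ _ (\int[mu]_x (`|g x| * RI (fun y => `|h y|))%:E)%E); last first.
  have ii := RableZ (RI (fun y => `|h y|)) (Rable_abs ig).
  apply: (@le_lt_trans _ _ (RI (fun x => RI (fun y => `|h y|) * `|g x|))%:E); last exact: ltry.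
  rewrite RI_fin // le_eqVlt; apply/orP; left; apply/eqP.
  by apply: eq_integral => x _; rewrite mulrC.
have mabs : measurable_fun setT (fun z => `|(EFin \o F) z|)%E.
  by apply: measurableT_comp => //; exact/measurable_EFinP.
apply: ge0_le_integral => //.
- by move=> x _; apply: integral_ge0.
- have mm : measurable_fun (setT : set R) (fun x : R => \int[mu]_y (abse \o (EFin \o F)) (x, y))%E.
    by apply: (@measurable_fun_fubini_tonelli_F _ _ _ _ _ mu) => // z; exact: abse_ge0.
  exact: mm.
- apply/measurable_EFinP; apply: measurable_funM => //.
  by apply: measurableT_comp => //; exact: Rable_meas.
- move=> x _; have ii := RableZ `|g x| (Rable_abs ih).
  rewrite -RIZ; last exact: Rable_abs.
  rewrite RI_fin //; apply: ge0_le_integral => //.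
  + by apply: measurableT_comp => //; apply/measurable_EFinP; exact: (measurable_fun_pair2 x mF).
  + by apply/measurable_EFinP; exact: Rable_meas.
  + move=> y _ /=; rewrite lee_fin (le_trans (dom x y)) // -normrM ler_norm //.
Qed.

Lemma CI_fubini (F : R * R -> C) (g h : R -> R) : Cmeas F ->
  Rable g -> Rable h -> (forall x y, nc (F (x, y)) <= g x * h y) ->
  CI (fun x => CI (fun y => F (x, y))) = CI (fun y => CI (fun x => F (x, y))).
Proof.
move=> [a b] ig ih dom; apply: complex_ext.
  apply: (RI_fubini (F := fun z => Re (F z)) a ig ih) => x y.
  exact: le_trans (nc_Re _) (dom x y).
apply: (RI_fubini (F := fun z => Im (F z)) b ig ih) => x y.
exact: le_trans (nc_Im _) (dom x y).
Qed.

Lemma Cmeas_pair1 d (T : measurableType d) (F : T * R -> C) x : Cmeas F ->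
  Cmeas (fun t => F (t, x)).
Proof. by move=> mF; apply: (Cmeas_comp mF); exact: pair2_measurable. Qed.
Lemma Cmeas_pair2 d (T : measurableType d) (F : T * R -> C) t : Cmeas F ->
  Cmeas (fun x => F (t, x)).
Proof. by move=> mF; apply: (Cmeas_comp mF); exact: pair1_measurable. Qed.

Lemma Cable_CI (F : R * R -> C) (g h : R -> R) : Cmeas F ->
  Rable g -> Rable h -> (forall x y, nc (F (x, y)) <= g x * h y) ->
  Cable (fun x => CI (fun y => F (x, y))).
Proof.
move=> mF ig ih dom; apply: (@Cable_dom _ _ (fun x => RI h * g x)).
- exact: Cmeas_CI.
- exact: RableZ.
- move=> x; rewrite mulrC -RIZ //; apply: CI_le_dom => //.
    exact: Cmeas_pair2.
  exact: RableZ.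
Qed.

End Fubini.

(** * Derivatives in epsilon-delta form *)

Section EpsDerive.
Variable K : numFieldType.
Implicit Types (f : K -> K) (z l : K).

Definition derivableK f z := derivable f z 1.
Definition derK f : K -> K := derive1 f.

(** Derivatives are handled below through this estimate, in which real and complex
    increments can be compared. *)
Lemma eps_derivable f z l :
  (forall e, 0 < e -> exists2 d, 0 < d &
    forall h, `|h| < d -> `|f (z + h) - f z - l * h| <= e * `|h|) ->
  derivableK f z /\ derK f z = l.
Proof.
move=> H.
have cv : (fun h => h^-1 *: (f (h + z) - f z)) @ 0^' --> l.
  apply/cvgrPdist_le => e e0; have [d d0 hd] := H e e0.
  rewrite near_withinE; apply/nbhs_ballP; exists d => //= h; rewrite /ball /= sub0r normrN.
  move=> hh h0.
  have hp : 0 < `|h| by rewrite normr_gt0.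
  rewrite -(ler_pM2r hp) -normrM mulrBl.
  rewrite -[(_ *: _) * h]/(h^-1 * (f (h + z) - f z) * h) mulrAC mulVf // mul1r.
  by rewrite -normrN opprB (addrC h z); exact: hd.
split; last exact: cvg_lim cv.
apply/cvg_ex; exists l.
suff -> : (fun h : K => h^-1 *: ((f \o shift z) (h *: 1) - f z)) =
          (fun h => h^-1 *: (f (h + z) - f z)) by [].
by apply/funext => h; rewrite /= /shift /= [h *: 1]mulr1.
Qed.

Lemma derivable_eps f z : derivableK f z ->
  forall e, 0 < e -> exists2 d, 0 < d &
    forall h, `|h| < d -> `|f (z + h) - f z - derK f z * h| <= e * `|h|.
Proof.
move=> df e e0.
have cv : (fun h => h^-1 *: (f (h + z) - f z)) @ 0^' --> derive1 f z.
  have -> : (fun h => h^-1 *: (f (h + z) - f z)) =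
    (fun h : K => h^-1 *: ((f \o shift z) (h *: 1) - f z)).
    by apply/funext => h; rewrite /= /shift /= [h *: 1]mulr1.
  by rewrite derive1E; exact: df.
move/cvgrPdist_le : cv => /(_ e e0).
rewrite near_withinE => /nbhs_ballP[d /= d0 hd]; exists d => // h hh.
have [->|h0] := eqVneq h 0; first by rewrite addr0 subrr sub0r mulr0 oppr0 !normr0 mulr0.
have := hd h; rewrite /ball /= sub0r normrN => /(_ hh h0).
have hp : 0 < `|h| by rewrite normr_gt0.
rewrite -(ler_pM2r hp) -normrM mulrBl.
rewrite -[(_ *: _) * h]/(h^-1 * (f (h + z) - f z) * h) mulrAC mulVf // mul1r.
by rewrite -normrN opprB (addrC h z).
Qed.
End EpsDerive.

Section Derivatives.
Variable R : realType.
Local Notation C := R[i].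
Local Notation Re := (@complex.Re R).
Local Notation Im := (@complex.Im R).
Local Notation nc := (@Normc.normc R).

(** Differentiability and continuity with respect to a complex and to a real variable,
    with the real-valued modulus on both sides. *)
Definition Cd (f : C -> C) (z l : C) := forall e : R, 0 < e -> exists2 d : R, 0 < d &
  forall h, nc h < d -> nc (f (z + h) - f z - l * h) <= e * nc h.
Definition Rd (f : R -> C) (t : R) (l : C) := forall e : R, 0 < e -> exists2 d : R, 0 < d &
  forall h : R, `|h| < d -> nc (f (t + h) - f t - l * h%:C) <= e * `|h|.
Definition Ccont (f : C -> C) (z : C) := forall e : R, 0 < e -> exists2 d : R, 0 < d &
  forall h, nc h < d -> nc (f (z + h) - f z) <= e.
Definition Rcont (f : R -> C) (t : R) := forall e : R, 0 < e -> exists2 d : R, 0 < d &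
  forall h : R, `|h| < d -> nc (f (t + h) - f t) <= e.

Lemma Cd_derivable f z l : Cd f z l -> derivableK f z /\ derK f z = l.
Proof.
move=> H; apply: eps_derivable => e e0.
have eR : e = (Re e)%:C by rewrite RRe_real // gtr0_real.
have [|d d0 hd] := H (Re e); first by rewrite -ltcR -eR.
exists d%:C; first by rewrite ltcR.
move=> h; rewrite !nc_norm ltcR => /hd hh.
by rewrite eR -rmorphM lecR.
Qed.

Lemma derivable_Cd f z : derivableK f z -> Cd f z (derK f z).
Proof.
move=> df e e0; have [|d d0 hd] := derivable_eps df (e := e%:C); first by rewrite ltcR.
have dR : d = (Re d)%:C by rewrite RRe_real // gtr0_real.
exists (Re d); first by rewrite -ltcR -dR.
move=> h hh; have := hd h; rewrite !nc_norm dR ltcR => /(_ hh).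
by rewrite -rmorphM lecR.
Qed.

Lemma Cd_cont f z l : Cd f z l -> Ccont f z.
Proof.
move=> H e e0; have [d d0 hd] := H 1 ltr01.
have k0 : 0 < 1 + nc l + 1 by have := nc_ge0 l; lra.
exists (Num.min d (e / (1 + nc l + 1))).
  by rewrite lt_min d0 divr_gt0.
move=> h; rewrite lt_min => /andP[h1 h2].
have := hd h h1; rewrite mul1r => h3.
rewrite ltr_pdivlMr // in h2.
have -> : f (z + h) - f z = (f (z + h) - f z - l * h) + l * h by rewrite subrK.
apply: le_trans (ncD _ _) _; rewrite ncM.
have := nc_ge0 h; lra.
Qed.

Lemma Rd_cont f t l : Rd f t l -> Rcont f t.
Proof.
move=> H e e0; have [d d0 hd] := H 1 ltr01.
have k0 : 0 < 1 + nc l + 1 by have := nc_ge0 l; lra.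
exists (Num.min d (e / (1 + nc l + 1))).
  by rewrite lt_min d0 divr_gt0.
move=> h; rewrite lt_min => /andP[h1 h2].
have := hd h h1; rewrite mul1r => h3.
rewrite ltr_pdivlMr // in h2.
have -> : f (t + h) - f t = (f (t + h) - f t - l * h%:C) + l * h%:C by rewrite subrK.
apply: le_trans (ncD _ _) _; rewrite ncM nc_real.
have := normr_ge0 h; lra.
Qed.

Lemma Rcont_continuous f : (forall t, Rcont f t) ->
  continuous (fun t => Re (f t)) /\ continuous (fun t => Im (f t)).
Proof.
move=> H; split=> t; apply/cvgrPdist_le => e e0; have [d d0 hd] := H t e e0;
  apply/nbhs_ballP; exists d => //= x; rewrite /ball /= => hx.
  have := hd (x - t); rewrite distrC => /(_ hx).
  by rewrite subrKC distrC -cReB; apply: le_trans; exact: nc_Re.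
have := hd (x - t); rewrite distrC => /(_ hx).
by rewrite subrKC distrC -cImB; apply: le_trans; exact: nc_Im.
Qed.

Lemma Rcont_meas f : (forall t, Rcont f t) -> Cmeas f.
Proof.
by move/Rcont_continuous => [a b]; split; exact: continuous_measurable_fun.
Qed.

Lemma Rd_is_derive (f : R -> C) (t : R) (l : C) : Rd f t l ->
  is_derive t 1 (fun t => Re (f t)) (Re l) /\ is_derive t 1 (fun t => Im (f t)) (Im l).
Proof.
move=> H; split.
- have [|a b] := @eps_derivable R (fun t => Re (f t)) t (Re l).
    move=> e e0; have [d d0 hd] := H e e0; exists d => // h /hd hh.
    apply: le_trans hh; apply: le_trans _ (nc_Re _).
    by rewrite !cReB cReM Re_real Im_real mulr0 subr0.
  by apply: DeriveDef => //; rewrite -derive1E.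
- have [|a b] := @eps_derivable R (fun t => Im (f t)) t (Im l).
    move=> e e0; have [d d0 hd] := H e e0; exists d => // h /hd hh.
    apply: le_trans hh; apply: le_trans _ (nc_Im _).
    by rewrite !cImB cImM Re_real Im_real mulr0 add0r.
  by apply: DeriveDef => //; rewrite -derive1E.
Qed.

Lemma is_derive_Rd (f : R -> C) (t : R) (l : C) : is_derive t 1 (fun t => Re (f t)) (Re l) ->
  is_derive t 1 (fun t => Im (f t)) (Im l) -> Rd f t l.
Proof.
move=> [a a'] [b b'] e e0.
rewrite -derive1E in a'; rewrite -derive1E in b'.
have e2 : 0 < e / 2 by lra.
have [d d0 hd] := derivable_eps a e2.
have [d' d'0 hd'] := derivable_eps b e2.
exists (Num.min d d'); first by rewrite lt_min d0.
move=> h; rewrite lt_min => /andP[/hd h1 /hd' h2].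
rewrite /derK a' in h1; rewrite /derK b' in h2.
apply: le_trans (nc_ReIm _) _.
rewrite !cReB !cImB cReM cImM Re_real Im_real !mulr0 subr0 add0r.
by apply: le_trans (lerD h1 h2) _; lra.
Qed.

(** The common core of the chain rules for real and complex variables: only the size s h
    of the increment matters, which may therefore have any type. *)
Lemma chain_eps (T : Type) (s : T -> R) (w k : T -> C) (G : C -> C) (p l : C) (m : R) :
  (forall h, 0 <= s h) -> (forall h, nc (k h) <= m * s h) ->
  (forall e : R, 0 < e -> exists2 d : R, 0 < d &
     forall h, s h < d -> nc (w h - k h) <= e * s h) ->
  Cd G p l ->
  forall e : R, 0 < e -> exists2 d : R, 0 < d &
     forall h, s h < d -> nc (G (p + w h) - G p - l * k h) <= e * s h.
Proof.
move=> s0 hk hw HG e e0.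
pose K := `|m| + 1; have K0 : 0 < K by rewrite /K; have := normr_ge0 m; lra.
pose l1 := nc l + 1; have l0 : 0 < l1 by rewrite /l1; have := nc_ge0 l; lra.
have e2 : 0 < e / 2 by lra.
have [d d0 hd] := HG (e / 2 / K) (divr_gt0 e2 K0).
pose e1 := Num.min 1 (e / 2 / l1).
have e10 : 0 < e1 by rewrite lt_min ltr01 !divr_gt0.
have [d' d'0 hd'] := hw e1 e10.
exists (Num.min d' (d / K)); first by rewrite lt_min d'0 divr_gt0.
move=> h; rewrite lt_min => /andP[/hd' h1 h2].
rewrite ltr_pdivlMr // in h2.
have wb : nc (w h) <= K * s h.
  have -> : w h = (w h - k h) + k h by rewrite subrK.
  apply: le_trans (ncD _ _) _; rewrite /K.
  have : e1 <= 1 by rewrite ge_min lexx.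
  have := hk h; have := s0 h; have := ler_norm m; nra.
have h3 : nc (G (p + w h) - G p - l * w h) <= e / 2 * s h.
  apply: le_trans (hd _ _) _; first by apply: le_lt_trans wb _; rewrite mulrC.
  have : e / 2 / K * nc (w h) <= e / 2 / K * (K * s h).
    by rewrite ler_pM2l // !divr_gt0.
  by rewrite mulrA divfK // gt_eqF.
have h4 : nc (l * (w h - k h)) <= e / 2 * s h.
  rewrite ncM; have : nc l * nc (w h - k h) <= l1 * (e1 * s h).
    by apply: ler_pM; rewrite ?nc_ge0 // /l1; lra.
  move/le_trans; apply.
  rewrite mulrA ler_wpM2r //.
  have : e1 <= e / 2 / l1 by rewrite ge_min lexx orbT.
  by rewrite ler_pdivlMr // mulrC.
have -> : G (p + w h) - G p - l * k h =
  (G (p + w h) - G p - l * w h) + l * (w h - k h) by ring.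
apply: le_trans (ncD _ _) _; lra.
Qed.

Lemma Rd_comp (G : C -> C) (g : R -> C) t l m : Cd G (g t) l -> Rd g t m ->
  Rd (fun t => G (g t)) t (l * m).
Proof.
move=> HG Hg e e0.
have [|d d0 hd] := @chain_eps R (fun h : R => `|h|) (fun h => g (t + h) - g t) (fun h => m * h%:C)
  G (g t) l (nc m) (fun h : R => normr_ge0 h) _ Hg HG e e0.
  by move=> h; rewrite ncM nc_real.
by exists d => // h /hd; rewrite subrKC mulrA.
Qed.

Lemma Cd_comp (G g : C -> C) z l m : Cd G (g z) l -> Cd g z m ->
  Cd (fun z => G (g z)) z (l * m).
Proof.
move=> HG Hg e e0.
have [|d d0 hd] := @chain_eps C nc (fun h => g (z + h) - g z) (fun h => m * h)
  G (g z) l (nc m) (@nc_ge0 R) _ Hg HG e e0.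
  by move=> h; rewrite ncM.
by exists d => // h /hd; rewrite subrKC mulrA.
Qed.

Lemma Rd_line (z v : C) t : Rd (fun t => z + v * t%:C) t v.
Proof.
move=> e e0; exists 1 => // h _.
rewrite rmorphD /= (_ : _ - _ = 0); first by rewrite nc0 mulr_ge0 // ltW.
by ring.
Qed.

(** Multiplication by the conjugate of the increment of f reduces the bound to the mean
    value theorem for a real function of t. *)
Lemma C_mean_value (f df : C -> C) (z h : C) (B : R) :
  (forall t : R, 0 <= t <= 1 -> Cd f (z + h * t%:C) (df (z + h * t%:C))) ->
  (forall t : R, 0 <= t <= 1 -> nc (df (z + h * t%:C)) <= B) ->
  nc (f (z + h) - f z) <= B * nc h.
Proof.
move=> Hd HB; set w := f (z + h) - f z.
have [->|w0] := eqVneq w 0.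
  rewrite nc0 mulr_ge0 ?nc_ge0 //; apply: le_trans (nc_ge0 _) (HB 0 _).
  by rewrite lexx ler01.
have wp := nc_gt0 w0.
pose phi (t : R) : C := w^*%C * f (z + h * t%:C).
have Hphi t : 0 <= t <= 1 -> Rd phi t (w^*%C * (df (z + h * t%:C) * h)).
  move=> t01 e e0.
  have [d d0 hd] := Rd_comp (Hd t t01) (@Rd_line z h t) (divr_gt0 e0 wp).
  exists d => // k /hd hk; rewrite /phi.
  have -> : w^*%C * f (z + h * (t + k)%:C) - w^*%C * f (z + h * t%:C) -
     w^*%C * (df (z + h * t%:C) * h) * k%:C =
     w^*%C * (f (z + h * (t + k)%:C) - f (z + h * t%:C) - df (z + h * t%:C) * h * k%:C) by ring.
  by rewrite ncM nc_conj mulrC -ler_pdivlMr //; apply: le_trans hk _; rewrite mulrAC.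
have [||c c01 hc] := @MVT R (fun t => Re (phi t))
    (fun t => Re (w^*%C * (df (z + h * t%:C) * h))) 0 1 ltr01.
- move=> x; rewrite in_itv /= => /andP[/ltW x0 /ltW x1].
  by have [] := Rd_is_derive (Hphi x (introT andP (conj x0 x1))).
- apply: derivable_within_continuous => x; rewrite in_itv /= => x01.
  by have [[]] := Rd_is_derive (Hphi x x01).
rewrite /phi -cReB rmorph1 rmorph0 mulr1 mulr0 addr0 subr0 mulr1 -mulrBr -/w ReV_conj in hc.
move: c01; rewrite in_itv /= => /andP[/ltW c0 /ltW c1].
have := HB c (introT andP (conj c0 c1)) => hB.
rewrite -(ler_pM2l wp) -expr2 hc; apply: le_trans (ler_norm _) (le_trans (nc_Re _) _).
rewrite !ncM nc_conj ler_pM2l //.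
by rewrite ler_wpM2r // nc_ge0.
Qed.

End Derivatives.

(** * The exponential function and integrals over intervals *)

Section Exponential.
Variable R : realType.
Local Notation C := R[i].
Local Notation Re := (@complex.Re R).
Local Notation Im := (@complex.Im R).
Local Notation nc := (@Normc.normc R).
Local Notation mu := (@lebesgue_measure R).

Lemma cexpD (z w : C) : cexp (z + w) = cexp z * cexp w.
Proof.
case: z w => [a b] [c d]; rewrite /cexp /= expRD cosD sinD.
by apply: complex_ext => /=; ring.
Qed.
Lemma cexp0 : cexp (0 : C) = 1.
Proof. by rewrite /cexp /= expR0 cos0 sin0 mulr1 mulr0. Qed.
Lemma cexpNM (z : C) : cexp (- z) * cexp z = 1.
Proof. by rewrite -cexpD addNr cexp0. Qed.
Lemma nc_cexp (z : C) : nc (cexp z) = expR (Re z).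
Proof.
rewrite /cexp /= !exprMn -mulrDr cos2Dsin2 mulr1 sqrtr_sqr ger0_norm //.
Qed.
Lemma cexp_neq0 (z : C) : cexp z != 0.
Proof.
apply/eqP => h; have := cexpNM z; rewrite h mulr0 => /eqP.
by rewrite eq_sym oner_eq0.
Qed.

Lemma Cd_cexp0 (e : R) : 0 < e -> exists2 d : R, 0 < d &
  forall h : C, nc h < d -> nc (cexp h - 1 - h) <= e * nc h.
Proof.
move=> e0.
have [dE vE] : derivableK (@expR R) 0 /\ derK (@expR R) 0 = 1.
  split; first exact: derivable_expR.
  by rewrite /derK derive1E; have [_ ->] := is_derive_expR (0 : R); rewrite expR0.
have Rt : Rd (fun b : R => cos b +i* sin b) 0 (0 +i* 1).
  apply: is_derive_Rd => /=.
    by have := is_derive_cos (0 : R); rewrite sin0 oppr0.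
  by have := is_derive_sin (0 : R); rewrite cos0.
have e3 : 0 < e / 3 by lra.
have [d1 d10 h1] := derivable_eps dE e3.
have [d2 d20 h2] := Rt _ e3.
have [d3 d30 h3] := Rd_cont Rt e3.
exists (Num.min d1 (Num.min d2 d3)); first by rewrite !lt_min d10 d20.
move=> [a b]; rewrite !lt_min => /and3P[k1 k2 k3].
have ha : `|a| <= nc (a +i* b) by exact: (nc_Re (a +i* b)).
have hb : `|b| <= nc (a +i* b) by exact: (nc_Im (a +i* b)).
have {}h1 := h1 a (le_lt_trans ha k1).
have {}h2 := h2 b (le_lt_trans hb k2).
have {}h3 := h3 b (le_lt_trans hb k3).
rewrite add0r vE expR0 mul1r in h1.
rewrite add0r cos0 sin0 in h2; rewrite add0r cos0 sin0 in h3.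
pose E := cos b +i* sin b.
have nE : nc E = 1 by rewrite /= cos2Dsin2 sqrtr1.
have -> : cexp (a +i* b) - 1 - (a +i* b) =
  (expR a - 1 - a)%:C * E + a%:C * (E - 1) + (E - 1 - (0 +i* 1) * b%:C).
  by apply: complex_ext; rewrite /cexp /E /=; ring.
apply: le_trans (ncD _ _) _.
apply: le_trans (lerD (ncD _ _) (lexx _)) _.
rewrite ncM nE mulr1 ncM !nc_real.
have -> : e * nc (a +i* b) = e/3 * nc (a +i* b) + e/3 * nc (a +i* b) + e/3 * nc (a +i* b) by field.
apply: lerD; first apply: lerD.
- by apply: le_trans h1 _; rewrite ler_pM2l.
- rewrite mulrC; apply: ler_pM; rewrite ?nc_ge0 //.
- by apply: le_trans h2 _; rewrite ler_pM2l.
Qed.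

Lemma Cd_cexp (z : C) : Cd (@cexp R) z (cexp z).
Proof.
move=> e e0; have p := nc_gt0 (cexp_neq0 z).
have [d d0 hd] := Cd_cexp0 (divr_gt0 e0 p).
exists d => // h /hd hh.
have -> : cexp (z + h) - cexp z - cexp z * h = cexp z * (cexp h - 1 - h).
  by rewrite cexpD; ring.
rewrite ncM -ler_pdivlMl //; apply: le_trans hh _.
by rewrite mulrA [_^-1 * _]mulrC.
Qed.

Lemma cexp_nc_le (z : C) : nc (cexp z) <= expR (nc z).
Proof. by rewrite nc_cexp ler_expR; apply: le_trans (ler_norm _) (nc_Re _). Qed.

End Exponential.

Section Interval.
Variable R : realType.
Local Notation C := R[i].
Local Notation Re := (@complex.Re R).
Local Notation Im := (@complex.Im R).
Local Notation nc := (@Normc.normc R).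
Local Notation mu := (@lebesgue_measure R).
Implicit Types f g : R -> C.

Definition oo (a b x : R) : C := ((a < x) && (x < b))%:R.
Definition Iv f a b : C := CI (fun x => oo a b x * f x).

Lemma nc_oo a b x : nc (oo a b x) = ((a < x) && (x < b))%:R.
Proof. exact: nc_boolE. Qed.
Lemma nc_oo_le1 a b x : nc (oo a b x) <= 1.
Proof. exact: nc_bool. Qed.

Lemma Iv_Cintegral f a b : Iv f a b = Cintegral `]a, b[ f.
Proof. by rewrite Cintegral_oo. Qed.

Lemma eq_Iv f g a b : (forall x, a < x -> x < b -> f x = g x) -> Iv f a b = Iv g a b.
Proof.
move=> h; apply: eq_CI => x; rewrite /oo.
case: (ltP a x) => ax; last by rewrite !mul0r.
by case: (ltP x b) => xb; rewrite ?mul0r // h.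
Qed.

Lemma Iv_le f (a b B : R) : a <= b -> Cmeas f ->
  (forall x, a < x -> x < b -> nc (f x) <= B) -> nc (Iv f a b) <= B * (b - a).
Proof.
move=> ab mf hB; rewrite -(RI_oo ab) -RIZ; last exact: Rable_oo.
apply: CI_le_dom.
- by apply: CmeasM => //; exact: Cmeas_oo.
- by apply: RableZ; exact: Rable_oo.
- move=> x; rewrite ncM nc_oo mulrC.
  case: (ltP a x) => ax; case: (ltP x b) => xb; rewrite ?mulr0 ?mulr1 ?hB //.
Qed.

Lemma ae_neq (m : R) : {ae mu, forall x : R, x != m}.
Proof.
exists [set m]; split => //; first exact: lebesgue_measure_set1.
by move=> x /= /negP; rewrite negbK => /eqP.
Qed.

Lemma Iv_split f (a m b : R) : a <= m -> m <= b -> Cable (fun x => oo a b x * f x) ->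
  Iv f a b = Iv f a m + Iv f m b.
Proof.
move=> am mb cf.
have h1 : Cable (fun x => oo a m x * f x).
  apply: Cable_eq (Cable_ooM a m cf) => x; rewrite /oo mulrA -natrM mulnb.
  congr (_%:R * _); case: (ltP a x) => //= _.
  by case: (ltP x m) => //= xm; rewrite (lt_le_trans xm mb).
have h2 : Cable (fun x => oo m b x * f x).
  apply: Cable_eq (Cable_ooM m b cf) => x; rewrite /oo mulrA -natrM mulnb.
  congr (_%:R * _); case: (ltP x b) => //= _; rewrite ?andbF // !andbT.
  by case: (ltP m x) => //= mx; rewrite (le_lt_trans am mx).
rewrite /Iv -CID //; apply: CI_ae.
- exact: Cable_meas.
- by apply: CmeasD; exact: Cable_meas.
- apply: (@filterS _ _ (ae_filter_ringOfSetsType mu) _ _ _ (ae_neq m)) => x xm.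
  rewrite -mulrDl /oo -natrD; congr (_%:R * _).
  have [xm'|mx|e] := ltgtP x m; last by rewrite e eqxx in xm.
    by rewrite (lt_le_trans xm' mb) !andbT addn0.
  by rewrite (le_lt_trans am mx) andbF add0n.
Qed.

Lemma FTC (F f : R -> C) (a b : R) : a <= b -> (forall t, Rd F t (f t)) ->
  (forall t, Rcont f t) -> Iv f a b = F b - F a.
Proof.
rewrite le_eqVlt => /predU1P[->|ab] dF cf.
  rewrite subrr /Iv -[RHS](@CI0 R); apply: eq_CI => x; rewrite /oo.
  by have [xb|xb] := ltP x b; rewrite ?andbF ?mul0r // (le_gtF (ltW xb)) mul0r.
have [c1 c2] := Rcont_continuous cf.
have real (u U : R -> R) : continuous u -> (forall t : R, is_derive t 1 U (u t)) ->
    RI (fun x => ((a < x) && (x < b))%:R * u x) = U b - U a.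
  move=> cu dU.
  have cU : continuous U.
    by move=> t; apply/differentiable_continuous/derivable1_diffP; case: (dU t).
  have h := @continuous_FTC2 R u U a b ab.
  have iu : mu.-integrable `[a, b] (EFin \o u).
    by apply: continuous_compact_integrable; [exact: segment_compact|exact: continuous_subspaceT].
  transitivity (Rintegral mu `]a, b[ u).
    rewrite /RI [RHS]Rintegral_mkcond; congr Rintegral; apply/funext => x.
    rewrite /patch; case: ifP => [|].
      by rewrite inE /= in_itv /= => ->; rewrite mul1r.
    by move/negP; rewrite inE /= in_itv /= => /negP/negPf ->; rewrite mul0r.
  rewrite Rintegral_itv_bndo_bndc; last first.
    apply: integrableS iu => //; exact: subset_itv_oo_cc.
  rewrite Rintegral_itv_obnd_cbnd; last first.
    apply: integrableS iu => //; exact: subset_itv_oc_cc.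
  rewrite /Rintegral h //.
  - exact: continuous_subspaceT.
  - split; first by move=> x _; case: (dU x).
      exact: cvg_at_right_filter (cU a).
    exact: cvg_at_left_filter (cU b).
  - by move=> x _; rewrite derive1E; case: (dU x).
apply: complex_ext.
  have e1 := real _ (fun t => Re (F t)) c1 (fun t => proj1 (Rd_is_derive (dF t))).
  rewrite cReB -e1.
  rewrite Re_CI; congr RI; apply/funext => x.
  by rewrite cReM Re_bool Im_bool mul0r subr0.
have e2 := real _ (fun t => Im (F t)) c2 (fun t => proj2 (Rd_is_derive (dF t))).
rewrite cImB -e2.
rewrite Im_CI; congr RI; apply/funext => x.
by rewrite cImM Re_bool Im_bool mul0r addr0.
Qed.

End Interval.

(** * Bisection of rectangles *)

Section Bisection.
Variable R : realType.

Lemma half_pow_small (x d : R) : 0 < d -> exists n, x / 2 ^+ n < d.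
Proof.
move=> d0.
have h0 : 0 <= `|x| / d by rewrite divr_ge0 // ltW.
exists (Num.Def.archi_bound (`|x| / d)).
set n := Num.Def.archi_bound _.
have : `|x| / d < n%:R := archi_boundP h0.
rewrite ltr_pdivrMr // => h.
rewrite ltr_pdivrMr ?exprn_gt0 //.
apply: le_lt_trans (ler_norm _) _; apply: lt_le_trans h _.
rewrite mulrC ler_pM2l // -natrX ler_nat ltnW // ltn_expl //.
Qed.

(** Compactness of a rectangle, in the form in which it is used for integrals and
    bounds: if P failed on a rectangle, it would fail on nested quarters that shrink to
    a point. *)
Lemma bisection (P : R -> R -> R -> R -> Prop) (a0 b0 c0 d0 : R) :
  a0 <= b0 -> c0 <= d0 ->
  (forall a b c d, a <= b -> c <= d ->
     P a ((a + b) / 2) c ((c + d) / 2) -> P ((a + b) / 2) b c ((c + d) / 2) ->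
     P a ((a + b) / 2) ((c + d) / 2) d -> P ((a + b) / 2) b ((c + d) / 2) d ->
     P a b c d) ->
  (forall x y, exists2 e, 0 < e & forall a b c d,
     a <= x <= b -> c <= y <= d -> b - a < e -> d - c < e -> P a b c d) ->
  P a0 b0 c0 d0.
Proof.
move=> ab0 cd0 Hsub Hloc; apply: contrapT => nP.
pose Q (r : (R * R) * (R * R)) := P r.1.1 r.1.2 r.2.1 r.2.2.
pose ok (r : (R * R) * (R * R)) := r.1.1 <= r.1.2 /\ r.2.1 <= r.2.2.
pose child (r r' : (R * R) * (R * R)) :=
  let m := (r.1.1 + r.1.2) / 2 in let n := (r.2.1 + r.2.2) / 2 in
  (r'.1 = (r.1.1, m) \/ r'.1 = (m, r.1.2)) /\
  (r'.2 = (r.2.1, n) \/ r'.2 = (n, r.2.2)).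
have step r : ok r -> ~ Q r -> exists r', child r r' /\ ~ Q r'.
  case: r => [[a b] [c d]] [/= ab cd] nQ.
  apply: contrapT => /forallNP H; apply: nQ; rewrite /Q /=.
  have H' r' : child ((a, b), (c, d)) r' -> Q r'.
    by move=> hr; apply: contrapT => nq; apply: (H r').
  apply: Hsub => //.
  - by apply: (H' ((a, (a + b) / 2), (c, (c + d) / 2))); split; [left|left].
  - by apply: (H' (((a + b) / 2, b), (c, (c + d) / 2))); split; [right|left].
  - by apply: (H' ((a, (a + b) / 2), ((c + d) / 2, d))); split; [left|right].
  - by apply: (H' (((a + b) / 2, b), ((c + d) / 2, d))); split; [right|right].
have /choice[nx Hnx] : forall r, exists r', ok r -> ~ Q r -> child r r' /\ ~ Q r'.
  move=> r; have [h1|h1] := pselect (ok r /\ ~ Q r).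
    by case: h1 => h1 h2; have [r' hr'] := step r h1 h2; exists r'.
  by exists r => u v; exfalso; apply: h1.
pose r0 := ((a0, b0), (c0, d0)).
pose s n := iter n nx r0.
have ch_ok r r' : ok r -> child r r' -> [/\ ok r', r.1.1 <= r'.1.1, r'.1.2 <= r.1.2,
    r.2.1 <= r'.2.1 & r'.2.2 <= r.2.2] /\
    (r'.1.2 - r'.1.1 = (r.1.2 - r.1.1) / 2 /\ r'.2.2 - r'.2.1 = (r.2.2 - r.2.1) / 2).
  case: r r' => [[a b] [c d]] [r1 r2] [/= ab cd] [/= h1 h2].
  by case: h1 => ->; case: h2 => -> /=; (split; [split => //=; try lra; split => /=; lra|split; lra]).
have Hs n : ok (s n) /\ ~ Q (s n).
  elim: n => [|n [IH1 IH2]]; first by split.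
  have [h1 h2] := Hnx (s n) IH1 IH2.
  by split => //; have [ []] := ch_ok _ _ IH1 h1.
have Hch n : child (s n) (s n.+1).
  by have [h1 h2] := Hs n; have [] := Hnx (s n) h1 h2.
have wid n : (s n).1.2 - (s n).1.1 = (b0 - a0) / 2 ^+ n /\
    (s n).2.2 - (s n).2.1 = (d0 - c0) / 2 ^+ n.
  elim: n => [|n [IH1 IH2]]; first by rewrite expr0 !divr1.
  have [_ [-> ->]] := ch_ok _ _ (Hs n).1 (Hch n).
  by rewrite IH1 IH2 exprSr !invfM !mulrA.
have mono n k : [/\ (s n).1.1 <= (s (n + k)%N).1.1, (s (n + k)%N).1.2 <= (s n).1.2,
    (s n).2.1 <= (s (n + k)%N).2.1 & (s (n + k)%N).2.2 <= (s n).2.2].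
  elim: k => [|k [h1 h2 h3 h4]]; first by rewrite addn0.
  have [ [kk0 k1 k2 k3 k4] kk] := ch_ok _ _ (Hs (n + k)%N).1 (Hch (n + k)%N).
  rewrite addnS; split.
  - exact: le_trans h1 k1.
  - exact: le_trans k2 h2.
  - exact: le_trans h3 k3.
  - exact: le_trans k4 h4.
have cross n m : (s n).1.1 <= (s m).1.2 /\ (s n).2.1 <= (s m).2.2.
  have [h1 _ h3 _] := mono n m; have [_ k2 _ k4] := mono m n.
  rewrite addnC in k2 k4; have [ [q1 q2] _] := Hs (n + m)%N.
  by split; [exact: le_trans h1 (le_trans q1 k2)|exact: le_trans h3 (le_trans q2 k4)].
have lim (u v : nat -> R) : (forall n m, u n <= v m) -> exists x, forall n, u n <= x <= v n.
  move=> uv; exists (sup (range u)) => n.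
  have hs : has_sup (range u).
    split; first by exists (u 0%N), 0%N.
    by exists (v 0%N) => _ [m _ <-]; exact: uv.
  apply/andP; split.
    by apply: ub_le_sup; [case: hs|exists n].
  apply: ge_sup; first by case: hs.
  by move=> _ [m _ <-].
have [x hx] := lim (fun n => (s n).1.1) (fun n => (s n).1.2) (fun n m => (cross n m).1).
have [y hy] := lim (fun n => (s n).2.1) (fun n => (s n).2.2) (fun n m => (cross n m).2).
have [e e0 he] := Hloc x y.
have [n hn] := half_pow_small ((b0 - a0) + (d0 - c0)) e0.
apply: (Hs n).2; apply: he (hx n) (hy n) _ _.
  rewrite (wid n).1; apply: le_lt_trans hn; rewrite ler_pM2r ?invr_gt0 ?exprn_gt0 //; lra.
rewrite (wid n).2; apply: le_lt_trans hn; rewrite ler_pM2r ?invr_gt0 ?exprn_gt0 //; lra.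
Qed.
End Bisection.

(** * Goursat's theorem *)

Section Goursat.
Variable R : realType.
Local Notation C := R[i].
Local Notation nc := (@Normc.normc R).
Local Notation ii := (0 +i* 1 : C).
Implicit Types f G : C -> C.

Lemma ii2 : ii * ii = -1.
Proof. by apply: complex_ext => /=; ring. Qed.
Lemma complexXY (x y : R) : x +i* y = x%:C + ii * y%:C.
Proof. by apply: complex_ext => /=; ring. Qed.
Lemma nc_ii : nc ii = 1.
Proof. by rewrite /= expr0n /= add0r expr1n sqrtr1. Qed.

Lemma Cable_cont (f : R -> C) a b : (forall t, Rcont f t) -> Cable (fun x => oo a b x * f x).
Proof.
move=> cf; have [c1 c2] := Rcont_continuous cf.
have real (u : R -> R) : continuous u -> Rable (fun x => ((a < x) && (x < b))%:R * u x).
  move=> cu; have [ab|ba] := leP a b; last first.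
    apply: Rable_eq (@Rable0 R) => x; case: (ltP a x) => ax; last by rewrite mul0r.
    by rewrite (le_gtF (ltW (lt_trans ba ax))) mul0r.
  have cu' : {within `[a, b], continuous u} by exact: continuous_subspaceT.
  have [p _ hp] := EVT_max ab cu'; have [n _ hn] := EVT_min ab cu'.
  apply: (Rable_dom _ (RableZ (`|u p| + `|u n|) (Rable_oo a b))).
    apply: measurable_funM; first exact: Rable_meas (Rable_oo a b).
    exact: continuous_measurable_fun.
  move=> x; case: (ltP a x) => ax; last by rewrite mul0r normr0 mulr0.
  case: (ltP x b) => xb; last by rewrite mul0r normr0 mulr0.
  have xab : x \in `[a, b]%R by rewrite in_itv /= !ltW.
  have := hp x xab; have := hn x xab; have := ler_norm (u p).
  have := ler_norm (- u n); rewrite normrN mul1r mulr1 ler_norml.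
  have := normr_ge0 (u p); have := normr_ge0 (u n).
  by move=> *; apply/andP; split; lra.
split.
  apply: Rable_eq (real _ c1) => x.
  by rewrite cReM Re_bool Im_bool mul0r subr0.
apply: Rable_eq (real _ c2) => x.
by rewrite cImM Re_bool Im_bool mul0r addr0.
Qed.

Lemma Ccont_line f (z v : C) t : Ccont f (z + v * t%:C) -> Rcont (fun t => f (z + v * t%:C)) t.
Proof.
move=> cf e e0; have [d d0 hd] := cf e e0.
have k0 : 0 < nc v + 1 by have := nc_ge0 v; lra.
exists (d / (nc v + 1)); first by rewrite divr_gt0.
move=> h; rewrite ltr_pdivlMr // => hh.
have := hd (v * h%:C); rewrite ncM nc_real.
have -> : z + v * t%:C + v * h%:C = z + v * (t + h)%:C by rewrite rmorphD /=; ring.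
apply; have := normr_ge0 h; nra.
Qed.

(** The integral of G along the boundary of the rectangle, counterclockwise. *)
Definition boundary G a b c d : C :=
  Iv (fun x => G (ii * c%:C + 1 * x%:C)) a b + ii * Iv (fun y => G (b%:C + ii * y%:C)) c d
  - Iv (fun x => G (ii * d%:C + 1 * x%:C)) a b - ii * Iv (fun y => G (a%:C + ii * y%:C)) c d.

Lemma Cd_quad (al l z : C) : Cd (fun z => al * z + l / 2 * z * z) z (al + l * z).
Proof.
move=> e e0; have k0 : 0 < nc l + 1 by have := nc_ge0 l; lra.
exists (e / (nc l + 1)); first by rewrite divr_gt0.
move=> h; rewrite ltr_pdivlMr // => hh.
have -> : al * (z + h) + l / 2 * (z + h) * (z + h) - (al * z + l / 2 * z * z) -
  (al + l * z) * h = l / 2 * h * h by field.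
rewrite !ncM ncV nc_nat -mulrA; have := nc_ge0 h; have := nc_ge0 l; nra.
Qed.

Lemma Cd_affine (al l z : C) : Cd (fun z => al + l * z) z l.
Proof.
move=> e e0; exists 1 => // h _; rewrite (_ : _ - _ = 0); last by ring.
by rewrite nc0 mulr_ge0 ?nc_ge0 // ltW.
Qed.

Lemma boundary_affine (al l : C) a b c d : a <= b -> c <= d ->
  boundary (fun z => al + l * z) a b c d = 0.
Proof.
move=> ab cd; pose P z := al * z + l / 2 * z * z.
have cl z v t : Rcont (fun t : R => al + l * (z + v * t%:C)) t.
  by apply: (@Ccont_line (fun z => al + l * z)); exact: Cd_cont (Cd_affine _ _ _).
have key z v s t : s <= t -> v * Iv (fun t => al + l * (z + v * t%:C)) s t =
   P (z + v * t%:C) - P (z + v * s%:C).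
  move=> st; rewrite /Iv -CIZ; last exact: Cable_cont.
  rewrite -(@FTC _ (fun t => P (z + v * t%:C)) (fun t => (al + l * (z + v * t%:C)) * v)) //.
  - by apply: eq_CI => x; ring.
  - by move=> u; apply: (Rd_comp (Cd_quad _ _ _)); exact: Rd_line.
  - move=> u e e0; have k0 : 0 < nc v + 1 by have := nc_ge0 v; lra.
    have [de de0 hde] := cl z v u (e / (nc v + 1)) (divr_gt0 e0 k0).
    exists de => // h /hde hh; rewrite -mulrBl ncM.
    rewrite ler_pdivlMr // in hh; apply: le_trans hh.
    by rewrite ler_wpM2l ?nc_ge0 //; lra.
rewrite /boundary -[Iv _ a b]mul1r key // key // -[X in _ - X - _]mul1r key // key //.
by rewrite !mul1r /P; ring.
Qed.

Lemma boundaryD G1 G2 a b c d : (forall z, Ccont G1 z) -> (forall z, Ccont G2 z) ->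
  boundary (fun z => G1 z + G2 z) a b c d = boundary G1 a b c d + boundary G2 a b c d.
Proof.
move=> c1 c2.
have IvD z v s t : Iv (fun x => G1 (z + v * x%:C) + G2 (z + v * x%:C)) s t =
    Iv (fun x => G1 (z + v * x%:C)) s t + Iv (fun x => G2 (z + v * x%:C)) s t.
  rewrite /Iv -CID; last 2 first.
  - by apply: Cable_cont => u; exact: Ccont_line.
  - by apply: Cable_cont => u; exact: Ccont_line.
  by apply: eq_CI => x; ring.
by rewrite /boundary !IvD; ring.
Qed.

Lemma boundary_split G a b c d : (forall z, Ccont G z) -> a <= b -> c <= d ->
  let m := (a + b) / 2 in let n := (c + d) / 2 in
  boundary G a b c d = boundary G a m c n + boundary G m b c n +
                       boundary G a m n d + boundary G m b n d.
Proof.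
move=> cG ab cd m n.
have am : a <= m by rewrite /m; lra.
have mb : m <= b by rewrite /m; lra.
have cn : c <= n by rewrite /n; lra.
have nd : n <= d by rewrite /n; lra.
have sp z v s u t : s <= u -> u <= t -> Iv (fun x => G (z + v * x%:C)) s t =
   Iv (fun x => G (z + v * x%:C)) s u + Iv (fun x => G (z + v * x%:C)) u t.
  move=> su ut; apply: Iv_split => //; apply: Cable_cont => w; exact: Ccont_line.
rewrite /boundary (sp _ _ a m b) // (sp _ _ c n d) //.
rewrite (sp (ii * d%:C) 1 a m b) // (sp a%:C ii c n d) //.
by ring.
Qed.

Lemma boundary_le G a b c d (B : R) : (forall z, Ccont G z) -> a <= b -> c <= d ->
  (forall x y, a <= x <= b -> c <= y <= d -> nc (G (x +i* y)) <= B) ->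
  nc (boundary G a b c d) <= 2 * B * ((b - a) + (d - c)).
Proof.
move=> cG ab cd hB.
have m z v : Cmeas (fun x : R => G (z + v * x%:C)).
  by apply: Rcont_meas => u; exact: Ccont_line.
have e1 y : c <= y <= d -> nc (Iv (fun x => G (ii * y%:C + 1 * x%:C)) a b) <= B * (b - a).
  move=> hy; apply: Iv_le => // x /ltW h1 /ltW h2.
  by rewrite addrC mul1r -complexXY hB // h1.
have e2 x : a <= x <= b -> nc (Iv (fun y => G (x%:C + ii * y%:C)) c d) <= B * (d - c).
  move=> hx; apply: Iv_le => // y /ltW h1 /ltW h2.
  by rewrite -complexXY hB // h1.
have h1 := e1 c; rewrite lexx cd in h1; have {}h1 := h1 isT.
have h2 := e1 d; rewrite lexx cd in h2; have {}h2 := h2 isT.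
have h3 := e2 a; rewrite lexx ab in h3; have {}h3 := h3 isT.
have h4 := e2 b; rewrite lexx ab in h4; have {}h4 := h4 isT.
rewrite /boundary.
apply: le_trans (ncB _ _) _; rewrite ncM nc_ii mul1r.
apply: le_trans (lerD (ncB _ _) (lexx _)) _.
apply: le_trans (lerD (lerD (ncD _ _) (lexx _)) (lexx _)) _.
rewrite ncM nc_ii mul1r; lra.
Qed.

(** Subtracting from G its expansion of first order at a point changes no boundary
    integral and leaves one that is small compared with the square of the perimeter.
    Such an estimate adds up exactly under bisection. *)
Theorem goursat G a b c d : (forall z, exists l, Cd G z l) -> a <= b -> c <= d ->
  boundary G a b c d = 0.
Proof.
move=> dG ab cd.
have cG z : Ccont G z by have [l /Cd_cont] := dG z.
apply: nc_eq0; apply/eqP; rewrite eq_le nc_ge0 andbT; apply/ler_addgt0Pr => e e0; rewrite add0r.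
pose k := ((b - a) + (d - c)) ^+ 2 + 1.
have k0 : 0 < k by rewrite /k; have := sqr_ge0 ((b - a) + (d - c)); lra.
suff : nc (boundary G a b c d) <= e / k * ((b - a) + (d - c)) ^+ 2.
  move/le_trans; apply; rewrite mulrAC ler_pdivrMr // ler_pM2l // /k; lra.
have ek : 0 < e / k by rewrite divr_gt0.
move: (e / k) ek => {}e {}e0 {k k0}.
apply: (@bisection R (fun a b c d => nc (boundary G a b c d) <= e * ((b - a) + (d - c)) ^+ 2)) => //.
  move=> {ab cd a b c d} a b c d ab cd h1 h2 h3 h4.
  rewrite boundary_split //.
  apply: le_trans (ncD _ _) _.
  apply: le_trans (lerD (ncD _ _) (lexx _)) _.
  apply: le_trans (lerD (lerD (ncD _ _) (lexx _)) (lexx _)) _.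
  apply: le_trans (lerD (lerD (lerD h1 h2) h3) h4) _.
  by rewrite le_eqVlt; apply/orP; left; apply/eqP; field.
move=> x y; have [l hl] := dG (x +i* y).
have e2 : 0 < e / 2 by lra.
have [de de0 hde] := hl _ e2.
exists (de / 2); first by lra.
move=> {ab cd a b c d} a b c d hx hy hw hh.
have ab : a <= b by move: hx => /andP[]; exact: le_trans.
have cd : c <= d by move: hy => /andP[]; exact: le_trans.
pose p := x +i* y.
pose r z := G z + (- (G p - l * p) + - l * z).
have cr z : Ccont (fun z => - (G p - l * p) + - l * z) z.
  exact: Cd_cont (Cd_affine _ _ _).
have : boundary r a b c d = boundary G a b c d.
  by rewrite boundaryD // boundary_affine // addr0.
move=> <-.
have -> : e * ((b - a) + (d - c)) ^+ 2 = 2 * (e / 2 * ((b - a) + (d - c))) * ((b - a) + (d - c)).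
  by field.
apply: boundary_le => //.
  move=> z e' e'0; have [l1 hl1] := dG z.
  have d1 : Cd r z (l1 + - l).
    move=> e1 e10; have [d1 d10 hd1] := hl1 e1 e10; exists d1 => // h /hd1 h1.
    by rewrite (_ : _ - _ = G (z + h) - G z - l1 * h) // /r; ring.
  exact: (Cd_cont d1).
move=> x' y' hx' hy'.
pose h := (x' +i* y') - p.
have hle : nc h <= (b - a) + (d - c).
  apply: le_trans (nc_ReIm _) _; apply: lerD.
    rewrite cReB /=; move: hx hx' => /andP[u1 u2] /andP[u3 u4].
    by rewrite ler_norml; apply/andP; split; lra.
  rewrite cImB /=; move: hy hy' => /andP[u1 u2] /andP[u3 u4].
  by rewrite ler_norml; apply/andP; split; lra.
have := hde h; rewrite -/p /h subrKC -/h => /(_ _).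
have hlt : nc h < de by apply: le_lt_trans hle _; lra.
move=> /(_ hlt) hh'.
have -> : r (x' +i* y') = G (x' +i* y') - G p - l * h by rewrite /r /h; ring.
apply: le_trans hh' _; rewrite ler_pM2l //.
Qed.

End Goursat.

(** * The mean value property *)

Section DerivableRules.
Variable K : numFieldType.
Implicit Types (f g : K -> K) (z : K).

Lemma derivableK_cst (a z : K) : derivableK (fun=> a) z.
Proof. exact: derivable_cst. Qed.
Lemma derivableK_id z : derivableK id z.
Proof. exact: derivable_id. Qed.
Lemma derivableKD f g z : derivableK f z -> derivableK g z ->
  derivableK (fun x => f x + g x) z.
Proof. exact: derivableD. Qed.
Lemma derivableKM f g z : derivableK f z -> derivableK g z ->
  derivableK (fun x => f x * g x) z.
Proof. exact: derivableM. Qed.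
Lemma derivableKN f z : derivableK f z -> derivableK (fun x => - f x) z.
Proof. exact: derivableN. Qed.
Lemma derivableKB f g z : derivableK f z -> derivableK g z ->
  derivableK (fun x => f x - g x) z.
Proof. by move=> df /derivableKN; exact: derivableKD. Qed.
Lemma derivableKV f z : f z != 0 -> derivableK f z -> derivableK (fun x => (f x)^-1) z.
Proof. exact: derivableV. Qed.
End DerivableRules.

Section Circle.
Variable R : realType.
Local Notation C := R[i].
Local Notation nc := (@Normc.normc R).
Local Notation ii := (0 +i* 1 : C).
Local Notation tau := (2 * pi : R).
Implicit Types f G : C -> C.

Lemma derivable_comp f G z : derivableK f (G z) -> derivableK G z ->
  derivableK (fun z => f (G z)) z.
Proof.
move=> /derivable_Cd hf /derivable_Cd hG.
by have [] := Cd_derivable (Cd_comp hf hG).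
Qed.
Lemma derivable_Ccont f z : derivableK f z -> Ccont f z.
Proof. by move/derivable_Cd/Cd_cont. Qed.
Lemma derivable_cexp (z : C) : derivableK (@cexp R) z.
Proof. by have [] := Cd_derivable (@Cd_cexp R z). Qed.

Lemma ii_neq0 : ii != 0.
Proof. by apply/eqP => h; have := nc_ii R; rewrite h nc0 => /eqP; rewrite eq_sym oner_eq0. Qed.

Definition circ (t : R) : C := cexp (ii * t%:C).
Lemma nc_circ t : nc (circ t) = 1.
Proof. by rewrite nc_cexp /= mulr0 mul0r subr0 expR0. Qed.
Lemma circ0 : circ 0 = 1.
Proof. by rewrite /circ mulr0 cexp0. Qed.
Lemma circ2pi : circ tau = 1.
Proof.
have -> : circ tau = cexp (0 +i* tau).
  by rewrite /circ; congr cexp; apply: complex_ext => /=; ring.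
have -> : tau = 0 + pi *+ 2 by rewrite add0r mulr_natl.
by rewrite /cexp /= cosD2pi sinD2pi cos0 sin0 expR0 mulr1 mulr0.
Qed.
Lemma circN t : circ (- t) = (circ t)^-1.
Proof.
apply: (@mulIf _ (circ t)); first exact: cexp_neq0.
by rewrite mulVf ?cexp_neq0 // /circ rmorphN /= mulrN cexpNM.
Qed.
Lemma circ_neq0 t : circ t != 0. Proof. exact: cexp_neq0. Qed.
Lemma Rd_circ t : Rd circ t (ii * circ t).
Proof.
rewrite mulrC; apply: (@Rd_comp _ (@cexp R) (fun t => ii * t%:C)); first exact: Cd_cexp.
have -> : (fun t : R => ii * t%:C) = (fun t => 0 + ii * t%:C) by apply/funext => x; rewrite add0r.
exact: Rd_line.
Qed.
Lemma Rcont_circ t : Rcont circ t.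
Proof. exact: Rd_cont (Rd_circ t). Qed.
Lemma tau_gt0 : 0 < tau.
Proof. by rewrite mulr_gt0 // pi_gt0. Qed.

(** The composition of f with the exponential is holomorphic in the whole plane. By
    Goursat's theorem and periodicity its integral over a period on the line Re u = x
    does not depend on x, and it tends to the right-hand side as x tends to -oo. *)
Theorem mean_value f : Ccont f 0 -> (forall z, z != 0 -> derivableK f z) ->
  Iv (fun t => f (circ t)) 0 tau = tau%:C * f 0.
Proof.
move=> c0 df.
pose G u := f (cexp u).
have dG z : exists l, Cd G z l.
  exists (derK G z); apply: derivable_Cd; apply: derivable_comp.
    by apply: df; exact: cexp_neq0.
  exact: derivable_cexp.
have cG z : Ccont G z by have [l /Cd_cont] := dG z.
pose M x := Iv (fun y => G (x%:C + ii * y%:C)) 0 tau.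
have per z : cexp (ii * tau%:C + z) = cexp z by rewrite cexpD -/(circ tau) circ2pi mul1r.
have Mx x : x <= 0 -> M 0 = M x.
  move=> x0; have := @goursat _ G x 0 0 tau dG x0 (ltW tau_gt0).
  have e1 : Iv (fun t => G (ii * tau%:C + 1 * t%:C)) x 0 = Iv (fun t => G (ii * 0%:C + 1 * t%:C)) x 0.
    by apply: eq_Iv => t _ _; rewrite /G per mulr0 add0r.
  have -> : boundary G x 0 0 tau = ii * (M 0 - M x).
    have alg (j u v w : C) : u + j * v - u - j * w = j * (v - w) by ring.
    by rewrite /boundary e1 alg.
  move/eqP; rewrite mulf_eq0 (negPf ii_neq0) /= subr_eq0 => /eqP.
  exact.
transitivity (M 0).
  by apply: eq_Iv => t _ _; rewrite /G add0r.
apply/eqP; rewrite -subr_eq0; apply/eqP/nc_eq0/eqP; rewrite eq_le nc_ge0 andbT.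
apply/ler_addgt0Pr => e e0; rewrite add0r.
have [d d0 hd] := c0 (e / tau) (divr_gt0 e0 tau_gt0).
pose x := Num.min 0 (ln (d / 2)).
have x0 : x <= 0 by rewrite ge_min lexx.
have ex : expR x < d.
  have : expR x <= expR (ln (d / 2)) by rewrite ler_expR ge_min lexx orbT.
  by rewrite lnK ?posrE; lra.
have mG y : Cmeas (fun t : R => G (y%:C + ii * t%:C)).
  by apply: Rcont_meas => u; exact: Ccont_line.
have k (a : C) : tau%:C * a = Iv (fun=> a) 0 tau.
  rewrite (@FTC _ (fun t => 0 + a * t%:C)) ?(ltW tau_gt0) //.
  - by rewrite mulr0 addr0 subr0 add0r mulrC.
  - by move=> t; exact: Rd_line.
  - by move=> t e1 e10; exists 1 => // h _; rewrite subrr nc0 ltW.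
rewrite (Mx x x0) k /M /Iv -CIB; last 2 first.
- by apply: Cable_cont => u; exact: Ccont_line.
- by apply: Cable_cont => u e1 e10; exists 1 => // h _; rewrite subrr nc0 ltW.
rewrite (_ : CI _ = Iv (fun t => G (x%:C + ii * t%:C) - f 0) 0 tau); last first.
  by apply: eq_CI => t; rewrite mulrBr.
apply: le_trans (@Iv_le _ _ _ _ (e / tau) (ltW tau_gt0) _ _) _.
- by apply: CmeasB => //; exact: Cmeas_cst.
- move=> t _ _; rewrite /G; have := hd (cexp (x%:C + ii * t%:C)); rewrite add0r; apply.
  by rewrite nc_cexp /= mul0r mulr0 subr0 addr0.
- by rewrite subr0 divfK // gt_eqF // tau_gt0.
Qed.
End Circle.

(** * Cauchy's formulas for entire functions *)

Section Entire.
Variable R : realType.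
Local Notation C := R[i].
Local Notation Re := (@complex.Re R).
Local Notation Im := (@complex.Im R).
Local Notation nc := (@Normc.normc R).
Local Notation ii := (0 +i* 1 : C).
Local Notation tau := (2 * pi : R).
Implicit Types f g : C -> C.

Lemma locally_bounded f (r : R) : (forall z, Ccont f z) ->
  exists2 M, 0 <= M & forall z, nc z <= r -> nc (f z) <= M.
Proof.
move=> cf; have [r0|r0] := ltP r 0.
  by exists 0 => // z hz; have := le_lt_trans (le_trans (nc_ge0 z) hz) r0; rewrite ltxx.
suff [M hM] : exists M, forall x y, -r <= x <= r -> -r <= y <= r -> nc (f (x +i* y)) <= M.
  exists `|M| => // z hz; apply: le_trans (ler_norm M).
  have -> : z = Re z +i* Im z by case: z {hz}.
  by apply: hM; rewrite -ler_norml; apply: le_trans hz; [exact: nc_Re|exact: nc_Im].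
have rr : -r <= r by lra.
apply: (@bisection R (fun a b c d => exists M, forall x y, a <= x <= b -> c <= y <= d ->
  nc (f (x +i* y)) <= M)) => //.
  move=> a b c d ab cd [M1 h1] [M2 h2] [M3 h3] [M4 h4].
  exists (`|M1| + `|M2| + `|M3| + `|M4|) => x y /andP[xa xb] /andP[ya yb].
  have := ler_norm M1; have := ler_norm M2; have := ler_norm M3; have := ler_norm M4.
  have := normr_ge0 M1; have := normr_ge0 M2; have := normr_ge0 M3; have := normr_ge0 M4.
  have := h1 x y; have := h2 x y; have := h3 x y; have := h4 x y.
  rewrite xa xb ya yb !andbT /=.
  have [hx|/ltW hx] := lerP x ((a + b) / 2); have [hy|/ltW hy] := lerP y ((c + d) / 2);
    rewrite ?hx ?hy.
  - by move=> _ _ _ /(_ isT isT) *; lra.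
  - by move=> _ /(_ isT isT) *; lra.
  - by move=> _ _ /(_ isT isT) *; lra.
  - by move=> /(_ isT isT) *; lra.
move=> x y; have [d d0 hd] := cf (x +i* y) 1 ltr01.
exists (d / 2); first by lra.
move=> a b c e /andP[xa xb] /andP[ya yb] hw hh.
exists (nc (f (x +i* y)) + 1) => x' y' /andP[x'a x'b] /andP[y'a y'b].
have hle : nc ((x' +i* y') - (x +i* y)) < d.
  apply: le_lt_trans (nc_ReIm _) _; rewrite cReB cImB /=.
  have : `|x' - x| <= b - a by rewrite ler_norml; apply/andP; split; lra.
  have : `|y' - y| <= e - c by rewrite ler_norml; apply/andP; split; lra.
  lra.
have := hd _ hle; rewrite subrKC => h.
have -> : f (x' +i* y') = f (x +i* y) + (f (x' +i* y') - f (x +i* y)) by rewrite subrKC.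
by apply: le_trans (ncD _ _) _; rewrite lerD2l.
Qed.

(** This is [entire], folded over [derivableK]. *)
Definition ent f := forall z, derivableK f z.

(** The Taylor coefficient as a Cauchy integral over the unit circle around z. In this
    form it commutes with integrals over a parameter. *)
Definition Tc (j : nat) f (z : C) : C :=
  (tau%:C)^-1 * Iv (fun t => f (z + circ t) * circ (- t) ^+ j) 0 tau.

Lemma tauC_neq0 : tau%:C != 0 :> C.
Proof.
rewrite (_ : 0 = (0:R)%:C) //; apply/eqP => /complexI/eqP.
by rewrite gt_eqF // tau_gt0.
Qed.

Lemma ent_cont f : ent f -> forall z, Ccont f z.
Proof. by move=> ef z; exact: derivable_Ccont. Qed.
Lemma ent_shift f (z : C) : ent f -> ent (fun w => f (z + w)).
Proof.
move=> ef w; apply: (derivable_comp (f := f) (G := fun w => z + w)) => //.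
by apply: derivableKD; [exact: derivableK_cst|exact: derivableK_id].
Qed.

Lemma Rcont_comp f (g : R -> C) t : Ccont f (g t) -> Rcont g t -> Rcont (fun t => f (g t)) t.
Proof.
move=> cf cg e e0; have [d d0 hd] := cf e e0.
have d20 : 0 < d / 2 by lra.
have [d' d'0 hd'] := cg (d / 2) d20.
exists d' => // h /hd' hh; have := hd (g (t + h) - g t); rewrite subrKC; apply.
by apply: le_lt_trans hh _; lra.
Qed.
Lemma Rcont_cst (a : C) t : Rcont (fun=> a) t.
Proof. by move=> e e0; exists 1 => // h _; rewrite subrr nc0 ltW. Qed.
Lemma RcontD (g1 g2 : R -> C) t : Rcont g1 t -> Rcont g2 t -> Rcont (fun t => g1 t + g2 t) t.
Proof.
move=> c1 c2 e e0; have e20 : 0 < e / 2 by lra.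
have [d d0 hd] := c1 _ e20; have [d' d'0 hd'] := c2 _ e20.
exists (Num.min d d'); first by rewrite lt_min d0.
move=> h; rewrite lt_min => /andP[/hd h1 /hd' h2].
rewrite (_ : _ - _ = (g1 (t + h) - g1 t) + (g2 (t + h) - g2 t)); last by ring.
by apply: le_trans (ncD _ _) _; lra.
Qed.
Lemma RcontM (g1 g2 : R -> C) t : Rcont g1 t -> Rcont g2 t -> Rcont (fun t => g1 t * g2 t) t.
Proof.
move=> c1 c2 e e0.
pose K1 := nc (g1 t) + 1; pose K2 := nc (g2 t) + 1.
have K10 : 0 < K1 by rewrite /K1; have := nc_ge0 (g1 t); lra.
have K20 : 0 < K2 by rewrite /K2; have := nc_ge0 (g2 t); lra.
have e1 : 0 < Num.min 1 (e / 2 / K2) by rewrite lt_min ltr01 !divr_gt0.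
have e2 : 0 < e / 2 / K1 by rewrite !divr_gt0.
have [d d0 hd] := c1 _ e1; have [d' d'0 hd'] := c2 _ e2.
exists (Num.min d d'); first by rewrite lt_min d0.
move=> h; rewrite lt_min => /andP[/hd h1 /hd' h2].
rewrite le_min in h1; move/andP: h1 => [h1 h1'].
rewrite ler_pdivlMr // in h1'; rewrite ler_pdivlMr // in h2.
rewrite (_ : _ - _ = (g1 (t + h) - g1 t) * g2 t + g1 (t + h) * (g2 (t + h) - g2 t)); last by ring.
apply: le_trans (ncD _ _) _; rewrite !ncM.
have h3 : nc (g1 (t + h)) <= K1.
  have -> : g1 (t + h) = (g1 (t + h) - g1 t) + g1 t by rewrite subrK.
  by apply: le_trans (ncD _ _) _; rewrite /K1; lra.
have := nc_ge0 (g1 (t + h) - g1 t); have := nc_ge0 (g2 (t + h) - g2 t).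
have : nc (g2 t) <= K2 by rewrite /K2; lra.
nra.
Qed.
Lemma Rcont_circN j t : Rcont (fun t : R => circ (- t) ^+ j : C) t.
Proof.
elim: j => [|j IH]; first exact: Rcont_cst.
have -> : (fun t : R => circ (- t) ^+ j.+1 : C) = (fun t => circ (- t) * circ (- t) ^+ j).
  by apply/funext => u; rewrite exprS.
apply: RcontM => // e e0; have [d d0 hd] := @Rcont_circ R (- t) e e0.
by exists d => // h hh; have := hd (- h); rewrite normrN opprD; apply.
Qed.
Lemma Rcont_addcirc (z : C) t : Rcont (fun t => z + circ t) t.
Proof. by apply: RcontD; [exact: Rcont_cst|exact: Rcont_circ]. Qed.

Lemma Rcont_Tc j f z t : (forall z, Ccont f z) ->
  Rcont (fun t => f (z + circ t) * circ (- t) ^+ j) t.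
Proof.
move=> cf; apply: RcontM; last exact: Rcont_circN.
by apply: Rcont_comp => //; exact: Rcont_addcirc.
Qed.

Lemma TcB j f g z : (forall z, Ccont f z) -> (forall z, Ccont g z) ->
  Tc j (fun z => f z - g z) z = Tc j f z - Tc j g z.
Proof.
move=> cf cg; rewrite /Tc -mulrBr; congr (_ * _).
rewrite /Iv -CIB; try by apply: Cable_cont => t; exact: Rcont_Tc.
by apply: eq_CI => t; ring.
Qed.

Lemma Tc_le j f z B : (forall z, Ccont f z) ->
  (forall w, nc w <= nc z + 1 -> nc (f w) <= B) -> nc (Tc j f z) <= B.
Proof.
move=> cf hB; rewrite /Tc ncM ncV nc_real gtr0_norm ?tau_gt0 //.
rewrite ler_pdivrMl ?tau_gt0 // [leRHS]mulrC -[X in B * X]subr0.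
apply: Iv_le; first exact: ltW (tau_gt0 R).
  by apply: Rcont_meas => t; exact: Rcont_Tc.
move=> t _ _; rewrite ncM ncX nc_circ expr1n mulr1; apply: hB.
by apply: le_trans (ncD _ _) _; rewrite nc_circ.
Qed.

Lemma cauchy0 f z : ent f -> f z = Tc 0 f z.
Proof.
move=> ef; have h := @mean_value R (fun w => f (z + w)).
rewrite /Tc (_ : Iv _ _ _ = tau%:C * f z); first by rewrite mulKf // tauC_neq0.
rewrite -[z in RHS]addr0 -h.
- by apply: eq_Iv => t _ _; rewrite expr0 mulr1.
- by apply: ent_cont; exact: ent_shift.
- by move=> w _; exact: ent_shift.
Qed.

Lemma Iv_circN : Iv (fun t => circ (- t)) 0 tau = 0 :> C.
Proof.
rewrite (@FTC _ (fun t => ii * circ (- t))) ?(ltW (tau_gt0 R)) //.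
- by rewrite circN circ2pi oppr0 circ0 invr1 subrr.
- move=> t e e0; have [d d0 hd] := @Rd_circ R (- t) e e0.
  exists d => // h hh; have := hd (- h); rewrite normrN -opprD => /(_ hh).
  set u := circ (- (t + h)); set v := circ (- t) => hle.
  rewrite (_ : _ - _ = ii * (u - v - ii * v * (- h)%:C)).
    by rewrite ncM nc_ii mul1r.
  rewrite rmorphN /=; have i2 := ii2 R.
  rewrite !mulrBr !mulrA i2; ring.
- by move=> t; have := @Rcont_circN 1 t; under eq_fun do rewrite expr1.
Qed.

(** The mean value property of the difference quotient of f at z, continued to its
    removable singularity. *)
Lemma cauchy1 f z : ent f -> derK f z = Tc 1 f z.
Proof.
move=> ef.
pose g w := if w == 0 then derK f z else (f (z + w) - f z) / w.
have g0 : g 0 = derK f z by rewrite /g eqxx.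
have cg0 : Ccont g 0.
  move=> e e0; have [d d0 hd] := derivable_Cd (ef z) e0.
  exists d => // h hh; rewrite add0r g0 /g; case: eqVneq => [_|h0].
    by rewrite subrr nc0 ltW.
  have hp := nc_gt0 h0.
  rewrite -(ler_pM2r hp) -ncM mulrBl divfK //; exact: hd.
have dg w : w != 0 -> derivableK g w.
  move=> w0; pose g' w := (f (z + w) - f z) * w^-1.
  have : derivableK g' w.
    apply: derivableKM; last by apply: derivableKV => //; exact: derivableK_id.
    by apply: derivableKB; [exact: ent_shift|exact: derivableK_cst].
  move=> /derivable_Cd h.
  have wp := nc_gt0 w0.
  suff /Cd_derivable[] : Cd g w (derK g' w) by [].
  move=> e e0; have [d d0 hd] := h e e0.
  exists (Num.min d (nc w)); first by rewrite lt_min d0.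
  move=> k; rewrite lt_min => /andP[/hd h1 h2].
  rewrite /g (negPf w0) ifF //; apply/negP => /eqP wk.
  by rewrite -ncN (_ : - k = w) ?ltxx // in h2; apply/eqP; rewrite eq_sym -addr_eq0 wk.
have := mean_value cg0 dg; rewrite g0 => h.
rewrite /Tc -[LHS](mulKf tauC_neq0) -h; congr (_ * _).
have cf := ent_cont ef.
transitivity (Iv (fun t => f (z + circ t) * circ (- t) ^+ 1) 0 tau -
              f z * Iv (fun t => circ (- t)) 0 tau); last first.
  by rewrite Iv_circN mulr0 subr0.
have c1 : Cable (fun t => oo 0 tau t * (circ (- t) : C)).
  by apply: Cable_cont => t; have := @Rcont_circN 1 t; under eq_fun do rewrite expr1.
rewrite {2 3}/Iv -CIZ // -CIB; last 2 first.
- by apply: Cable_cont => t; exact: Rcont_Tc.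
- exact: CableZ.
apply: eq_CI => t; rewrite /g (negPf (circ_neq0 _)) circN; ring.
Qed.

Lemma der_bounded f (r : R) : ent f ->
  exists2 M, 0 <= M & forall z, nc z <= r -> nc (derK f z) <= M.
Proof.
move=> ef; have cf := ent_cont ef.
have [M M0 hM] := locally_bounded (r + 1) cf; exists M => // z hz.
rewrite cauchy1 //; apply: Tc_le => // w hw; apply: hM.
by apply: le_trans hw _; rewrite lerD2r.
Qed.

Lemma ent_lip f (r : R) : ent f -> exists2 M, 0 <= M & forall z h,
  nc z <= r -> nc h <= 1 -> nc (f (z + h) - f z) <= M * nc h.
Proof.
move=> ef; have [M M0 hM] := der_bounded (r + 1) ef; exists M => // z h hz hh.
apply: (@C_mean_value R f (derK f)) => t /andP[t0 t1].
  exact: derivable_Cd.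
apply: hM; apply: le_trans (ncD _ _) _; rewrite ncM nc_real ger0_norm //.
apply: lerD => //; have := nc_ge0 h; nra.
Qed.

Lemma derK_cont f z : ent f -> Ccont (derK f) z.
Proof.
move=> ef; have cf := ent_cont ef.
have [M M0 hM] := ent_lip (nc z + 1) ef => e e0.
have M1 : 0 < M + 1 by lra.
exists (Num.min 1 (e / (M + 1))); first by rewrite lt_min ltr01 divr_gt0.
move=> h; rewrite lt_min ltr_pdivlMr // => /andP[h1 h2].
rewrite !cauchy1 //.
have -> : Tc 1 f (z + h) = Tc 1 (fun w => f (w + h)) z.
  by rewrite /Tc; congr (_ * _); apply: eq_Iv => t _ _; rewrite addrAC.
have ch w : Ccont (fun w => f (w + h)) w.
  move=> e1 e10; have [d d0 hd] := cf (w + h) e1 e10; exists d => // k /hd.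
  by rewrite addrAC.
rewrite -TcB //; apply: Tc_le.
  move=> w; apply: derivable_Ccont; apply: derivableKB; last exact: ef.
  by have := @ent_shift f h ef w; under eq_fun do rewrite addrC.
move=> w hw; apply: le_trans (hM w h hw (ltW h1)) _.
have := nc_ge0 h; nra.
Qed.

(** The derivative is locally Lipschitz continuous, being a Cauchy integral of f by
    [cauchy1]. *)
Lemma ent_quad f (r : R) : ent f -> exists2 L, 0 <= L & forall z h,
  nc z <= r -> nc h <= 1 -> nc (f (z + h) - f z - derK f z * h) <= L * nc h ^+ 2.
Proof.
move=> ef; have cf := ent_cont ef.
have [M M0 hM] := ent_lip (r + 1) ef; exists M => // z h hz hh.
pose p w := f w + (- derK f z) * w.
have -> : f (z + h) - f z - derK f z * h = p (z + h) - p z by rewrite /p; ring.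
rewrite expr2 mulrA.
apply: (@C_mean_value R p (fun w => derK f w - derK f z)) => t /andP[t0 t1].
  move=> e e0; have [d d0 hd] := derivable_Cd (ef (z + h * t%:C)) e0.
  have alg (A B c l u v : C) : A + - c * (u + v) - (B + - c * u) - (l - c) * v = A - B - l * v.
    by ring.
  by exists d => // k /hd; rewrite /p alg.
pose k := h * t%:C.
have kh : nc k <= nc h by rewrite ncM nc_real ger0_norm //; have := nc_ge0 h; nra.
rewrite !cauchy1 //.
have -> : Tc 1 f (z + k) = Tc 1 (fun w => f (w + k)) z.
  by rewrite /Tc; congr (_ * _); apply: eq_Iv => u _ _; rewrite addrAC.
have ch w : Ccont (fun w => f (w + k)) w.
  move=> e1 e10; have [d d0 hd] := cf (w + k) e1 e10; exists d => // u /hd.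
  by rewrite addrAC.
rewrite -TcB //; apply: Tc_le.
  move=> w; apply: derivable_Ccont; apply: derivableKB; last exact: ef.
  by have := @ent_shift f k ef w; under eq_fun do rewrite addrC.
move=> w hw; apply: le_trans (hM w k _ _) _.
- by apply: le_trans hw _; rewrite lerD2r.
- exact: le_trans kh hh.
- by rewrite ler_wpM2l.
Qed.

(** Differentiation under the integral sign: the remainder of f is quadratic uniformly
    on bounded sets, hence can be integrated against k. *)
Lemma ent_CI f (a b k : R -> C) (A B : R) : ent f ->
  (forall t, nc (a t) <= A) -> (forall t, nc (b t) <= B) -> Cable k -> Cmeas b ->
  (forall z, Cmeas (fun t => f (a t + b t * z))) ->
  (forall z, Cmeas (fun t => derK f (a t + b t * z))) ->
  ent (fun z => CI (fun t => f (a t + b t * z) * k t)).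
Proof.
move=> ef hA hB ck mb mf mdf z.
have B0 : 0 <= B := le_trans (nc_ge0 _) (hB 0).
have pb w t : nc (a t + b t * w) <= A + B * nc w.
  by apply: le_trans (ncD _ _) _; rewrite ncM lerD // ler_wpM2r ?nc_ge0.
have cf w : Cable (fun t => f (a t + b t * w) * k t).
  have [M M0 hM] := locally_bounded (A + B * nc w) (ent_cont ef).
  by apply: (CableM (B := M)) => // t; exact: hM.
have cdf : Cable (fun t => derK f (a t + b t * z) * b t * k t).
  have [M M0 hM] := der_bounded (A + B * nc z) ef.
  apply: (CableM (B := M * B)) => //; first exact: CmeasM.
  by move=> t; rewrite ncM ler_pM ?nc_ge0 // hM.
have [L L0 hL] := ent_quad (A + B * nc z) ef.
pose I := RI (fun t => nc (k t)).
have I0 : 0 <= I by apply: RI_ge0 => t; exact: nc_ge0.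
suff /Cd_derivable[] : Cd (fun z => CI (fun t => f (a t + b t * z) * k t)) z
   (CI (fun t => derK f (a t + b t * z) * b t * k t)) by [].
move=> e e0.
have B1 : 0 < B + 1 by lra.
have LBI : 0 <= L * B ^+ 2 * I by rewrite !mulr_ge0 // sqr_ge0.
have K0 : 0 < L * B ^+ 2 * I + 1 by rewrite ltr_wpDl.
exists (Num.min (B + 1)^-1 (e / (L * B ^+ 2 * I + 1))).
  by rewrite lt_min invr_gt0 B1 divr_gt0.
move=> h; rewrite lt_min => /andP[]; rewrite -div1r !ltr_pdivlMr // => h1 h2.
rewrite -CIB // mulrC -CIZ // -CIB; [|exact: CableB|exact: CableZ].
have h0 := nc_ge0 h.
apply: le_trans (_ : _ <= RI (fun t => (L * B ^+ 2 * nc h ^+ 2) * nc (k t))) _.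
  apply: CI_le_dom.
  - apply: Cable_meas; apply: CableB; [exact: CableB|exact: CableZ].
  - by apply: RableZ; exact: Cable_nc.
  move=> t.
  rewrite (_ : _ - _ = (f (a t + b t * z + b t * h) - f (a t + b t * z) -
     derK f (a t + b t * z) * (b t * h)) * k t); last by rewrite mulrDr addrA; ring.
  rewrite ncM ler_wpM2r ?nc_ge0 //.
  have bh : nc (b t * h) <= B * nc h by rewrite ncM ler_wpM2r.
  apply: le_trans (hL _ _ (pb z t) _) _.
    by apply: le_trans bh _; nra.
  rewrite -mulrA ler_wpM2l // -exprMn lerXn2r ?nnegrE ?nc_ge0 // mulr_ge0 //.
rewrite RIZ; last exact: Cable_nc.
rewrite -/I; have := sqr_ge0 B; nra.
Qed.

(** By [cauchy1] the derivative is an integral over a parameter, to which [ent_CI]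
    applies. *)
Theorem ent_derK f : ent f -> ent (derK f).
Proof.
move=> ef; have cf := ent_cont ef.
have := @ent_CI f (fun t => circ t) (fun=> 1) (fun t => (tau%:C)^-1 * (oo 0 tau t * circ (- t))) 1 1 ef.
move=> /(_ _ _ _ _ _ _) H.
have {}H : ent (fun z => CI (fun t => f (circ t + 1 * z) * ((tau%:C)^-1 * (oo 0 tau t * circ (- t))))).
  apply: H.
  - by move=> t; rewrite nc_circ.
  - by move=> t; rewrite nc1.
  - apply: CableZ; apply: Cable_cont => t.
    by have := @Rcont_circN 1 t; under eq_fun do rewrite expr1.
  - exact: Cmeas_cst.
  - move=> z; apply: Rcont_meas => t; apply: Rcont_comp; first exact: cf.
    by apply: RcontD; [exact: Rcont_circ|exact: Rcont_cst].
  - move=> z; apply: Rcont_meas => t; apply: Rcont_comp; first exact: derK_cont.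
    by apply: RcontD; [exact: Rcont_circ|exact: Rcont_cst].
have -> : derK f = (fun z => CI (fun t => f (circ t + 1 * z) * ((tau%:C)^-1 * (oo 0 tau t * circ (- t))))).
  apply/funext => z; rewrite cauchy1 // /Tc /Iv -CIZ; last first.
    by apply: Cable_cont => t; exact: Rcont_Tc.
  by apply: eq_CI => t; rewrite mul1r (addrC (circ t)); ring.
exact: H.
Qed.

End Entire.

(** * Taylor coefficients *)

Section TaylorGeneric.
Variable K : numFieldType.
Definition derKn j (f : K -> K) : K -> K := derive1n j f.
Lemma derKnS j (f : K -> K) : derKn j.+1 f = derKn j (derK f).
Proof. by rewrite /derKn derive1Sn. Qed.
Lemma derKn0 (f : K -> K) : derKn 0 f = f.
Proof. by []. Qed.
Lemma taylor_coef_derKn j (f : K -> K) z : taylor_coef j f z = derKn j f z / (j`!)%:R.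
Proof. by []. Qed.
End TaylorGeneric.

Section Taylor.
Variable R : realType.
Local Notation C := R[i].
Local Notation nc := (@Normc.normc R).
Local Notation ii := (0 +i* 1 : C).
Local Notation tau := (2 * pi : R).
Implicit Types f g : C -> C.

Lemma Rd_circN t : Rd (fun t => circ (- t)) t (- (ii * circ (- t))).
Proof.
move=> e e0; have [d d0 hd] := @Rd_circ R (- t) e e0.
exists d => // h hh; have := hd (- h); rewrite normrN -opprD => /(_ hh).
by rewrite rmorphN mulrN mulNr.
Qed.

Lemma RdM (g1 g2 : R -> C) t l1 l2 : Rd g1 t l1 -> Rd g2 t l2 ->
  Rd (fun t => g1 t * g2 t) t (l1 * g2 t + g1 t * l2).
Proof.
move=> d1 d2.
(* polarization: a product is a combination of squares *)
have sq (g : R -> C) l : Rd g t l -> Rd (fun t => g t * g t) t ((2 * g t) * l).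
  move=> dg; apply: (@Rd_comp _ (fun z => z * z)) dg.
  have := @Cd_quad R 0 2 (g t).
  have -> : (fun z : C => 0 * z + 2 / 2 * z * z) = (fun z => z * z).
    by apply/funext => z; rewrite mul0r add0r divff ?mul1r // pnatr_eq0.
  by rewrite add0r.
have RdD' (g h : R -> C) l m (c : C) : Rd g t l -> Rd h t m -> Rd (fun t => g t + c * h t) t (l + c * m).
  move=> dg dh e e0; have k0 : 0 < nc c + 1 by have := nc_ge0 c; lra.
  have e2 : 0 < e / 2 by lra.
  have [p p0 hp] := dg _ e2; have [r r0 hr] := dh _ (divr_gt0 e2 k0).
  exists (Num.min p r); first by rewrite lt_min p0.
  move=> k; rewrite lt_min => /andP[/hp k1 /hr k2].
  rewrite (_ : _ - _ = (g (t + k) - g t - l * k%:C) + c * (h (t + k) - h t - m * k%:C)); last by ring.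
  apply: le_trans (ncD _ _) _; rewrite ncM.
  rewrite mulrAC ler_pdivlMr // in k2.
  have := nc_ge0 (h (t + k) - h t - m * k%:C); have := nc_ge0 c; nra.
have s1 := sq _ _ (RdD' _ _ _ _ 1 d1 d2).
have s2 := sq _ _ (RdD' _ _ _ _ (-1) d1 d2).
have s3 := RdD' _ _ _ _ (-1) s1 s2.
have z0 : Rd (fun=> 0 : C) t 0.
  by move=> e e0; exists 1 => // h _; rewrite mul0r !subrr nc0 mulr_ge0 // ltW.
have := RdD' _ _ _ _ (4^-1) z0 s3.
have -> : (fun x : R => 0 + 4^-1 * ((g1 x + 1 * g2 x) * (g1 x + 1 * g2 x) +
     -1 * ((g1 x + -1 * g2 x) * (g1 x + -1 * g2 x)))) = (fun t => g1 t * g2 t).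
  by apply/funext => x; field.
have -> : 0 + 4^-1 * (2 * (g1 t + 1 * g2 t) * (l1 + 1 * l2) + -1 * (2 * (g1 t + -1 * g2 t) * (l1 + -1 * l2)))
  = l1 * g2 t + g1 t * l2 by field.
by [].
Qed.

Lemma Rd_circNX j t : Rd (fun t => circ (- t) ^+ j) t (- (j%:R * ii * circ (- t) ^+ j)).
Proof.
elim: j => [|j IH].
  rewrite mul0r mul0r oppr0 => e e0; exists 1 => // h _.
  by rewrite !expr0 mul0r !subrr nc0 mulr_ge0 // ltW.
have := RdM IH (Rd_circN t).
have -> : (fun t => circ (- t) ^+ j * circ (- t)) = (fun t : R => circ (- t) ^+ j.+1 : C).
  by apply/funext => x; rewrite exprSr.
have alg (u i k : C) : - (k * i * u) * circ (- t) + u * - (i * circ (- t)) =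
   - ((1 + k) * i * (u * circ (- t))) by ring.
by rewrite alg exprSr -natr1 (addrC 1).
Qed.

(** Integration by parts along the circle. *)
Lemma Tc_derK j f z : ent f -> Tc j (derK f) z = j.+1%:R * Tc j.+1 f z.
Proof.
move=> ef; rewrite /Tc mulrCA; congr (_ * _).
have cf := ent_cont ef; have cdf w := @derK_cont R f w ef.
pose F t := f (z + circ t) * circ (- t) ^+ j.+1.
have dF t : Rd F t (ii * (derK f (z + circ t) * circ (- t) ^+ j - j.+1%:R * (f (z + circ t) * circ (- t) ^+ j.+1))).
  have d1 : Rd (fun t => z + circ t) t (ii * circ t).
    move=> e e0; have [d d0 hd] := @Rd_circ R t e e0; exists d => // h /hd.
    by rewrite opprD addrACA subrr add0r.
  have d2 := Rd_comp (derivable_Cd (ef (z + circ t))) d1.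
  have := RdM d2 (Rd_circNX j.+1 t).
  rewrite circN => d3.
  set l := (X in Rd _ _ X) in d3; rewrite (_ : ii * _ = l) //.
  rewrite /l exprS; have cn := @circ_neq0 R t; move: (circ t) cn (derK f _) (f _) => c c0 u v.
  move: (c^-1 ^+ j) => w.
  have alg (i n : C) : i * (u * w - n * (v * (c^-1 * w))) = u * (i * c) * (c^-1 * w) + v * - (n * i * (c^-1 * w)).
    by field.
  exact: alg.
have h := @FTC R F _ 0 tau (ltW (tau_gt0 R)) dF.
have c1 t : Rcont (fun t => derK f (z + circ t) * circ (- t) ^+ j) t by exact: Rcont_Tc.
have c2 t : Rcont (fun t => f (z + circ t) * circ (- t) ^+ j.+1) t by exact: Rcont_Tc.
have {}h : Iv (fun t => ii * (derK f (z + circ t) * circ (- t) ^+ j +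
     (- j.+1%:R) * (f (z + circ t) * circ (- t) ^+ j.+1))) 0 tau = 0.
  have -> : (0 : C) = F tau - F 0.
    by rewrite /F circ2pi circ0 circN circ2pi oppr0 circ0 invr1 subrr.
  rewrite -h.
    by apply: eq_Iv => t _ _; rewrite mulNr.
  move=> t; apply: RcontM; first exact: Rcont_cst.
  have := RcontD (c1 t) (RcontM (@Rcont_cst R (- j.+1%:R) t) (c2 t)).
  by under eq_fun do rewrite mulNr.
have k1 : Cable (fun t => oo 0 tau t * (derK f (z + circ t) * circ (- t) ^+ j)) by exact: Cable_cont.
have k2 : Cable (fun t => oo 0 tau t * (f (z + circ t) * circ (- t) ^+ j.+1)) by exact: Cable_cont.
have k3 : Cable (fun t => oo 0 tau t * (derK f (z + circ t) * circ (- t) ^+ j) +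
   - j.+1%:R * (oo 0 tau t * (f (z + circ t) * circ (- t) ^+ j.+1))).
  by apply: CableD => //; exact: CableZ.
move: h; rewrite /Iv.
rewrite (_ : CI _ = ii * (CI (fun t => oo 0 tau t * (derK f (z + circ t) * circ (- t) ^+ j)) +
   - j.+1%:R * CI (fun t => oo 0 tau t * (f (z + circ t) * circ (- t) ^+ j.+1)))); last first.
  rewrite -CIZ // -CID //; last exact: CableZ.
  rewrite -CIZ //; apply: eq_CI => t.
  have alg (i o a n b : C) : o * (i * (a + - n * b)) = i * (o * a + - n * (o * b)) by ring.
  exact: alg.
move/eqP; rewrite mulf_eq0 (negPf (ii_neq0 R)) /= mulNr subr_eq0 => /eqP.
by [].
Qed.

(** Induction on j, which starts with [cauchy0] and proceeds by [Tc_derK]. *)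
Theorem taylor_coefE j f z : ent f -> taylor_coef j f z = Tc j f z.
Proof.
move=> ef; rewrite taylor_coef_derKn.
suff -> : derKn j f z = (j`!)%:R * Tc j f z.
  by rewrite mulrAC divff ?mul1r // pnatr_eq0 -lt0n fact_gt0.
elim: j f ef => [|j IH] f ef.
  by rewrite fact0 mul1r derKn0 -cauchy0.
rewrite derKnS (IH _ (ent_derK ef)) (Tc_derK j z ef) factS natrM.
have alg (a b c : C) : a * (b * c) = b * a * c by ring.
exact: alg.
Qed.

(** On the circle the factor w is z plus circ t, and multiplication by circ t shifts the
    index of the Cauchy integral. *)
Lemma Tc_mulz j f z : (forall z, Ccont f z) ->
  Tc j.+1 (fun w => w * f w) z = z * Tc j.+1 f z + Tc j f z.
Proof.
move=> cf; rewrite /Tc mulrCA -mulrDr; congr (_ * _).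
have k1 i : Cable (fun t => oo 0 tau t * (f (z + circ t) * circ (- t) ^+ i)).
  by apply: Cable_cont => t; exact: Rcont_Tc.
rewrite /Iv -CIZ // -CID //; last exact: CableZ.
apply: eq_CI => t; rewrite circN !exprS.
have cn := @circ_neq0 R t; move: (circ t) cn (f _) (oo 0 tau t) => c c0 u v.
move: (c^-1 ^+ j) => w; by field.
Qed.

(** Both sides are double integrals, over the circle and over y. *)
Lemma Tc_CI j (F : R -> C -> C) (z : C) (h : R -> R) :
  Cmeas (fun p : R * R => F p.2 (z + circ p.1)) ->
  Rable h -> (forall t y, nc (F y (z + circ t)) <= h y) ->
  Tc j (fun w => CI (fun y => F y w)) z = CI (fun y => Tc j (F y) z).
Proof.
move=> mF ih hF.
have mcN : Cmeas (fun t : R => circ (- t) ^+ j : C).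
  by apply: Rcont_meas => t; exact: Rcont_circN.
pose G (p : R * R) := oo 0 tau p.1 * (F p.2 (z + circ p.1) * circ (- p.1) ^+ j).
have mG : Cmeas G.
  apply: CmeasM; first by apply: (Cmeas_comp (Cmeas_oo 0 tau)); exact: measurable_fst.
  by apply: CmeasM => //; apply: (Cmeas_comp mcN); exact: measurable_fst.
have dom t y : nc (G (t, y)) <= ((0 < t) && (t < tau))%:R * h y.
  by rewrite /G /= !ncM ncX nc_circ expr1n mulr1 nc_oo ler_wpM2l.
have fub := CI_fubini mG (Rable_oo 0 tau) ih dom.
have iF t : Cable (fun y => F y (z + circ t)).
  by apply: (Cable_dom (Cmeas_pair2 t mF) ih) => y; exact: hF.
rewrite /Tc /Iv.
transitivity ((tau%:C)^-1 * CI (fun t => CI (fun y => G (t, y)))).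
  congr (_ * _); apply: eq_CI => t.
  have alg (a b c : C) : a * (b * c) = a * c * b by ring.
  transitivity (oo 0 tau t * circ (- t) ^+ j * CI (fun y => F y (z + circ t))).
    exact: alg.
  rewrite -(CIZ (oo 0 tau t * circ (- t) ^+ j) (iF t)); apply: eq_CI => y.
  exact: esym (alg _ _ _).
rewrite fub.
have mG' : Cmeas (fun p : R * R => G (p.2, p.1)).
  by apply: (Cmeas_comp mG); exact: measurable_swap.
have cG : Cable (fun y => CI (fun t => G (t, y))).
  apply: (Cable_CI (F := fun p => G (p.2, p.1)) mG' ih (Rable_oo 0 tau)) => y t.
  by rewrite mulrC; exact: dom.
by rewrite -(CIZ (tau%:C)^-1 cG).
Qed.

End Taylor.

(** * Even entire functions of a square root *)

Section EntireConstructions.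
Variable R : realType.
Local Notation C := R[i].
Local Notation nc := (@Normc.normc R).
Implicit Types f g : C -> C.

(** The derivative of f minus its Taylor polynomial of degree 2 is small compared with
    |h|. *)
Lemma taylor2 f z : ent f -> forall e : R, 0 < e -> exists2 d : R, 0 < d & forall h, nc h < d ->
  nc (f (z + h) - f z - derK f z * h - derK (derK f) z / 2 * h * h) <= e * nc h ^+ 2.
Proof.
move=> ef e e0; set a := derK f z; set b := derK (derK f) z.
have edf : ent (derK f) by exact: ent_derK.
have [d d0 hd] := derivable_Cd (edf z) e0.
exists d => // h hh.
pose p w := f w + (- a * (w - z) + (- b / 2) * (w - z) * (w - z)).
have -> : f (z + h) - f z - a * h - b / 2 * h * h = p (z + h) - p z.
  have e1 : z + h - z = h by rewrite addrC addKr.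
  rewrite /p e1 subrr; have alg (A B : C) : A - B - a * h - b / 2 * h * h =
    A + (- a * h + (- b / 2) * h * h) - (B + (- a * 0 + (- b / 2) * 0 * 0)) by ring.
  exact: alg.
rewrite expr2 mulrA.
apply: (@C_mean_value R p (fun w => derK f w - a - b * (w - z))) => t /andP[t0 t1].
  set w := z + h * t%:C.
  have d1 := derivable_Cd (ef w).
  have d2 : Cd (fun w => - a * w + (- b) / 2 * w * w) (w - z) (- a + - b * (w - z)) by exact: Cd_quad.
  move=> e' e'0; have e2 : 0 < e' / 2 by lra.
  have [r r0 hr] := d1 _ e2; have [s s0 hs] := d2 _ e2.
  exists (Num.min r s); first by rewrite lt_min r0.
  move=> k; rewrite lt_min => /andP[/hr k1 /hs k2].
  have alg (A B c l u v : C) : A + u - (B + v) - (l - a - b * c) * k =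
     (A - B - l * k) + (u - v - (- a + - b * c) * k) by ring.
  rewrite /p (addrAC w k) alg; apply: le_trans (ncD _ _) _.
  have -> : e' * nc k = e' / 2 * nc k + e' / 2 * nc k by field.
  exact: lerD.
have kh : nc (h * t%:C) <= nc h.
  by rewrite ncM nc_real ger0_norm //; have := nc_ge0 h; nra.
rewrite (addrC z) addrK (addrC _ z).
apply: le_trans (hd (h * t%:C) (le_lt_trans kh hh)) _.
by rewrite ler_pM2l.
Qed.

Lemma Cd_near f g z l (d : R) : 0 < d -> (forall h, nc h < d -> f (z + h) = g (z + h)) ->
  Cd g z l -> Cd f z l.
Proof.
move=> d0 fg hg e e0; have [r r0 hr] := hg e e0.
exists (Num.min r d); first by rewrite lt_min r0.
move=> h; rewrite lt_min => /andP[/hr h1 h2].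
have f0 := fg 0; rewrite addr0 nc0 in f0.
by rewrite fg // f0.
Qed.

Lemma even_derK0 g : ent g -> (forall z, g (- z) = g z) -> derK g 0 = 0.
Proof.
move=> eg ev; apply: nc_eq0; apply/eqP; rewrite eq_le nc_ge0 andbT.
apply/ler_addgt0Pr => e e0; rewrite add0r.
have [d d0 hd] := derivable_Cd (eg 0) e0.
pose h : C := (d / 2)%:C.
have hp : nc h = d / 2 by rewrite nc_real ger0_norm //; lra.
have h1 := hd h; have h2 := hd (- h).
rewrite ncN hp !add0r ev in h1 h2.
have hlt : d / 2 < d by lra.
have {}h1 := h1 hlt; have {}h2 := h2 hlt.
have h3 : nc (2 * (derK g 0 * h)) <= 2 * (e * (d / 2)).
  rewrite (_ : 2 * _ = (g h - g 0 - derK g 0 * - h) - (g h - g 0 - derK g 0 * h)); last by ring.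
  by apply: le_trans (ncB _ _) _; lra.
rewrite !ncM nc_nat hp in h3.
have := nc_ge0 (derK g 0); nra.
Qed.

(** Since g is even, the square root may be replaced by the one nearest to a given root
    of l0, which is differentiable at l0. At l0 = 0 the expansion of g to second order,
    without a linear term, is an expansion to first order in l. *)
Theorem ent_even_sqrt g : ent g -> (forall z, g (- z) = g z) -> ent (fun l => g (sqrtc l)).
Proof.
move=> eg ev l0.
pose rho := sqrtc l0.
have [l00|l00] := eqVneq l0 0.
  rewrite l00.
  suff /Cd_derivable[] : Cd (fun l => g (sqrtc l)) 0 (derK (derK g) 0 / 2) by [].
  move=> e e0; have [d d0 hd] := taylor2 0 eg e0.
  exists (d ^+ 2); first by rewrite exprn_gt0.
  move=> h hh; rewrite add0r sqrtc0.
  have sq : sqrtc h ^+ 2 = h := sqr_sqrtc h.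
  have nsq : nc (sqrtc h) ^+ 2 = nc h by rewrite -ncX sq.
  have lt : nc (sqrtc h) < d.
    by rewrite -(@ltr_pXn2r _ 2) ?nnegrE ?nc_ge0 ?(ltW d0) // nsq.
  have alg (a b c s : C) : s ^+ 2 = h -> a - b - 0 * s - c * s * s = a - b - c * h.
    by move=> <-; ring.
  have := hd _ lt; rewrite (even_derK0 eg ev) (alg _ _ _ _ sq) nsq add0r.
  exact.
have rho2 : rho ^+ 2 = l0 := sqr_sqrtc l0.
have rho0 : rho != 0 by rewrite sqrtc_eq0.
have rp := nc_gt0 rho0.
(* the square root of l0 + h nearest to rho *)
have /choice[r hr] : forall h, exists r, [/\ r ^+ 2 = l0 + h, g r = g (sqrtc (l0 + h)) &
    nc (r - rho) <= nc (r + rho)].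
  move=> h; set s := sqrtc (l0 + h); have s2 : s ^+ 2 = l0 + h := sqr_sqrtc _.
  have [le|/ltW le] := lerP (nc (s - rho)) (nc (s + rho)).
    by exists s; split.
  exists (- s); split; first by rewrite sqrrN.
    exact: ev.
  rewrite -opprD ncN (_ : - s + rho = - (s - rho)) ?ncN //.
  by rewrite opprB addrC.
have rge h : nc rho <= nc (r h + rho).
  have [_ _ le] := hr h.
  have : nc (2 * rho) <= nc (r h + rho) + nc (r h - rho).
    have -> : 2 * rho = (r h + rho) - (r h - rho) by ring.
    exact: ncB.
  rewrite ncM nc_nat; lra.
have req h : (r h - rho) * (r h + rho) = h.
  by have [e _ _] := hr h; rewrite -subr_sqr e rho2 addrC addKr.
have rsum0 h : r h + rho != 0.
  by apply/eqP => e; have := rge h; rewrite e nc0 leNgt rp.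
have rle h : nc (r h - rho) <= nc h / nc rho.
  rewrite ler_pdivlMr // -[in leRHS](req h) ncM ler_wpM2l ?nc_ge0 //.
suff /Cd_derivable[] : Cd (fun l => g (sqrtc l)) l0 (derK g rho / (2 * rho)) by [].
have bd h : nc (h / (2 * rho)) <= (nc (2 * rho))^-1 * nc h by rewrite (ncM h) (ncV (2 * rho)) mulrC.
have small e : 0 < e -> exists2 d : R, 0 < d &
    forall h, nc h < d -> nc (r h - rho - h / (2 * rho)) <= e * nc h.
  move=> e0; have p3 : 0 < 2 * nc rho ^+ 3 by rewrite mulr_gt0 // exprn_gt0.
  exists (e * (2 * nc rho ^+ 3)); first by rewrite mulr_gt0.
  move=> h hh.
  have -> : r h - rho - h / (2 * rho) = - ((r h - rho) ^+ 2 / (2 * rho)).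
    rewrite -[in h / _](req h); have rho2' : 2 * rho != 0 :> C by rewrite mulf_neq0 // pnatr_eq0.
    have alg (a b : C) : 2 * b != 0 -> a - b - (a - b) * (a + b) / (2 * b) = - ((a - b) ^+ 2 / (2 * b)).
      by move=> hb; field; move: hb; rewrite mulf_eq0 negb_or => /andP[].
    exact: alg.
  rewrite ncN ncM ncV ncM nc_nat ncX.
  have h1 : nc (r h - rho) ^+ 2 <= (nc h / nc rho) ^+ 2.
    by rewrite lerXn2r ?nnegrE ?nc_ge0 // divr_ge0 ?nc_ge0.
  have c0 : 0 <= (2 * nc rho)^-1 by rewrite invr_ge0 mulr_ge0 ?nc_ge0.
  apply: le_trans (ler_wpM2r c0 h1) _.
  have -> : (nc h / nc rho) ^+ 2 / (2 * nc rho) = nc h * (nc h / (2 * nc rho ^+ 3)).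
    by field; rewrite gt_eqF.
  by rewrite mulrC ler_wpM2r ?nc_ge0 // ler_pdivrMr // ltW.
have Hc := @chain_eps R C nc (fun h => r h - rho) (fun h => h / (2 * rho)) g rho (derK g rho)
   (nc (2 * rho))^-1 (@nc_ge0 R) bd small (derivable_Cd (eg rho)).
move=> e e0; have [d d0 hd] := Hc e e0; exists d => // h /hd.
have [_ er _] := hr h.
by rewrite subrKC er mulrA mulrAC.
Qed.

End EntireConstructions.

(** * Square-integrable potentials and exponential weights *)

Section Potential.
Variable R : realType.
Local Notation C := R[i].
Local Notation Re := (@complex.Re R).
Local Notation nc := (@Normc.normc R).
Implicit Types Q : R -> C.

Definition potential Q := [/\ Cmeas Q, Rable (fun x => nc (Q x) ^+ 2) &
  forall x, ~~ ((0 < x) && (x < pi)) -> Q x = 0].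

Lemma ext_measurable (q : R -> C) : Cmeasurable `]0, pi[ q -> Cmeas (fun x => oo 0 pi x * q x).
Proof.
have key (u : R -> R) : measurable_fun `]0, pi[ u ->
    measurable_fun setT (fun x : R => ((0 < x) && (x < pi))%:R * u x).
  move=> mu'; have := (measurable_restrictT u (measurable_itv `]0, pi[%R)).1 mu'.
  apply: eq_measurable_fun => x _; rewrite /patch; case: ifP => [|].
    by rewrite inE /= in_itv /= => ->; rewrite mul1r.
  by move/negP; rewrite inE /= in_itv /= => /negP/negPf ->; rewrite mul0r.
move=> [a b]; split.
  apply: eq_measurable_fun (key _ a) => x _ /=.
  by rewrite cReM Re_bool Im_bool mul0r subr0.
apply: eq_measurable_fun (key _ b) => x _ /=.
by rewrite cImM Re_bool Im_bool mul0r addr0.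
Qed.

Lemma L2_potential (q : R -> C) : L2 q -> potential (fun x => oo 0 pi x * q x).
Proof.
move=> [mq sq]; have mQ := ext_measurable mq.
split => //; last by move=> x /negPf h; rewrite /oo h mul0r.
have e : (fun x => nc (oo 0 pi x * q x) ^+ 2) = (fun x => ((0 < x) && (x < pi))%:R * sqnorm (q x)).
  apply/funext => x; rewrite ncM nc_oo exprMn nc_sqr.
  by case: (_ && _); rewrite ?expr1n // expr0n.
apply: Rable_ge0.
- by apply: measurable_funX; exact: measurable_nc.
- by move=> x; exact: sqr_ge0.
move: sq; rewrite /sqL2 integral_mkcond.
apply: le_lt_trans; rewrite le_eqVlt; apply/orP; left; apply/eqP.
apply: eq_integral => x _; rewrite /patch [nc _ ^+ 2](congr1 (fun f => f x) e).
case: ifP => [|].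
  by rewrite inE /= in_itv /= => ->; rewrite mul1r.
by move/negP; rewrite inE /= in_itv /= => /negP/negPf ->; rewrite mul0r.
Qed.

Lemma potential_Cable Q : potential Q -> Cable Q.
Proof.
move=> [mQ iQ sQ]; apply: (Cable_dom mQ (RableD (Rable_oo 0 pi) iQ)) => x.
have := nc_ge0 (Q x).
have [h|h] := boolP ((0 < x) && (x < pi)).
  move=> /= q0; have := sqr_ge0 (nc (Q x) - 1); nra.
by rewrite sQ // nc0 expr0n /= addr0.
Qed.

Lemma potentialB Q Q' : potential Q -> potential Q' -> potential (fun x => Q x - Q' x).
Proof.
move=> [a b c] [a' b' c']; split.
- exact: CmeasB.
- apply: (Rable_dom _ (RableZ 2 (RableD b b'))).
    by apply: measurable_funX; apply: measurable_nc; exact: CmeasB.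
  move=> x; rewrite ger0_norm ?sqr_ge0 //.
  have := ncB (Q x) (Q' x); have := nc_ge0 (Q x - Q' x).
  have := sqr_ge0 (nc (Q x) - nc (Q' x)); nra.
- by move=> x h; rewrite c // c' // subrr.
Qed.

Lemma RI_exp (m x : R) : 0 < m -> 0 <= x ->
  RI (fun t => ((0 < t) && (t < x))%:R * expR (m * t)) <= expR (m * x) / m.
Proof.
move=> m0 x0.
have eC t : cexp (m%:C * t%:C) = (expR (m * t))%:C.
  rewrite -rmorphM /cexp /= cos0 sin0 mulr1 mulr0 //.
have d t : Rd (fun t => cexp (m%:C * t%:C)) t (cexp (m%:C * t%:C) * m%:C).
  apply: (@Rd_comp _ (@cexp R) (fun t => m%:C * t%:C)); first exact: Cd_cexp.
  have := @Rd_line R 0 m%:C t.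
  by have -> : (fun t : R => 0 + m%:C * t%:C) = (fun t => m%:C * t%:C)
    by apply/funext => u; rewrite add0r.
have h := @FTC R _ _ 0 x x0 d.
have {}h : Iv (fun t => cexp (m%:C * t%:C) * m%:C) 0 x = cexp (m%:C * x%:C) - cexp (m%:C * 0%:C).
  by apply: h => t; apply: RcontM; [exact: Rd_cont (d t)|exact: Rcont_cst].
rewrite /Iv in h; have := congr1 Re h; rewrite Re_CI !eC cReB !Re_real mulr0 expR0 => h'.
rewrite ler_pdivlMr // mulrC -RIZ; last first.
  have [] := @Cable_cont R (fun t => cexp (m%:C * t%:C)) 0 x (fun t => Rd_cont (d t)).
  by move=> i _; apply: Rable_eq i => t; rewrite eC cReM Re_bool Im_bool mul0r subr0.
rewrite (_ : RI _ = expR (m * x) - 1); first by lra.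
rewrite -h'; congr RI; apply/funext => t.
by rewrite eC -rmorphM cReM Re_bool Im_bool mul0r subr0 Re_real; ring.
Qed.

Lemma measurable_lt (x : R) : measurable_fun setT (fun t : R => t < x).
Proof. by apply: measurable_fun_ltr. Qed.
Lemma measurable_bool (b : R -> bool) : measurable_fun setT b ->
  measurable_fun setT (fun t => (b t)%:R : R).
Proof.
move=> mb; have [h _] := @Cmeas_bool R _ _ _ mb.
by apply: eq_measurable_fun h => x _ /=; rewrite Re_bool.
Qed.
Lemma measurable_expm (m : R) : measurable_fun setT (fun t : R => expR (m * t)).
Proof.
apply: (measurableT_comp (@measurable_expR R)).
by apply: measurable_funM.
Qed.

(** Increasing exponentials make Volterra operators contract: in g <= c/2 g^2 + 1/(2c)
    the first term is small for small c, and the second one then for large m, because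
    integrating exp (m t) divides it by m. *)
Lemma weight (g : R -> R) (th : R) : measurable_fun setT g -> (forall x, 0 <= g x) ->
  (forall x, ~~ ((0 < x) && (x < pi)) -> g x = 0) -> Rable (fun x => g x ^+ 2) -> 0 < th ->
  exists2 m : R, 0 < m & forall x : R,
    Rable (fun t => (t < x)%R%:R * (g t * expR (m * t))) /\
    RI (fun t => (t < x)%R%:R * (g t * expR (m * t))) <= th * expR (m * x).
Proof.
move=> mg g0 sg ig th0.
pose I := RI (fun x => g x ^+ 2).
have I0 : 0 <= I by apply: RI_ge0 => x; exact: sqr_ge0.
have I1 : 0 < I + 1 by lra.
(* c bounds the first term by th / 2, and m then the second one by th / 4 *)
pose c := th / (I + 1); have c0 : 0 < c by rewrite divr_gt0.
pose m := 2 / (c * th); have m0 : 0 < m by rewrite divr_gt0 // mulr_gt0.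
exists m => // x.
have mb : measurable_fun setT (fun t : R => ((t < x)%R%:R * (g t * expR (m * t)) : R)).
  apply: measurable_funM; first by apply: measurable_bool; exact: measurable_lt.
  by apply: measurable_funM => //; exact: measurable_expm.
pose u t := c / 2 * (expR (m * x) * g t ^+ 2) + (2 * c)^-1 * (((0 < t) && (t < Num.min x pi))%:R * expR (m * t)).
pose v := Num.min x pi.
have i2 : Rable (fun t => ((0 < t) && (t < v))%:R * expR (m * t)).
  apply: (Rable_dom _ (RableZ (expR (m * v)) (Rable_oo 0 v))).
    by apply: measurable_funM; [exact: Rable_meas (Rable_oo _ _)|exact: measurable_expm].
  move=> t; rewrite ger0_norm ?mulr_ge0 ?expR_ge0 // mulrC.
  case: (ltP 0 t) => h1; last by rewrite !mulr0.
  case: (ltP t v) => h2; last by rewrite !mulr0.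
  by rewrite !mulr1 ler_expR ler_pM2l // ltW.
have iu : Rable u by apply: RableD; apply: RableZ => //; exact: RableZ.
have le t : (t < x)%R%:R * (g t * expR (m * t)) <= u t.
  have u0 : 0 <= c / 2 * (expR (m * x) * g t ^+ 2).
    apply: mulr_ge0; first by rewrite divr_ge0 // ltW.
    by apply: mulr_ge0; [exact: expR_ge0|exact: sqr_ge0].
  have v0 : 0 <= (2 * c)^-1 * (((0 < t) && (t < v))%:R * expR (m * t)).
    apply: mulr_ge0; first by rewrite invr_ge0 mulr_ge0 // ltW.
    by apply: mulr_ge0 => //; exact: expR_ge0.
  rewrite /u -/v; case: (ltP t x) => tx; last by rewrite mul0r addr_ge0.
  have [ht|ht] := boolP ((0 < t) && (t < pi)); last by rewrite [in leLHS]sg // mul0r mulr0 addr_ge0.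
  move/andP: (ht) => [t0 tp].
  rewrite t0 lt_min tx tp /= !mul1r.
  have h1 : g t <= c / 2 * g t ^+ 2 + (2 * c)^-1.
    have e1 : c / 2 * g t ^+ 2 + (2 * c)^-1 - g t = (c * g t - 1) ^+ 2 / (2 * c).
      by field; rewrite gt_eqF.
    by rewrite -subr_ge0 e1 divr_ge0 ?sqr_ge0 // mulr_ge0 // ltW.
  apply: le_trans (ler_wpM2r (expR_ge0 _) h1) _.
  rewrite mulrDl lerD2r -(mulrA (c / 2)); apply: ler_wpM2l; first by rewrite divr_ge0 // ltW.
  by rewrite mulrC; apply: ler_wpM2r; [exact: sqr_ge0|rewrite ler_expR ler_pM2l // ltW].
have ge0 t : 0 <= (t < x)%R%:R * (g t * expR (m * t)) by rewrite !mulr_ge0 ?expR_ge0.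
have ib : Rable (fun t => (t < x)%R%:R * (g t * expR (m * t))).
  by apply: (Rable_dom mb iu) => t; rewrite ger0_norm.
split => //; apply: le_trans (RI_le ib iu le) _.
rewrite /u RID; [|by apply: RableZ; exact: RableZ|exact: RableZ].
rewrite RIZ; last exact: RableZ.
rewrite RIZ // RIZ // -/I -/v.
have h2 : RI (fun t => ((0 < t) && (t < v))%:R * expR (m * t)) <= expR (m * x) / m.
  have [v0|v0] := leP 0 v.
    apply: le_trans (RI_exp m0 v0) _.
    by rewrite ler_pM2r ?invr_gt0 // ler_expR ler_pM2l // ge_min lexx.
  rewrite (_ : RI _ = 0); first by rewrite divr_ge0 ?expR_ge0 // ltW.
  rewrite -[RHS](@RI0 R); congr RI; apply/funext => t.
  case: (ltP 0 t) => t0; last by rewrite mul0r.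
  by rewrite (le_gtF (ltW (lt_trans v0 t0))) mul0r.
have h3 : c * I <= th.
  by rewrite /c mulrAC ler_pdivrMr // ler_pM2l //; lra.
have h4 : (2 * c)^-1 * (expR (m * x) / m) = th / 4 * expR (m * x).
  by rewrite /m; field; rewrite !gt_eqF.
have := ler_wpM2l (_ : 0 <= (2 * c)^-1) h2.
rewrite h4 invr_ge0 mulr_ge0 ?(ltW c0) // => /(_ isT).
have := expR_ge0 (m * x); move: (expR _) => E E0; nra.
Qed.

End Potential.

(** * Existence of the transmutation kernel *)

Section Kernel.
Variable R : realType.
Local Notation C := R[i].
Local Notation Re := (@complex.Re R).
Local Notation Im := (@complex.Im R).
Local Notation nc := (@Normc.normc R).
Implicit Types Q : R -> C.

Lemma Cmeas_oo3 d (T : measurableType d) (a b c : T -> R) : measurable_fun setT a ->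
  measurable_fun setT b -> measurable_fun setT c -> Cmeas (fun t => oo (a t) (b t) (c t) : C).
Proof.
move=> ma mb mc; apply: Cmeas_bool; apply: measurable_and; exact: measurable_fun_ltr.
Qed.

Lemma Cmeas_lt d (T : measurableType d) (a b : T -> R) : measurable_fun setT a ->
  measurable_fun setT b -> Cmeas (fun t => (a t < b t)%R%:R : C).
Proof. by move=> ma mb; apply: Cmeas_bool; exact: measurable_fun_ltr. Qed.

Definition Gam Q x : C := CI (fun t => (t < x)%R%:R * Q t).
(** In terms of w = x - s the inner integral of the kernel equation does not involve x.
    *)
Definition PJ Q (f : R * R -> C) (w y : R) : C := CI (fun u => oo y (w + y) u * (Q u * f (u, y))).
Definition J Q (f : R * R -> C) (x s : R) : C := CI (fun y => oo 0 s y * PJ Q f (x - s) y).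

Section Bounded.
Variables (Q : R -> C) (f : R * R -> C) (B : R).
Hypotheses (cQ : Cable Q) (mf : Cmeas f) (fB : forall p, nc (f p) <= B).
Let N := RI (fun x => nc (Q x)).

Lemma PJ_Cable a b y : Cable (fun u => oo a b u * (Q u * f (u, y))).
Proof.
apply: CableM (Cmeas_oo a b) (fun x => nc_oo_le1 a b x) _.
apply: (Cable_dom _ (RableZ B (Cable_nc cQ))).
  apply: CmeasM; first exact: Cable_meas.
  exact: Cmeas_pair1.
by move=> u; rewrite ncM mulrC ler_wpM2r ?nc_ge0.
Qed.

Lemma PJ_meas : Cmeas (fun p : R * R => PJ Q f p.1 p.2).
Proof.
suff mF : Cmeas (fun p : (R * R) * R => oo p.1.2 (p.1.1 + p.1.2) p.2 * (Q p.2 * f (p.2, p.1.2))).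
  exact: (Cmeas_CI mF).
have m11 : measurable_fun setT (fun p : (R * R) * R => p.1.1).
  exact: (measurableT_comp measurable_fst measurable_fst).
have m12 : measurable_fun setT (fun p : (R * R) * R => p.1.2).
  exact: (measurableT_comp measurable_snd measurable_fst).
have m2 : measurable_fun setT (fun p : (R * R) * R => p.2) by exact: measurable_snd.
apply: CmeasM; first by apply: Cmeas_oo3 => //; exact: measurable_funD.
apply: CmeasM; first by apply: (Cmeas_comp (Cable_meas cQ)).
by apply: (Cmeas_comp mf); exact: measurable_fun_pair.
Qed.

Lemma PJ_le w y : nc (PJ Q f w y) <= B * N.
Proof.
rewrite -RIZ; last exact: Cable_nc.
apply: CI_le_dom.
- exact: Cable_meas (PJ_Cable _ _ _).
- by apply: RableZ; exact: Cable_nc.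
- move=> u; rewrite !ncM nc_oo; have := nc_ge0 (Q u); have := fB (u, y).
  have := nc_ge0 (f (u, y)).
  case: (_ && _) => /=; nra.
Qed.

Lemma J_Cable w s : Cable (fun y => oo 0 s y * PJ Q f w y).
Proof.
apply: (Cable_bd (B := B * N)); last by move=> y _ _; exact: PJ_le.
exact: Cmeas_pair2 PJ_meas.
Qed.

Lemma J_meas : Cmeas (fun p : R * R => J Q f p.1 p.2).
Proof.
suff mF : Cmeas (fun p : (R * R) * R => oo 0 p.1.2 p.2 * PJ Q f (p.1.1 - p.1.2) p.2).
  exact: (Cmeas_CI mF).
have m11 : measurable_fun setT (fun p : (R * R) * R => p.1.1).
  exact: (measurableT_comp measurable_fst measurable_fst).
have m12 : measurable_fun setT (fun p : (R * R) * R => p.1.2).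
  exact: (measurableT_comp measurable_snd measurable_fst).
have m2 : measurable_fun setT (fun p : (R * R) * R => p.2) by exact: measurable_snd.
apply: CmeasM; first exact: Cmeas_oo3.
apply: (Cmeas_comp (g := fun p : (R * R) * R => (p.1.1 - p.1.2, p.2)) PJ_meas).
by apply: measurable_fun_pair => //; exact: measurable_funB.
Qed.

End Bounded.

Lemma JB Q f g Bf Bg x s : Cable Q -> Cmeas f -> Cmeas g ->
  (forall p, nc (f p) <= Bf) -> (forall p, nc (g p) <= Bg) ->
  J Q (fun p => f p - g p) x s = J Q f x s - J Q g x s.
Proof.
move=> cQ mf mg hf hg; rewrite /J -CIB; last 2 first.
- exact: (J_Cable cQ mf hf).
- exact: (J_Cable cQ mg hg).
apply: eq_CI => y; rewrite -mulrBr; congr (_ * _).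
rewrite /PJ -CIB; last 2 first.
- exact: (PJ_Cable cQ mf hf).
- exact: (PJ_Cable cQ mg hg).
by apply: eq_CI => u; rewrite !mulrBr.
Qed.

Lemma Gam_Cable Q x : Cable Q -> Cable (fun t => (t < x)%R%:R * Q t).
Proof.
move=> cQ; apply: CableM (_ : Cmeas _) (fun x => nc_bool _ _) cQ.
by apply: Cmeas_lt.
Qed.

Lemma Gam_meas Q : Cable Q -> Cmeas (Gam Q).
Proof.
move=> cQ; suff mF : Cmeas (fun p : R * R => (p.2 < p.1)%R%:R * Q p.2).
  exact: (Cmeas_CI mF).
apply: CmeasM; first by apply: Cmeas_lt; [exact: measurable_snd|exact: measurable_fst].
by apply: (Cmeas_comp (Cable_meas cQ)); exact: measurable_snd.
Qed.

Lemma Gam_le Q x : Cable Q -> nc (Gam Q x) <= RI (fun x => nc (Q x)).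
Proof.
move=> cQ; apply: CI_le_dom; last 1 first.
- by move=> t; rewrite ncM ler_piMl ?nc_ge0 // nc_bool.
- exact: Cable_meas (Gam_Cable x cQ).
- exact: Cable_nc.
Qed.

Definition tri (p : R * R) : bool := [&& 0 <= p.2, p.2 <= p.1 & p.1 <= pi].
Lemma Cmeas_tri : Cmeas (fun p => (tri p)%:R : C).
Proof.
have m1 : measurable_fun setT (fun p : R * R => p.1) by exact: measurable_fst.
have m2 : measurable_fun setT (fun p : R * R => p.2) by exact: measurable_snd.
apply: Cmeas_bool; apply: measurable_and; first exact: measurable_fun_ler.
by apply: measurable_and; exact: measurable_fun_ler.
Qed.

(** At (x, s) the operator J sees f only at points (u, y) with u < x, so that a weight
    in the first variable suffices. *)
Lemma J_contraction Q : potential Q -> exists2 m : R, 0 < m &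
  forall f B M, Cmeas f -> (forall p, nc (f p) <= B) -> 0 <= M ->
    (forall p, nc (f p) <= M * expR (m * p.1)) ->
    forall p, tri p -> nc (J Q f p.1 p.2) <= M / 2 * expR (m * p.1).
Proof.
move=> pQ; have [mQ iQ sQ] := pQ; have cQ := potential_Cable pQ.
have pip : 0 < pi :> R by exact: pi_gt0.
(* the outer integral in J runs over at most (0, pi), whence the factor pi *)
have th0 : 0 < (2 * pi)^-1 :> R by rewrite invr_gt0 mulr_gt0.
have [m m0 hm] := @weight R (fun x => nc (Q x)) _ (measurable_nc mQ) (fun x => nc_ge0 (Q x))
  (fun x h => eq_trans (congr1 nc (sQ x h)) (nc0 R)) iQ th0.
exists m => // f B M mf fB M0 fM [x s] /and3P[/= s0 sx xp].
have [wi wle] := hm x.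
have inner y : 0 < y -> y < s -> nc (PJ Q f (x - s) y) <= M * ((2 * pi)^-1 * expR (m * x)).
  move=> y0 ys; apply: le_trans (ler_wpM2l M0 wle); rewrite -RIZ //.
  apply: CI_le_dom.
  - exact: Cable_meas (PJ_Cable cQ mf fB _ _ _).
  - exact: RableZ.
  - move=> u; rewrite !ncM nc_oo; have := fM (u, y) => /= h.
    case: (ltP y u) => yu /=; last by rewrite mul0r !mulr_ge0 ?nc_ge0 ?expR_ge0.
    case: (ltP u (x - s + y)) => uy /=; last by rewrite mul0r !mulr_ge0 ?nc_ge0 ?expR_ge0.
    have -> : u < x by lra.
    rewrite !mul1r mulrCA ler_wpM2l ?nc_ge0 //.
apply: le_trans (Iv_le s0 (Cmeas_pair2 (x - s) (PJ_meas cQ mf)) inner) _.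
rewrite subr0 /=.
have alg (p E : R) : 0 < p -> M / 2 * E = M * ((2 * p)^-1 * E) * p by move=> h; field; rewrite gt_eqF.
rewrite (alg pi) //.
apply: ler_wpM2l; last exact: le_trans sx xp.
by apply: mulr_ge0 => //; apply: mulr_ge0; [exact: ltW|exact: expR_ge0].
Qed.

Lemma geometric_limit (u : nat -> R) (c : R) : (forall n, `|u n.+1 - u n| <= c / 2 ^+ n) ->
  exists l, forall n, `|u n - l| <= 2 * c / 2 ^+ n.
Proof.
move=> H.
have p2 n : 0 < 2 ^+ n :> R by rewrite exprn_gt0.
have c0 : 0 <= c by have := H 0%N; rewrite expr0 divr1; exact: le_trans.
pose e n : R := 2 * c / 2 ^+ n.
have e0 n : 0 <= e n by rewrite divr_ge0 ?mulr_ge0 // ltW.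
have eS n : e n = c / 2 ^+ n + e n.+1.
  by rewrite /e exprS; field; rewrite gt_eqF.
have lo n k : u n - e n <= u (n + k)%N - e (n + k)%N /\ u (n + k)%N + e (n + k)%N <= u n + e n.
  elim: k => [|k [h1 h2]]; first by rewrite addn0.
  rewrite addnS; have := H (n + k)%N; rewrite ler_norml => /andP[k1 k2].
  by have := eS (n + k)%N; move=> *; split; lra.
have cross n m : u n - e n <= u m + e m.
  have [h1 _] := lo n m; have [_ h2] := lo m n; rewrite addnC in h2.
  by have := e0 (n + m)%N; lra.
exists (sup (range (fun n => u n - e n))) => n.
have hs : has_sup (range (fun n => u n - e n)).
  by split; [exists (u 0%N - e 0%N), 0%N|exists (u 0%N + e 0%N) => _ [m _ <-]].
have h1 : u n - e n <= sup (range (fun n => u n - e n)).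
  by apply: ub_le_sup; [case: hs|exists n].
have h2 : sup (range (fun n => u n - e n)) <= u n + e n.
  by apply: ge_sup; [case: hs|move=> _ [m _ <-]].
by rewrite -/(e n) ler_norml; apply/andP; split; lra.
Qed.

Lemma geometric_to0 (c : R) : (fun n => c / 2 ^+ n) @ \oo --> 0.
Proof.
have := @cvg_geometric R c (2^-1); rewrite /geometric.
have -> : `|2^-1 : R| < 1 by rewrite ger0_norm ?invr_ge0 // invf_lt1 // ltr1n.
move=> /(_ isT); under eq_fun do rewrite exprVn.
exact.
Qed.

Lemma le_geometric0 (x c : R) : (forall n, x <= c / 2 ^+ n) -> x <= 0.
Proof.
move=> h; apply/ler_addgt0Pr => e e0; have [n hn] := @half_pow_small R c e e0.
by apply: le_trans (h n) _; rewrite add0r ltW.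
Qed.

(** Picard iteration of b0 + J f converges geometrically in the norm weighted as in
    [J_contraction]. *)
Theorem kernel_exists Q (b0 : R * R -> C) (B0 : R) : potential Q -> Cmeas b0 ->
  (forall p, nc (b0 p) <= B0) ->
  exists (b : R * R -> C) (B : R), [/\ Cmeas b, forall p, nc (b p) <= B &
    forall p, tri p -> b p = b0 p + J Q b p.1 p.2].
Proof.
move=> pQ mb0 hb0; have cQ := potential_Cable pQ.
have B00 : 0 <= B0 := le_trans (nc_ge0 _) (hb0 (0, 0)).
have [m m0 hm] := J_contraction pQ.
pose T (f : R * R -> C) p := (tri p)%:R * (b0 p + J Q f p.1 p.2).
have N0 : 0 <= RI (fun x => nc (Q x)) by apply: RI_ge0 => x; exact: nc_ge0.
have T_meas f B : Cmeas f -> (forall p, nc (f p) <= B) -> Cmeas (T f).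
  move=> mf hf; apply: CmeasM; first exact: Cmeas_tri.
  by apply: CmeasD => //; exact: (J_meas cQ mf).
have J_bd f B : Cmeas f -> (forall p, nc (f p) <= B) ->
    forall p, tri p -> nc (J Q f p.1 p.2) <= B * RI (fun x => nc (Q x)) * pi.
  move=> mf hf [x s] /and3P[/= s0 sx xp].
  have B1 : 0 <= B := le_trans (nc_ge0 _) (hf (0, 0)).
  apply: le_trans (Iv_le s0 (Cmeas_pair2 (x - s) (PJ_meas cQ mf)) (fun y _ _ => PJ_le cQ mf hf _ y)) _.
  by rewrite subr0 ler_wpM2l ?mulr_ge0 //; exact: le_trans sx xp.
have T_bd f B : Cmeas f -> (forall p, nc (f p) <= B) -> exists B', forall p, nc (T f p) <= B'.
  move=> mf hf; exists (B0 + B * RI (fun x => nc (Q x)) * pi) => p.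
  have B1 : 0 <= B := le_trans (nc_ge0 _) (hf (0, 0)).
  rewrite /T ncM nc_boolE; have [tp|tp] := boolP (tri p).
    by rewrite mul1r; apply: le_trans (ncD _ _) (lerD (hb0 p) _); exact: J_bd hf _ tp.
  by rewrite mul0r addr_ge0 // !mulr_ge0 // pi_ge0.
pose s n := iter n T (fun=> 0).
have s0E p : s 0%N p = 0 by [].
have s_ok n : Cmeas (s n) /\ exists B, forall p, nc (s n p) <= B.
  elim: n => [|n [IH1 [B IH2]]].
    by split; [exact: Cmeas_cst|exists 0 => p; rewrite s0E nc0].
  by split; [exact: T_meas IH2|exact: T_bd IH2].
have step n p : nc (s n.+1 p - s n p) <= B0 / 2 ^+ n * expR (m * p.1).
  elim: n p => [|n IH] p.
    rewrite expr0 divr1 s0E subr0 -[s 1%N]/(T (fun=> 0)) /T ncM nc_boolE.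
    have J0 : J Q (fun=> 0) p.1 p.2 = 0.
      rewrite /J -[RHS](@CI0 R); apply: eq_CI => y.
      rewrite (_ : PJ _ _ _ _ = 0) ?mulr0 // /PJ -[RHS](@CI0 R).
      by apply: eq_CI => u; rewrite !mulr0.
    rewrite J0 addr0; have [tp|tp] := boolP (tri p); last by rewrite mul0r mulr_ge0 // expR_ge0.
    rewrite mul1r; apply: le_trans (hb0 p) _; rewrite ler_peMr // -expR0 ler_expR mulr_ge0 ?(ltW m0) //.
    by move/and3P: tp => [a1 a2 _]; exact: le_trans a1 a2.
  have [m1 [B1 h1]] := s_ok n; have [m2 [B2 h2]] := s_ok n.+1.
  have -> : s n.+2 p - s n.+1 p = (tri p)%:R * J Q (fun p => s n.+1 p - s n p) p.1 p.2.
    rewrite (JB _ _ cQ m2 m1 h2 h1) -[s n.+2]/(T (s n.+1)) -[s n.+1 in LHS]/(T (s n)) /T.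
    by rewrite -mulrBr; congr (_ * _); rewrite opprD addrACA subrr add0r.
  rewrite ncM nc_boolE; have [tp|tp] := boolP (tri p); last first.
    by rewrite mul0r mulr_ge0 ?expR_ge0 // divr_ge0 // exprn_ge0.
  rewrite mul1r exprSr invfM mulrA.
  apply: (hm _ (B2 + B1)) => //.
  - exact: CmeasB.
  - by move=> r; apply: le_trans (ncB _ _) (lerD (h2 r) (h1 r)).
  - by rewrite divr_ge0 // exprn_ge0.
have E0 p : 0 <= expR (m * p.1) := expR_ge0 _.
have lim p : exists l : C, forall n, nc (s n p - l) <= 4 * (B0 * expR (m * p.1)) / 2 ^+ n.
  have [|a ha] := @geometric_limit (fun n => Re (s n p)) (B0 * expR (m * p.1)).
    move=> n; rewrite -cReB mulrAC; exact: le_trans (nc_Re _) (step n p).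
  have [|b hb] := @geometric_limit (fun n => Im (s n p)) (B0 * expR (m * p.1)).
    move=> n; rewrite -cImB mulrAC; exact: le_trans (nc_Im _) (step n p).
  exists (a +i* b) => n; apply: le_trans (nc_ReIm _) _; rewrite cReB cImB /=.
  have := ha n; have := hb n; rewrite mulrAC -[4 * _ / _]mulrAC; lra.
have /choice[b hb] := lim.
have soff n p : ~~ tri p -> s n p = 0.
  by case: n => [|n] // /negPf tp; rewrite -[s n.+1]/(T (s n)) /T tp mul0r.
have boff p : ~~ tri p -> b p = 0.
  move=> tp; apply: nc_eq0; apply/eqP; rewrite eq_le nc_ge0 andbT.
  by apply: (@le_geometric0 _ (4 * (B0 * expR (m * p.1)))) => n; have := hb p n; rewrite soff // sub0r ncN.
have mb : Cmeas b.
  have cvg (u : nat -> R * R -> R) (v : R * R -> R) : (forall n, measurable_fun setT (u n)) ->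
     (forall p, exists c, forall n, `|u n p - v p| <= c / 2 ^+ n) -> measurable_fun setT v.
    move=> mu' h; apply: (@measurable_fun_cvg _ _ R setT u) => // p _.
    have [c hc] := h p; apply/cvgrPdist_le => e e0.
    have := @geometric_to0 c; move/cvgrPdist_le => /(_ e e0); apply: filterS => n.
    rewrite sub0r normrN distrC => h'; apply: le_trans (hc n) _; exact: le_trans (ler_norm _) h'.
  split; [apply: (cvg (fun n p => Re (s n p)))|apply: (cvg (fun n p => Im (s n p)))].
  - by move=> n; have [[]] := s_ok n.
  - move=> p; exists (4 * (B0 * expR (m * p.1))) => n; rewrite -cReB; exact: le_trans (nc_Re _) (hb p n).
  - by move=> n; have [[]] := s_ok n.
  - move=> p; exists (4 * (B0 * expR (m * p.1))) => n; rewrite -cImB; exact: le_trans (nc_Im _) (hb p n).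
have expB p : tri p -> expR (m * p.1) <= expR (m * pi).
  by move=> /and3P[_ _ h]; rewrite ler_expR ler_pM2l.
pose B := 4 * (B0 * expR (m * pi)).
have hB p : nc (b p) <= B.
  have [tp|tp] := boolP (tri p); last first.
    by rewrite boff // nc0 /B !mulr_ge0 // expR_ge0.
  have := hb p 0%N; rewrite s0E sub0r ncN expr0 divr1 => /le_trans; apply.
  by rewrite ler_wpM2l // ler_wpM2l // expB.
exists b, B; split => // p tp.
apply/eqP; rewrite -subr_eq0; apply/eqP/nc_eq0/eqP; rewrite eq_le nc_ge0 andbT.
apply: (@le_geometric0 _ (8 * (B0 * expR (m * p.1)))) => n.
have [m1 [B1 h1]] := s_ok n.
have dB q : nc (s n q - b q) <= B1 + B by apply: le_trans (ncB _ _) (lerD (h1 q) (hB q)).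
have dw q : nc (s n q - b q) <= 4 * B0 / 2 ^+ n * expR (m * q.1).
  by have := hb q n; rewrite [4 * (B0 * _)]mulrA mulrAC.
have h3 := hm _ _ (4 * B0 / 2 ^+ n) (CmeasB m1 mb) dB _ dw p tp.
rewrite (JB _ _ cQ m1 mb h1 hB) in h3.
have -> : b p - (b0 p + J Q b p.1 p.2) = (J Q (s n) p.1 p.2 - J Q b p.1 p.2) - (s n.+1 p - b p).
  rewrite -[s n.+1]/(T (s n)) /T tp mul1r.
  have alg (u v w z : C) : u - (v + w) = z - w - (v + z - u) by ring.
  exact: alg.
apply: le_trans (ncB _ _) _.
have h4 := hb p n.+1; rewrite exprS invfM in h4.
have h5 : nc (J Q (s n) p.1 p.2 - J Q b p.1 p.2) <= 4 * B0 / 2 ^+ n / 2 * expR (m * p.1).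
  by apply: h3; rewrite divr_ge0 ?mulr_ge0 // exprn_ge0.
apply: le_trans (lerD h5 h4) _.
have : 0 <= B0 * expR (m * p.1) / 2 ^+ n by rewrite divr_ge0 ?mulr_ge0 // exprn_ge0.
have alg (a E t : R) : 0 <= a * E * t ->
    4 * a * t / 2 * E + 4 * (a * E) * (2^-1 * t) <= 8 * (a * E) * t by move=> h; lra.
exact: alg.
Qed.

End Kernel.

(** * Volterra inequalities and the antisymmetric kernel *)

Section Volterra.
Variable R : realType.
Local Notation C := R[i].
Local Notation nc := (@Normc.normc R).
Local Notation mu := (@lebesgue_measure R).
Implicit Types Q : R -> C.

(** The last premise is the inequality |D x| <= k * (integral of g |D| over (0, x)),
    tested on exponential bounds only; each application halves the bound. *)
Lemma volterra_zero (g : R -> R) (k M0 : R) (D : R -> C) : measurable_fun setT g ->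
  (forall x, 0 <= g x) -> (forall x, ~~ ((0 < x) && (x < pi)) -> g x = 0) ->
  Rable (fun x => g x ^+ 2) -> 0 < k -> (forall x, 0 <= x <= pi -> nc (D x) <= M0) ->
  (forall m M : R, 0 <= M ->
     (forall x : R, Rable (fun t => (t < x)%R%:R * (g t * expR (m * t)))) ->
     (forall x, 0 <= x <= pi -> nc (D x) <= M * expR (m * x)) ->
     forall x, 0 <= x <= pi ->
       nc (D x) <= k * (M * RI (fun t => (t < x)%R%:R * (g t * expR (m * t))))) ->
  forall x, 0 <= x <= pi -> D x = 0.
Proof.
move=> mg g0 sg ig k0 hM0 H x hx.
have th0 : 0 < (2 * k)^-1 by rewrite invr_gt0 mulr_gt0.
have [m m0 hm] := weight mg g0 sg ig th0.
have P n : forall x, 0 <= x <= pi -> nc (D x) <= `|M0| / 2 ^+ n * expR (m * x).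
  elim: n => [|n IH] t ht.
    have t0 : 0 <= t by case/andP: ht.
    have E1 : 1 <= expR (m * t) by rewrite -expR0 ler_expR mulr_ge0 // ltW.
    apply: le_trans (hM0 t ht) _; rewrite expr0 divr1.
    exact: le_trans (ler_norm _) (ler_peMr (normr_ge0 _) E1).
  have M1 : 0 <= `|M0| / 2 ^+ n by rewrite divr_ge0 // exprn_ge0.
  apply: le_trans (H m _ M1 (fun x => (hm x).1) IH t ht) _.
  apply: le_trans (ler_wpM2l (ltW k0) (ler_wpM2l M1 (hm t).2)) _.
  have alg (X E : R) : k * (X * ((2 * k)^-1 * E)) = X / 2 * E by field; rewrite gt_eqF.
  by rewrite alg exprSr invfM mulrA.
apply: nc_eq0; apply/eqP; rewrite eq_le nc_ge0 andbT.
apply: (@le_geometric0 R _ (`|M0| * expR (m * x))) => n.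
by rewrite mulrAC; exact: P.
Qed.

(** The product is a double integral, cut along the diagonal, which is a null set. *)
Lemma CI_prod (f g : R -> C) : Cable f -> Cable g ->
  [/\ Cable (fun t => f t * CI (fun s => (s < t)%R%:R * g s)),
      Cable (fun s => g s * CI (fun t => (t < s)%R%:R * f t)) &
      CI f * CI g = CI (fun t => f t * CI (fun s => (s < t)%R%:R * g s)) +
                    CI (fun s => g s * CI (fun t => (t < s)%R%:R * f t))].
Proof.
have half (h k : R -> C) : Cable h -> Cable k ->
    Cable (fun t => h t * CI (fun s => (s < t)%R%:R * k s)).
  move=> ch ck; apply: (Cable_dom _ (RableZ (RI (fun x => nc (k x))) (Cable_nc ch))).
    by apply: CmeasM; [exact: Cable_meas|exact: Gam_meas].
  by move=> t; rewrite ncM mulrC ler_wpM2r ?nc_ge0 //; exact: Gam_le.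
move=> cf cg; have c1 := half _ _ cf cg; have c2 := half _ _ cg cf.
split => //.
pose P (p : R * R) : C := f p.1 * ((p.2 < p.1)%R%:R * g p.2).
have mP : Cmeas P.
  apply: CmeasM; first by apply: (Cmeas_comp (Cable_meas cf)); exact: measurable_fst.
  apply: CmeasM; first by apply: Cmeas_lt; [exact: measurable_snd|exact: measurable_fst].
  by apply: (Cmeas_comp (Cable_meas cg)); exact: measurable_snd.
have domP t s : nc (P (t, s)) <= nc (f t) * nc (g s).
  by rewrite /P /= !ncM ler_wpM2l ?nc_ge0 // ler_piMl ?nc_ge0 // nc_bool.
have fub := CI_fubini mP (Cable_nc cf) (Cable_nc cg) domP.
have e1 : CI (fun t => CI (fun s => P (t, s))) = CI (fun t => f t * CI (fun s => (s < t)%R%:R * g s)).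
  by apply: eq_CI => t; rewrite -(CIZ (f t) (Gam_Cable t cg)).
have mgt s : Cable (fun t => (s < t)%R%:R * f t).
  apply: CableM (_ : Cmeas _) (fun x => nc_bool _ _) cf.
  by apply: Cmeas_lt.
have e2 : CI (fun s => CI (fun t => P (t, s))) = CI (fun s => g s * CI (fun t => (s < t)%R%:R * f t)).
  apply: eq_CI => s; rewrite -(CIZ (g s) (mgt s)); apply: eq_CI => t.
  have alg (a b c : C) : a * (b * c) = c * (b * a) by ring.
  exact: alg.
have e3 s : CI (fun t => (s < t)%R%:R * f t) = CI f - CI (fun t => (t < s)%R%:R * f t).
  rewrite -(CIB cf (Gam_Cable s cf)).
  apply: CI_ae.
  - exact: Cable_meas (mgt s).
  - by apply: CmeasB; [exact: Cable_meas|exact: Cable_meas (Gam_Cable s cf)].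
  apply: (@filterS _ _ (ae_filter_ringOfSetsType mu) _ _ _ (ae_neq s)) => t ts.
  have [st|st|st] := ltgtP s t.
  - by rewrite mul1r mul0r subr0.
  - by rewrite mul1r mul0r subrr.
  - by rewrite st eqxx in ts.
rewrite -e1 fub e2.
rewrite (_ : CI (fun s => g s * _) = CI (fun s => CI f * g s - g s * CI (fun t => (t < s)%R%:R * f t))).
  rewrite (CIB (CableZ (CI f) cg) c2) (CIZ (CI f) cg).
  by rewrite subrK.
by apply: eq_CI => s; rewrite e3 mulrBr mulrC.
Qed.

(** Integration by parts for functions that are only absolutely continuous. *)
Lemma Iv_prod (f g : R -> C) (F0 G0 : C) (x : R) :
  Cable (fun t => oo 0 x t * f t) -> Cable (fun t => oo 0 x t * g t) ->
  (F0 + Iv f 0 x) * (G0 + Iv g 0 x) = F0 * G0 +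
    Iv (fun t => f t * (G0 + Iv g 0 t) + (F0 + Iv f 0 t) * g t) 0 x.
Proof.
move=> cf cg; have [c1 c2 e] := CI_prod cf cg.
have IvE (h : R -> C) t : t < x -> CI (fun s => (s < t)%R%:R * (oo 0 x s * h s)) = Iv h 0 t.
  move=> tx; apply: eq_CI => s; rewrite mulrA /oo -natrM mulnb; congr (_%:R * _).
  by case: (ltP s t) => st; rewrite ?andbF // (lt_trans st tx) andbT.
have sub (h k : R -> C) t : oo 0 x t * h t * CI (fun s => (s < t)%R%:R * (oo 0 x s * k s)) =
   oo 0 x t * (h t * Iv k 0 t).
  rewrite /oo; case: (ltP t x) => tx; last by rewrite andbF !mul0r.
  by rewrite IvE // mulrA.
have -> : Iv (fun t => f t * (G0 + Iv g 0 t) + (F0 + Iv f 0 t) * g t) 0 x =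
    G0 * Iv f 0 x + F0 * Iv g 0 x + Iv f 0 x * Iv g 0 x.
  rewrite [X in _ + X]e -(CIZ G0 cf) -(CIZ F0 cg) -(CID (CableZ G0 cf) (CableZ F0 cg)).
  rewrite -(CID c1 c2) -(CID (CableD (CableZ G0 cf) (CableZ F0 cg)) (CableD c1 c2)).
  apply: eq_CI => t; rewrite !sub.
  have alg (o a b u v G F : C) : o * (a * (G + v) + (F + u) * b) =
     G * (o * a) + F * (o * b) + (o * (a * v) + o * (b * u)) by ring.
  exact: alg.
by ring.
Qed.

Lemma Cmeas_oo_y (w u : R) : Cmeas (fun y : R => oo y (w + y) u : C).
Proof.
apply: Cmeas_oo3; [exact: measurable_id| |exact: measurable_cst].
by apply: measurable_funD; [exact: measurable_cst|exact: measurable_id].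
Qed.

(** Integrating over u last exposes the reflection of y to u - y in the inner integral.
    *)
Lemma J_swap Q (f : R * R -> C) (B w s : R) : Cable Q -> Cmeas f -> (forall p, nc (f p) <= B) ->
  CI (fun y => oo 0 s y * PJ Q f w y) =
  CI (fun u => Q u * CI (fun y => oo 0 s y * (oo y (w + y) u * f (u, y)))).
Proof.
move=> cQ mf hf; have B0 : 0 <= B := le_trans (nc_ge0 _) (hf (0, 0)).
pose P (p : R * R) : C := oo 0 s p.1 * (oo p.1 (w + p.1) p.2 * (Q p.2 * f (p.2, p.1))).
have mP : Cmeas P.
  have m1 : measurable_fun setT (fun p : R * R => p.1) by exact: measurable_fst.
  have m2 : measurable_fun setT (fun p : R * R => p.2) by exact: measurable_snd.
  apply: CmeasM; first by apply: Cmeas_oo3.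
  apply: CmeasM; first by apply: Cmeas_oo3 => //; exact: measurable_funD.
  apply: CmeasM; first exact: (Cmeas_comp (Cable_meas cQ)).
  by apply: (Cmeas_comp mf); exact: measurable_fun_pair.
have dom y u : nc (P (y, u)) <= ((0 < y) && (y < s))%:R * (B * nc (Q u)).
  rewrite /P /= !ncM nc_oo; apply: ler_wpM2l => //.
  have := nc_oo_le1 y (w + y) u; have := nc_ge0 (oo y (w + y) u).
  have := hf (u, y); have := nc_ge0 (f (u, y)); have := nc_ge0 (Q u).
  move: (nc (oo _ _ _)) (nc (Q u)) (nc (f _)) => a b c b0 c0 cB a0 a1.
  have h : b * c <= B * b by rewrite mulrC ler_wpM2r.
  by apply: le_trans h; rewrite ler_piMl // mulr_ge0.
have fub := CI_fubini mP (Rable_oo 0 s) (RableZ B (Cable_nc cQ)) dom.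
transitivity (CI (fun y => CI (fun u => P (y, u)))).
  by apply: eq_CI => y; rewrite -(CIZ (oo 0 s y) (PJ_Cable cQ mf hf y (w + y) y)).
rewrite fub; apply: eq_CI => u; rewrite -CIZ.
  apply: eq_CI => y; rewrite /P /=.
  have alg (a b c d : C) : a * (b * (c * d)) = c * (a * (b * d)) by ring.
  exact: alg.
apply: (Cable_bd (B := B)).
  by apply: CmeasM; [exact: Cmeas_oo_y|exact: Cmeas_pair2].
move=> y _ _; rewrite ncM; have := nc_oo_le1 y (w + y) u; have := nc_ge0 (oo y (w + y) u).
by have := hf (u, y); have := nc_ge0 (f (u, y)); nra.
Qed.

(** The equation is invariant under reflecting s to x - s together with a change of
    sign, so the antisymmetric part of a solution is a solution. The antisymmetry is
    what makes the final step of the uniqueness proof a system without boundary terms,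
    see [Iv_G_total]. *)
Theorem antisymmetric_kernel Q : potential Q ->
  exists (b : R * R -> C) (B : R), [/\ Cmeas b, forall p, nc (b p) <= B,
    forall x s, b (x, x - s) = - b (x, s) &
    forall x s, tri (x, s) -> b (x, s) = Gam Q (x - s) - Gam Q s + J Q b x s].
Proof.
move=> pQ; have cQ := potential_Cable pQ.
have m1 : measurable_fun setT (fun p : R * R => p.1) by exact: measurable_fst.
have m2 : measurable_fun setT (fun p : R * R => p.2) by exact: measurable_snd.
have mG := Gam_meas cQ.
have [||b [B [mb hb eb]]] := @kernel_exists R Q (fun p => Gam Q (p.1 - p.2) - Gam Q p.2)
   (RI (fun x => nc (Q x)) + RI (fun x => nc (Q x))) pQ.
- by apply: CmeasB; apply: (Cmeas_comp mG) => //; exact: measurable_funB.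
- by move=> p; apply: le_trans (ncB _ _) (lerD _ _); exact: Gam_le.
pose r (p : R * R) : C := b (p.1, p.1 - p.2).
have mr : Cmeas r.
  by apply: (Cmeas_comp mb); apply: measurable_fun_pair => //; exact: measurable_funB.
have hr p : nc (r p) <= B by exact: hb.
have Jr x s : J Q r x s = J Q b x (x - s).
  rewrite /J (J_swap _ _ cQ mr hr) (J_swap _ _ cQ mb hb).
  apply: eq_CI => u; congr (_ * _).
  set h := fun y => _; rewrite -(@CI_reflect R u h); last first.
    apply: (Cable_bd (B := B)).
      by apply: CmeasM; [exact: Cmeas_oo_y|exact: Cmeas_pair2].
    move=> y _ _; rewrite ncM; have := nc_oo_le1 y (x - s + y) u; have := nc_ge0 (oo y (x - s + y) u).
    by have := hr (u, y); have := nc_ge0 (r (u, y)); nra.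
  apply: eq_CI => y; rewrite /h /r /= subKr !mulrA -!natrM !mulnb; congr (_%:R * _).
  rewrite (_ : (0 < u - y) = (y < u)); last by rewrite subr_gt0.
  rewrite (_ : (u - y < s) = (u < x - (x - s) + y)); last by rewrite subKr ltrBlDr.
  rewrite (_ : (u - y < u) = (0 < y)); last by rewrite ltrBlDr ltrDl.
  rewrite (_ : (u < x - s + (u - y)) = (y < x - s)); last by apply/idP/idP; lra.
  by case: (y < u); case: (u < _); case: (0 < y); case: (y < _).
exists (fun p => 2^-1 * (b p - r p)), (2^-1 * (B + B)); split.
- by apply: CmeasM; [exact: Cmeas_cst|exact: CmeasB].
- move=> p; rewrite ncM ncV nc_nat ler_wpM2l //; exact: le_trans (ncB _ _) (lerD (hb p) (hr p)).
- by move=> x s; rewrite /r /= subKr; ring.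
move=> x s tp.
have tp' : tri (x, x - s).
  move: tp => /and3P[/= a1 a2 a3]; apply/and3P; split => //=; lra.
have JZ : J Q (fun p => 2^-1 * (b p - r p)) x s = 2^-1 * (J Q b x s - J Q r x s).
  rewrite -(JB _ _ cQ mb mr hb hr) /J -CIZ; last first.
    exact: (J_Cable cQ (CmeasB mb mr) (fun p => le_trans (ncB _ _) (lerD (hb p) (hr p)))).
  apply: eq_CI => y; rewrite mulrCA; congr (_ * _).
  rewrite /PJ -CIZ; last exact: (PJ_Cable cQ (CmeasB mb mr) (fun p => le_trans (ncB _ _) (lerD (hb p) (hr p)))).
  apply: eq_CI => u; have alg (o q c X : C) : o * (q * (c * X)) = c * (o * (q * X)) by ring.
  exact: alg.
rewrite JZ Jr /r /= (eb _ tp) (eb _ tp') /= subKr.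
have alg (a c j k : C) : 2^-1 * (a - c + j - (c - a + k)) = a - c + 2^-1 * (j - k).
  by field.
exact: alg.
Qed.

End Volterra.

(** * A change of variables on a triangle *)

Section Representation.
Variable R : realType.
Local Notation C := R[i].
Local Notation nc := (@Normc.normc R).
Implicit Types Q : R -> C.

Definition expm (nu : C) (t : R) : C := cexp (- nu * t%:C).

Lemma expmD nu s t : expm nu (s + t) = expm nu s * expm nu t.
Proof. by rewrite /expm -cexpD rmorphD mulrDr. Qed.
Lemma Rd_expm nu t : Rd (expm nu) t (expm nu t * - nu).
Proof.
apply: (@Rd_comp _ (@cexp R) (fun t => - nu * t%:C)); first exact: Cd_cexp.
have -> : (fun t : R => - nu * t%:C) = (fun t => 0 + - nu * t%:C) by apply/funext => x; rewrite add0r.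
exact: Rd_line.
Qed.
Lemma Rcont_expm nu t : Rcont (expm nu) t.
Proof. exact: Rd_cont (Rd_expm nu t). Qed.
Lemma Cmeas_expm nu : Cmeas (expm nu).
Proof. by apply: Rcont_meas => t; exact: Rcont_expm. Qed.
Lemma expm0 nu : expm nu 0 = 1.
Proof. by rewrite /expm mulr0 cexp0. Qed.
Lemma expm_le nu (a t : R) : `|t| <= a -> nc (expm nu t) <= expR (nc nu * a).
Proof.
move=> ta; apply: le_trans (cexp_nc_le _) _; rewrite ler_expR ncM ncN nc_real.
by rewrite ler_wpM2l ?nc_ge0.
Qed.
Lemma expm_le_oo nu (x t : R) : 0 < t -> t < x -> nc (expm nu t) <= expR (nc nu * x).
Proof. by move=> t0 tx; apply: expm_le; rewrite gtr0_norm // ltW. Qed.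

Lemma oo_swap (x u y : R) : oo 0 x u * oo 0 u y = oo 0 x y * oo y x u :> C.
Proof.
rewrite /oo -!natrM !mulnb; congr (_%:R).
have [u0|u0] := ltP 0 u; have [ux|ux] := ltP u x; have [y0|y0] := ltP 0 y;
  have [yu|yu] := ltP y u; rewrite ?andbF ?andbT //=.
  by rewrite (lt_trans yu ux).
by have := lt_trans y0 yu; rewrite ltNge u0.
Qed.

Lemma oo_shear (x s y : R) :
  oo 0 x (s - y) * oo 0 (x - (s - y)) y = oo 0 x s * oo 0 s y :> C.
Proof.
rewrite /oo -!natrM !mulnb; congr (_%:R).
rewrite subr_gt0 (_ : (y < x - (s - y)) = (s < x)); last by apply/idP/idP; lra.
have [y0|y0] := ltP 0 y; rewrite ?andbF //=.
have [ys|ys] := ltP y s; rewrite ?andbF //=.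
have [sx|sx] := ltP s x; rewrite ?andbF //=.
by have [-> ->] : 0 < s /\ s - y < x by split; lra.
Qed.

(** The substitution s = u + y, applied after exchanging the two integrations. *)
Lemma shear (F : R * R -> C) (h : R -> R) (nu : C) (x : R) : 0 <= x -> Cmeas F -> Rable h ->
  (forall y, 0 <= h y) -> (forall w y, 0 < y -> y < x -> nc (F (w, y)) <= h y) ->
  Iv (fun u => expm nu u * CI (fun y => oo 0 (x - u) y * (expm nu y * F (x - u - y, y)))) 0 x =
  Iv (fun s => expm nu s * CI (fun y => oo 0 s y * F (x - s, y))) 0 x.
Proof.
move=> x0 mF ih h0 hF.
pose EB := expR (nc nu * x); have EB0 : 0 <= EB := expR_ge0 _.
have m1 : measurable_fun setT (fun p : R * R => p.1) by exact: measurable_fst.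
have m2 : measurable_fun setT (fun p : R * R => p.2) by exact: measurable_snd.
have mE1 : Cmeas (fun p : R * R => expm nu p.1) by exact: (Cmeas_comp (Cmeas_expm nu)).
have mE2 : Cmeas (fun p : R * R => expm nu p.2) by exact: (Cmeas_comp (Cmeas_expm nu)).
have mx1 : measurable_fun setT (fun p : R * R => x - p.1).
  by apply: measurable_funB; [exact: measurable_cst|exact: m1].
pose P (p : R * R) : C := oo 0 x p.1 * (expm nu p.1 * (oo 0 (x - p.1) p.2 * (expm nu p.2 * F (x - p.1 - p.2, p.2)))).
pose P2 (p : R * R) : C := oo 0 x p.1 * (expm nu p.1 * (oo 0 p.1 p.2 * F (x - p.1, p.2))).
have mP : Cmeas P.
  apply: CmeasM; first by apply: Cmeas_oo3; [exact: measurable_cst|exact: measurable_cst|exact: m1].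
  apply: CmeasM; first exact: mE1.
  apply: CmeasM; first by apply: Cmeas_oo3; [exact: measurable_cst|exact: mx1|exact: m2].
  apply: CmeasM; first exact: mE2.
  apply: (Cmeas_comp (g := fun p : R * R => (x - p.1 - p.2, p.2)) mF).
  by apply: measurable_fun_pair; [apply: measurable_funB; [exact: mx1|exact: m2]|exact: m2].
have mP2 : Cmeas P2.
  apply: CmeasM; first by apply: Cmeas_oo3; [exact: measurable_cst|exact: measurable_cst|exact: m1].
  apply: CmeasM; first exact: mE1.
  apply: CmeasM; first by apply: Cmeas_oo3; [exact: measurable_cst|exact: m1|exact: m2].
  apply: (Cmeas_comp (g := fun p : R * R => (x - p.1, p.2)) mF).
  by apply: measurable_fun_pair; [exact: mx1|exact: m2].
pose g1 (u : R) : R := EB * ((0 < u) && (u < x))%:R.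
have ig1 : Rable g1 by apply: RableZ; exact: Rable_oo.
pose g2 (y : R) : R := (EB + 1) * h y.
have ig2 : Rable g2 by exact: RableZ.
have g20 y : 0 <= g2 y by rewrite mulr_ge0 // addr_ge0.
have b1 u y : 0 < u -> u < x ->
    nc (oo 0 (x - u) y * (expm nu y * F (x - u - y, y))) <= g2 y.
  move=> u0 ux; have [hy|hy] := boolP ((0 < y) && (y < x - u)); last first.
    by rewrite /oo (negPf hy) mul0r nc0; exact: g20.
  rewrite /oo hy mul1r ncM; move/andP: hy => [y0 yx]; apply: ler_pM; rewrite ?nc_ge0 //.
    by apply: le_trans (_ : _ <= EB) _; [apply: expm_le_oo => //; lra|rewrite lerDl].
  by apply: hF => //; lra.
have b2 s y : 0 < s -> s < x -> nc (oo 0 s y * F (x - s, y)) <= g2 y.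
  move=> s0 sx; have [hy|hy] := boolP ((0 < y) && (y < s)); last first.
    by rewrite /oo (negPf hy) mul0r nc0; exact: g20.
  rewrite /oo hy mul1r; move/andP: hy => [y0 yx].
  apply: le_trans (hF _ _ y0 (lt_trans yx sx)) _.
  by rewrite -[leLHS]mul1r ler_wpM2r // lerDr.
have dom (H : R * R -> C) u y : (0 < u -> u < x -> nc (H (u, y)) <= g2 y) ->
    nc (oo 0 x u * (expm nu u * H (u, y))) <= g1 u * g2 y.
  move=> hH; rewrite /g1.
  have [hu|hu] := boolP ((0 < u) && (u < x)); last first.
    by rewrite /oo (negPf hu) mul0r nc0 mulr0 mul0r.
  rewrite /oo hu mul1r mulr1 ncM.
  by move/andP: hu => [u0 ux]; apply: ler_pM; rewrite ?nc_ge0 //; [exact: expm_le_oo|exact: hH].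
have dP u y : nc (P (u, y)) <= g1 u * g2 y.
  by apply: (dom (fun p => oo 0 (x - p.1) p.2 * (expm nu p.2 * F (x - p.1 - p.2, p.2)))) => u0 ux; exact: b1.
have dP2 s y : nc (P2 (s, y)) <= g1 s * g2 y.
  by apply: (dom (fun p => oo 0 p.1 p.2 * F (x - p.1, p.2))) => u0 ux; exact: b2.
have cP y : Cable (fun u => P (u, y)).
  apply: (Cable_dom (Cmeas_pair1 y mP) (RableZ (g2 y) ig1)) => u.
  by rewrite mulrC; exact: dP.
have fold (H : R -> R -> C) : (forall u y, 0 < u -> u < x -> nc (H u y) <= g2 y) ->
    (forall u, Cmeas (H u)) ->
    Iv (fun u => expm nu u * CI (H u)) 0 x = CI (fun u => CI (fun y => oo 0 x u * (expm nu u * H u y))).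
  move=> hH mH; apply: eq_CI => u.
  have [hu|hu] := boolP ((0 < u) && (u < x)); last first.
    rewrite /oo (negPf hu) mul0r -[LHS](@CI0 R); apply: eq_CI => y; by rewrite mul0r.
  move/andP: (hu) => [u0 ux].
  rewrite mulrA -(CIZ (oo 0 x u * expm nu u) (Cable_dom (mH u) ig2 (fun y => hH u y u0 ux))).
  by apply: eq_CI => y; rewrite mulrA.
rewrite (fold (fun u y => oo 0 (x - u) y * (expm nu y * F (x - u - y, y)))); last 2 first.
- exact: b1.
- move=> u; apply: CmeasM; first exact: Cmeas_oo.
  apply: CmeasM; first exact: Cmeas_expm.
  apply: (Cmeas_comp (g := fun y : R => (x - u - y, y)) mF).
  apply: measurable_fun_pair; last exact: measurable_id.
  by apply: measurable_funB; [exact: measurable_cst|exact: measurable_id].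
rewrite (CI_fubini mP ig1 ig2 dP).
rewrite (fold (fun s y => oo 0 s y * F (x - s, y))); last 2 first.
- exact: b2.
- by move=> u; apply: CmeasM; [exact: Cmeas_oo|exact: Cmeas_pair2].
rewrite (CI_fubini mP2 ig1 ig2 dP2).
apply: eq_CI => y; rewrite -(CI_shift (- y) (cP y)).
apply: eq_CI => s; rewrite /P /P2 /=.
have -> : x - (s - y) - y = x - s by ring.
have -> : expm nu s = expm nu (s - y) * expm nu y by rewrite -expmD subrK.
have alg (a b c d e : C) : a * (b * (c * (d * e))) = a * c * (b * d) * e by ring.
have alg2 (a b c d : C) : a * (b * (c * d)) = a * c * b * d by ring.
by rewrite alg alg2 oo_shear.
Qed.
End Representation.

(** * The transform of an exponential *)

Section Transmutation.
Variable R : realType.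
Local Notation C := R[i].
Local Notation nc := (@Normc.normc R).
Variables (Q : R -> C) (b : R * R -> C) (B : R).
Hypotheses (pQ : potential Q) (mb : Cmeas b) (hb : forall p, nc (b p) <= B)
  (eb : forall x s, tri (x, s) -> b (x, s) = Gam Q (x - s) - Gam Q s + J Q b x s).
Variable nu : C.
Local Notation E := (expm nu).

Let cQ : Cable Q. Proof. exact: potential_Cable. Qed.
Let mQ : Cmeas Q. Proof. by case: pQ. Qed.
Let B0 : 0 <= B. Proof. exact: le_trans (nc_ge0 _) (hb (0, 0)). Qed.

Lemma Iv_Gam x : Iv Q 0 x = Gam Q x.
Proof.
have [_ _ sQ] := pQ; apply: eq_CI => t; rewrite /oo.
by have [t0|t0] := ltP 0 t => //=; rewrite sQ ?mulr0 // (le_gtF t0).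
Qed.

(** For nu = 2 i sqrt lam this is nu e^{-nu x/2} S(x, lam), see [solution_kernel]. *)
Definition Wker (x : R) : C := 1 - E x + Iv (fun y => b (x, y) * E y) 0 x.

Lemma Wker_meas : Cmeas Wker.
Proof.
have m1 : measurable_fun setT (fun p : R * R => p.1) by exact: measurable_fst.
have m2 : measurable_fun setT (fun p : R * R => p.2) by exact: measurable_snd.
suff mF : Cmeas (fun p : R * R => oo 0 p.1 p.2 * (b (p.1, p.2) * E p.2)).
  apply: CmeasD; last exact: (Cmeas_CI mF).
  by apply: CmeasB; [exact: Cmeas_cst|exact: Cmeas_expm].
apply: CmeasM; first by apply: Cmeas_oo3; [exact: measurable_cst|exact: m1|exact: m2].
apply: CmeasM; last exact: (Cmeas_comp (Cmeas_expm nu)).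
by apply: (Cmeas_comp (g := fun p : R * R => (p.1, p.2)) mb); apply: measurable_fun_pair.
Qed.

Lemma Wker_le : exists M, forall x, 0 <= x <= pi -> nc (Wker x) <= M.
Proof.
pose EB := expR (nc nu * pi); exists (1 + EB + B * EB * pi) => x /andP[x0 xp].
have hE t : 0 <= t -> t <= pi -> nc (E t) <= EB by move=> t0 tp; apply: expm_le; rewrite ger0_norm.
apply: le_trans (ncD _ _) _; apply: lerD.
  by apply: le_trans (ncB _ _) _; rewrite nc1 lerD2l hE.
apply: (le_trans (Iv_le (B := B * EB) x0 _ _)).
- apply: CmeasM; last exact: Cmeas_expm.
  exact: (Cmeas_pair2 x mb).
- move=> y y0 yx; rewrite ncM; apply: ler_pM; rewrite ?nc_ge0 //.
  by apply: hE; [exact: ltW|exact: ltW (lt_le_trans yx xp)].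
- by rewrite subr0 ler_wpM2l // mulr_ge0 // expR_ge0.
Qed.

Lemma oo_expm_Cable (x : R) (f : R -> C) : 0 <= x -> Cable f -> Cable (fun t => oo 0 x t * (E t * f t)).
Proof.
move=> x0 cf; apply: (Cable_dom _ (RableZ (expR (nc nu * x)) (Cable_nc cf))).
  apply: CmeasM; first exact: Cmeas_oo.
  by apply: CmeasM; [exact: Cmeas_expm|exact: Cable_meas].
move=> t; have [ht|ht] := boolP ((0 < t) && (t < x)); rewrite /oo ?(negPf ht) ?ht.
  move/andP: ht => [t0 tx]; rewrite mul1r ncM ler_wpM2r ?nc_ge0 //; exact: expm_le_oo.
by rewrite mul0r nc0 mulr_ge0 ?nc_ge0 // expR_ge0.
Qed.

(** Exchanging the two integrations collects the coefficient of each exponential E y. *)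
Lemma Iv_QWker (x : R) : 0 <= x -> Iv (fun u => Q u * Wker u) 0 x =
  Gam Q x + Iv (fun y => E y * (PJ Q b (x - y) y - Q y)) 0 x.
Proof.
move=> x0.
pose EB := expR (nc nu * x); have EB0 : 0 <= EB := expR_ge0 _.
have m1 : measurable_fun setT (fun p : R * R => p.1) by exact: measurable_fst.
have m2 : measurable_fun setT (fun p : R * R => p.2) by exact: measurable_snd.
pose P (p : R * R) : C := oo 0 x p.1 * (Q p.1 * (oo 0 p.1 p.2 * (b (p.1, p.2) * E p.2))).
have mP : Cmeas P.
  apply: CmeasM; first by apply: Cmeas_oo3; [exact: measurable_cst|exact: measurable_cst|exact: m1].
  apply: CmeasM; first exact: (Cmeas_comp mQ).
  apply: CmeasM; first by apply: Cmeas_oo3; [exact: measurable_cst|exact: m1|exact: m2].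
  apply: CmeasM; last exact: (Cmeas_comp (Cmeas_expm nu)).
  by apply: (Cmeas_comp (g := fun p : R * R => (p.1, p.2)) mb); apply: measurable_fun_pair.
have ih : Rable (fun y : R => B * EB * ((0 < y) && (y < x))%:R).
  by apply: RableZ; exact: Rable_oo.
have dP u y : nc (P (u, y)) <= nc (Q u) * (B * EB * ((0 < y) && (y < x))%:R).
  have [hu|hu] := boolP ((0 < u) && (u < x)); last first.
    by rewrite /P /oo /= (negPf hu) mul0r nc0 !mulr_ge0 ?nc_ge0.
  have [hy|hy] := boolP ((0 < y) && (y < u)); last first.
    by rewrite /P /oo /= (negPf hy) !(mul0r, mulr0) nc0 !mulr_ge0 ?nc_ge0.
  rewrite /P /oo /= hu hy !mul1r; move/andP: hu => [u0 ux]; move/andP: hy => [y0 yu].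
  have yx := lt_trans yu ux; rewrite y0 yx mulr1 ncM ler_wpM2l ?nc_ge0 // ncM.
  by apply: ler_pM; [exact: nc_ge0|exact: nc_ge0|exact: hb|exact: expm_le_oo].
have cP := Cable_CI mP (Cable_nc cQ) ih dP.
have fub := CI_fubini mP (Cable_nc cQ) ih dP.
have cPJ : Cable (fun y => oo 0 x y * (E y * PJ Q b (x - y) y)).
  have mF : Cmeas (fun y : R => PJ Q b (x - y) y).
    apply: (Cmeas_comp (g := fun y : R => (x - y, y)) (PJ_meas cQ mb)).
    apply: measurable_fun_pair; last exact: measurable_id.
    by apply: measurable_funB; [exact: measurable_cst|exact: measurable_id].
  apply: (Cable_bd (B := EB * (B * RI (fun x => nc (Q x))))).
    by apply: CmeasM; [exact: Cmeas_expm|exact: mF].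
  move=> y y0 yx; rewrite ncM; apply: ler_pM; [exact: nc_ge0|exact: nc_ge0|exact: expm_le_oo|].
  exact: (PJ_le cQ mb hb).
have c1 := Cable_ooM 0 x cQ.
have c2 := oo_expm_Cable x0 cQ.
transitivity (CI (fun u => oo 0 x u * Q u) - CI (fun u => oo 0 x u * (E u * Q u)) +
    CI (fun u => CI (fun y => P (u, y)))).
  rewrite -(CIB c1 c2) -(CID (CableB c1 c2) cP).
  apply: eq_CI => u.
  have -> : CI (fun y => P (u, y)) = oo 0 x u * Q u * Iv (fun y => b (u, y) * E y) 0 u.
    rewrite /Iv -CIZ; first by apply: eq_CI => y; rewrite /P /= !mulrA.
    apply: (Cable_bd (B := B * expR (nc nu * u))).
      by apply: CmeasM; [exact: Cmeas_pair2|exact: Cmeas_expm].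
    by move=> y y0 yu; rewrite ncM; apply: ler_pM; [exact: nc_ge0|exact: nc_ge0|exact: hb|exact: expm_le_oo].
  rewrite /Wker; have alg (o q e i : C) : o * (q * (1 - e + i)) = o * q - o * (e * q) + o * q * i by ring.
  exact: alg.
rewrite [X in X - _ + _]Iv_Gam -addrA; congr (_ + _).
rewrite addrC fub.
have -> : CI (fun y => CI (fun u => P (u, y))) = CI (fun y => oo 0 x y * (E y * PJ Q b (x - y) y)).
  apply: eq_CI => y; rewrite mulrA /PJ subrK -(CIZ _ (PJ_Cable cQ mb hb y x y)).
  apply: eq_CI => u; rewrite /P /=.
  have alg (o p c d e : C) : o * (c * (p * (d * e))) = o * p * e * (c * d) by ring.
  have alg2 (o p c d e : C) : o * e * (p * (c * d)) = o * p * e * (c * d) by ring.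
  by rewrite alg alg2 oo_swap.
rewrite -(CIB cPJ c2); apply: eq_CI => y.
by rewrite mulrBr mulrBr.
Qed.

(** The equation that nu e^{-nu x/2} S(x, lam) satisfies as well, see [Y_eq]; the kernel
    equation for b is what makes the coefficients of E s agree. *)
Lemma Wker_eq (x : R) : 0 <= x <= pi -> Wker x = 1 - E x +
  Iv (fun u => E u * Iv (fun t => Q t * Wker t) 0 (x - u)) 0 x.
Proof.
move=> /andP[x0 xp]; congr (_ + _).
pose N := RI (fun x => nc (Q x)).
pose F (p : R * R) : C := PJ Q b p.1 p.2 - Q p.2.
have mF : Cmeas F.
  apply: CmeasB; first exact: (PJ_meas cQ mb).
  by apply: (Cmeas_comp mQ); exact: measurable_snd.
pose h y := ((0 < y) && (y < x))%:R * (B * N) + nc (Q y).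
have ih : Rable h.
  apply: RableD; last exact: Cable_nc.
  by apply: Rable_eq (RableZ (B * N) (Rable_oo 0 x)) => y; rewrite mulrC.
have N0 : 0 <= N by apply: RI_ge0 => y; exact: nc_ge0.
have h0 y : 0 <= h y by rewrite addr_ge0 ?nc_ge0 // !mulr_ge0.
have hF w y : 0 < y -> y < x -> nc (F (w, y)) <= h y.
  move=> y0 yx; rewrite /h y0 yx mul1r; apply: le_trans (ncB _ _) _.
  by rewrite lerD2r; exact: (PJ_le cQ mb hb).
have sh := shear nu x0 mF ih h0 hF.
pose g u := CI (fun y => oo 0 (x - u) y * (E y * F (x - u - y, y))).
have gE u : u < x -> Iv (fun t => Q t * Wker t) 0 (x - u) = Gam Q (x - u) + g u.
  move=> ux; have xu : 0 <= x - u by rewrite subr_ge0 ltW.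
  by rewrite (Iv_QWker xu); congr (_ + _); apply: eq_CI.
have m1 : measurable_fun setT (fun p : R * R => p.1) by exact: measurable_fst.
have m2 : measurable_fun setT (fun p : R * R => p.2) by exact: measurable_snd.
have mx1 : measurable_fun setT (fun p : R * R => x - p.1).
  by apply: measurable_funB; [exact: measurable_cst|exact: m1].
have mg : Cmeas g.
  suff mG : Cmeas (fun p : R * R => oo 0 (x - p.1) p.2 * (E p.2 * F (x - p.1 - p.2, p.2))).
    exact: (Cmeas_CI mG).
  apply: CmeasM; first by apply: Cmeas_oo3; [exact: measurable_cst|exact: mx1|exact: m2].
  apply: CmeasM; first exact: (Cmeas_comp (Cmeas_expm nu)).
  apply: (Cmeas_comp (g := fun p : R * R => (x - p.1 - p.2, p.2)) mF).
  by apply: measurable_fun_pair; [apply: measurable_funB; [exact: mx1|exact: m2]|exact: m2].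
have mGx : Cmeas (fun u : R => Gam Q (x - u)).
  apply: (Cmeas_comp (Gam_meas cQ)).
  by apply: measurable_funB; [exact: measurable_cst|exact: measurable_id].
pose EB := expR (nc nu * x); have EB0 : 0 <= EB := expR_ge0 _.
have gle u : 0 < u -> nc (g u) <= EB * RI h.
  move=> u0; rewrite -(RIZ EB ih); apply: CI_le_dom.
  - apply: CmeasM; first exact: Cmeas_oo.
    apply: CmeasM; first exact: Cmeas_expm.
    apply: (Cmeas_comp (g := fun y : R => (x - u - y, y)) mF).
    apply: measurable_fun_pair; last exact: measurable_id.
    by apply: measurable_funB; [exact: measurable_cst|exact: measurable_id].
  - exact: RableZ.
  - move=> y; have [hy|hy] := boolP ((0 < y) && (y < x - u)); last first.
      by rewrite /oo (negPf hy) mul0r nc0 mulr_ge0.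
    rewrite /oo hy mul1r ncM; move/andP: hy => [y0 yx]; have yx' : y < x by lra.
    by apply: ler_pM; [exact: nc_ge0|exact: nc_ge0|exact: expm_le_oo|exact: hF].
have c1 : Cable (fun u => oo 0 x u * (E u * Gam Q (x - u))).
  apply: (Cable_bd (B := EB * N)).
    by apply: CmeasM; [exact: Cmeas_expm|exact: mGx].
  move=> u u0 ux; rewrite ncM; apply: ler_pM; [exact: nc_ge0|exact: nc_ge0|exact: expm_le_oo|].
  exact: (Gam_le _ cQ).
have c2 : Cable (fun u => oo 0 x u * (E u * g u)).
  apply: (Cable_bd (B := EB * (EB * RI h))).
    by apply: CmeasM; [exact: Cmeas_expm|exact: mg].
  move=> u u0 ux; rewrite ncM; apply: ler_pM; [exact: nc_ge0|exact: nc_ge0|exact: expm_le_oo|].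
  exact: gle.
transitivity (Iv (fun u => E u * Gam Q (x - u)) 0 x + Iv (fun u => E u * g u) 0 x); last first.
  rewrite /Iv -(CID c1 c2); apply: eq_CI => u; rewrite -mulrDr -mulrDr.
  have [ux|ux] := ltP u x; first by congr (_ * (_ * _)); exact: (esym (gE u ux)).
  have oz : oo 0 x u = 0 :> C by rewrite /oo (le_gtF ux) andbF.
  by rewrite oz [LHS]mul0r [RHS]mul0r.
transitivity (Iv (fun u => E u * Gam Q (x - u)) 0 x +
    Iv (fun s => E s * CI (fun y => oo 0 s y * F (x - s, y))) 0 x); last first.
  have sh2 : Iv (fun u => E u * g u) 0 x = Iv (fun s => E s * CI (fun y => oo 0 s y * F (x - s, y))) 0 x.
    exact: sh.
  exact: (congr1 (fun z => Iv (fun u => E u * Gam Q (x - u)) 0 x + z) (esym sh2)).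
have inner s : CI (fun y => oo 0 s y * F (x - s, y)) = J Q b x s - Gam Q s.
  rewrite -Iv_Gam -(CIB (J_Cable cQ mb hb (x - s) s) (Cable_ooM 0 s cQ)).
  by apply: eq_CI => y; rewrite mulrBr.
have c3 : Cable (fun s => oo 0 x s * (E s * CI (fun y => oo 0 s y * F (x - s, y)))).
  apply: (Cable_bd (B := EB * (B * N * x + N))).
    apply: CmeasM; first exact: Cmeas_expm.
    apply: Cmeas_eq (fun s => esym (inner s)) _.
    by apply: CmeasB; [exact: (Cmeas_pair2 x (J_meas cQ mb))|exact: Gam_meas].
  move=> s s0 sx; rewrite ncM; apply: ler_pM; [exact: nc_ge0|exact: nc_ge0|exact: expm_le_oo|].
  rewrite inner; apply: le_trans (ncB _ _) _; apply: lerD; last exact: (Gam_le _ cQ).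
  apply: le_trans (Iv_le (ltW s0) (Cmeas_pair2 (x - s) (PJ_meas cQ mb)) (fun y _ _ => PJ_le cQ mb hb _ y)) _.
  rewrite subr0; exact: (ler_wpM2l (mulr_ge0 B0 N0) (ltW sx)).
rewrite /Iv -(CID c1 c3); apply: eq_CI => s; rewrite -mulrDr -mulrDr inner.
have [/andP[s0 sx]|hs] := boolP ((0 < s) && (s < x)); last first.
  have oz : oo 0 x s = 0 :> C by rewrite /oo (negPf hs).
  by rewrite oz [LHS]mul0r [RHS]mul0r.
have tri_xs : tri (x, s) by apply/and3P; split => /=; [exact: ltW|exact: ltW|exact: xp].
rewrite (eb tri_xs); congr (_ * _).
have alg (e p q r : C) : (p - q + r) * e = e * (p + (r - q)) by ring.
exact: alg.
Qed.

End Transmutation.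

(** * Solutions of the differential equation *)

Section Solutions.
Variable R : realType.
Local Notation C := R[i].
Local Notation nc := (@Normc.normc R).
Local Notation mu := (@lebesgue_measure R).

(** The initial value problem in integrated form, for representatives of the solution
    and its derivative that are measurable and bounded on the whole line. *)
Definition solves (Q : R -> C) (lam : C) (s s1 : R -> C) :=
  [/\ Cmeas s, Cmeas s1, exists M, forall x, nc (s x) <= M /\ nc (s1 x) <= M &
    forall x, 0 <= x <= pi -> s x = Iv s1 0 x /\ s1 x = 1 + Iv (fun t => (Q t - lam) * s t) 0 x].

Lemma Iv_meas (f : R -> C) : Cmeas f -> Cmeas (fun x => Iv f 0 x).
Proof.
move=> mf.
have m1 : measurable_fun setT (fun p : R * R => p.1) by exact: measurable_fst.
have m2 : measurable_fun setT (fun p : R * R => p.2) by exact: measurable_snd.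
suff mF : Cmeas (fun p : R * R => oo 0 p.1 p.2 * f p.2) by exact: (Cmeas_CI mF).
apply: CmeasM; first by apply: Cmeas_oo3; [exact: measurable_cst|exact: m1|exact: m2].
exact: (Cmeas_comp mf).
Qed.

(** The functions of the problem are arbitrary outside [0, pi], so the representatives
    are rebuilt from the second derivative. *)
Lemma SL_solves (q : R -> C) (lam : C) (y y1 : R -> C) : L2 q ->
  SL_solution q lam y y1 -> y 0 = 0 -> y1 0 = 1 ->
  exists s s1, [/\ solves (fun x => oo 0 pi x * q x) lam s s1, s pi = y pi & s1 pi = y1 pi].
Proof.
move=> Lq [y2 [Ly2 ey ey1 eq2]] y0 y10.
have p2 := L2_potential Ly2; have [mQ _ _] := L2_potential Lq.
pose z2 x := oo 0 pi x * y2 x; have c2 : Cable z2 := potential_Cable p2.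
pose s1 x := 1 + Iv z2 0 x; pose s x := Iv (fun t => oo 0 pi t * s1 t) 0 x.
pose N := RI (fun x => nc (z2 x)).
have N0 : 0 <= N by apply: RI_ge0 => x; exact: nc_ge0.
have ms1 : Cmeas s1.
  by apply: CmeasD; [exact: Cmeas_cst|apply: Iv_meas; exact: Cable_meas].
have bs1 x : nc (s1 x) <= 1 + N.
  apply: le_trans (ncD _ _) _; rewrite nc1 lerD2l; apply: CI_le_dom.
  - by apply: CmeasM; [exact: Cmeas_oo|exact: Cable_meas].
  - exact: Cable_nc.
  - by move=> t; rewrite ncM -[leRHS]mul1r ler_wpM2r ?nc_ge0 // nc_oo_le1.
have ms1' : Cmeas (fun t => oo 0 pi t * s1 t) by apply: CmeasM; [exact: Cmeas_oo|exact: ms1].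
have ms : Cmeas s by exact: Iv_meas.
have bs x : nc (s x) <= (1 + N) * pi.
  have -> : (1 + N) * pi = RI (fun t => (1 + N) * ((0 < t) && (t < pi))%:R).
    by rewrite RIZ ?RI_oo ?subr0 ?pi_ge0 //; exact: Rable_oo.
  apply: CI_le_dom.
  - by apply: CmeasM; [exact: Cmeas_oo|exact: ms1'].
  - by apply: RableZ; exact: Rable_oo.
  - move=> t; rewrite !ncM !nc_oo.
    case: ((0 < t) && (t < x)); case: ((0 < t) && (t < pi)); rewrite ?mul1r ?mul0r ?mulr1 ?mulr0 ?bs1 //.
    by rewrite addr_ge0.
have e1 x : 0 <= x <= pi -> s1 x = y1 x.
  move=> hx; have /andP[x0 xp] := hx.
  rewrite ey1; last by rewrite in_itv.
  rewrite y10 -Iv_Cintegral; congr (_ + _); apply: eq_Iv => t t0 tx.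
  by rewrite /z2 /oo t0 (lt_le_trans tx xp) mul1r.
have e0 x : 0 <= x <= pi -> s x = y x /\ s x = Iv s1 0 x.
  move=> hx; have /andP[x0 xp] := hx.
  have sE : s x = Iv s1 0 x.
    apply: eq_Iv => t t0 tx; by rewrite /oo t0 (lt_le_trans tx xp) mul1r.
  split; last by [].
  rewrite sE ey; last by rewrite in_itv.
  rewrite y0 add0r -Iv_Cintegral; apply: eq_Iv => t t0 tx.
  by apply: e1; rewrite ltW // ltW // (lt_le_trans tx xp).
exists s, s1; split; last 2 first.
- by rewrite (e0 pi _).1 // lexx pi_ge0.
- by rewrite (e1 pi) // lexx pi_ge0.
split.
- exact: ms.
- exact: ms1.
- exists (Num.max ((1 + N) * pi) (1 + N)) => x; split.
    by apply: le_trans (bs x) _; rewrite le_max lexx.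
  by apply: le_trans (bs1 x) _; rewrite le_max lexx orbT.
move=> x hx; have /andP[x0 xp] := hx; split; first exact: (e0 x hx).2.
congr (_ + _); apply: CI_ae.
- by apply: CmeasM; [exact: Cmeas_oo|exact: Cable_meas].
- apply: CmeasM; first exact: Cmeas_oo.
  by apply: CmeasM; [apply: CmeasB; [exact: mQ|exact: Cmeas_cst]|exact: ms].
apply: (@filterS _ _ (ae_filter_ringOfSetsType mu) _ _ _ eq2) => t ht.
have [/andP[t0 tx]|hs] := boolP ((0 < t) && (t < x)); last by rewrite /oo (negPf hs) !mul0r.
have tp := lt_le_trans tx xp.
have := ht; rewrite in_itv /= t0 tp => /(_ erefl) ht'.
congr (_ * _); rewrite /z2 /oo t0 tp !mul1r (e0 t _).1; last by rewrite !ltW.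
by rewrite mulrBl -ht' opprD opprK addrCA subrr addr0.
Qed.

(** Thus the point 0, where [solves_char] gives no information, can be moved, see
    [ent_S]. *)
Lemma solves_shift Q lam s s1 c : solves Q lam s s1 ->
  solves (fun x => Q x - oo 0 pi x * c) (lam - c) s s1.
Proof.
move=> [ms ms1 hM h]; split; [exact: ms|exact: ms1|exact: hM|].
move=> x hx; have [e1 e2] := h x hx; split; first exact: e1.
rewrite e2; congr (_ + _); apply: eq_Iv => t t0 tx.
have /andP[_ xp] := hx; rewrite /oo t0 (lt_le_trans tx xp) mul1r.
by congr (_ * _); rewrite opprB addrA addrNK.
Qed.

Lemma expmM (a c : C) t : expm a t * expm c t = expm (a + c) t.
Proof. by rewrite /expm -cexpD -mulrDl opprD. Qed.

Lemma Iv_expm (a : C) (x : R) : 0 <= x -> Iv (fun t => - a * expm a t) 0 x = expm a x - 1.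
Proof.
move=> x0; rewrite -[X in _ - X](expm0 a); apply: FTC => // t.
  by rewrite mulrC; exact: Rd_expm.
by apply: RcontM; [exact: Rcont_cst|exact: Rcont_expm].
Qed.

Section Solves.
Variables (Q : R -> C) (lam a : C) (s s1 : R -> C).
Hypotheses (pQ : potential Q) (hs : solves Q lam s s1) (ha : a ^+ 2 = - lam).
Let cQ : Cable Q. Proof. exact: potential_Cable. Qed.
Let nu := a + a.
Let Y x := expm a x * s x.
Let V x := expm a x * (s1 x + a * s x).

Let oo_Cable (f : R -> C) (x : R) : Cmeas f -> (exists M, forall t, 0 < t -> t < x -> nc (f t) <= M) ->
  Cable (fun t => oo 0 x t * f t).
Proof. by move=> mf [M hM]; exact: (Cable_bd mf hM). Qed.

Let expm_Cable (c : C) (x : R) : Cable (fun t => oo 0 x t * (- c * expm c t)).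
Proof.
apply: oo_Cable; first by apply: CmeasM; [exact: Cmeas_cst|exact: Cmeas_expm].
exists (nc c * expR (nc c * x)) => t t0 tx; rewrite ncM ncN ler_wpM2l ?nc_ge0 //.
exact: expm_le_oo.
Qed.

Let ms : Cmeas s. Proof. by case: hs. Qed.
Let ms1 : Cmeas s1. Proof. by case: hs. Qed.

Let s_Cable x : Cable (fun t => oo 0 x t * s t).
Proof. by apply: oo_Cable; [exact: ms|case: hs => _ _ [M hM] _; exists M => t _ _; case: (hM t)]. Qed.
Let s1_Cable x : Cable (fun t => oo 0 x t * s1 t).
Proof. by apply: oo_Cable; [exact: ms1|case: hs => _ _ [M hM] _; exists M => t _ _; case: (hM t)]. Qed.

Let QM_Cable (f : R -> C) x : Cmeas f -> (exists M, forall t, 0 < t -> t < x -> nc (f t) <= M) ->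
  Cable (fun t => oo 0 x t * (Q t * f t)).
Proof.
move=> mf [M hM].
apply: (Cable_dom _ (RableZ `|M| (Cable_nc cQ))).
  apply: CmeasM; first exact: Cmeas_oo.
  by apply: CmeasM; [exact: Cable_meas|exact: mf].
move=> t; have [/andP[t0 tx]|ht] := boolP ((0 < t) && (t < x)); last first.
  by rewrite /oo (negPf ht) mul0r nc0 mulr_ge0 // nc_ge0.
rewrite /oo t0 tx mul1r ncM mulrC ler_wpM2r ?nc_ge0 //.
exact: le_trans (hM t t0 tx) (ler_norm _).
Qed.

Let g_Cable x : Cable (fun t => oo 0 x t * ((Q t - lam) * s t)).
Proof.
have [_ _ [M hM] _] := hs.
have c1 : Cable (fun t => oo 0 x t * (Q t * s t)).
  by apply: QM_Cable => //; exists M => t _ _; case: (hM t).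
apply: Cable_eq (CableB c1 (CableZ lam (s_Cable x))) => t.
have alg (o q l z : C) : o * (q * z) - l * (o * z) = o * ((q - l) * z) by ring.
exact: alg.
Qed.

(** The product rule; the terms without Q cancel because a^2 = - lam. *)
Lemma V_eq x : 0 <= x <= pi -> V x = 1 + Iv (fun t => Q t * Y t) 0 x.
Proof.
move=> hx; have /andP[x0 xp] := hx; have [_ _ _ he] := hs.
pose f t := - a * expm a t; pose g t := (Q t - lam) * s t + a * s1 t.
have gE t : oo 0 x t * g t = oo 0 x t * ((Q t - lam) * s t) + a * (oo 0 x t * s1 t).
  by rewrite /g mulrDr; congr (_ + _); rewrite mulrCA.
have cg y : Cable (fun t => oo 0 y t * g t).
  apply: Cable_eq (CableD (g_Cable y) (CableZ a (s1_Cable y))) => t.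
  by rewrite /g mulrDr; congr (_ + _); rewrite mulrCA.
have fE t : 0 <= t -> 1 + Iv f 0 t = expm a t.
  by move=> t0; rewrite Iv_expm // addrC subrK.
have gI t : 0 <= t <= pi -> 1 + Iv g 0 t = s1 t + a * s t.
  move=> ht; have [-> ->] := he t ht.
  rewrite -addrA; congr (_ + _).
  rewrite /Iv -(CIZ a (s1_Cable t)) -(CID (g_Cable t) (CableZ a (s1_Cable t))).
  by apply: eq_CI => u; rewrite /g mulrDr; congr (_ + _); rewrite mulrCA.
have := Iv_prod 1 1 (expm_Cable a x) (cg x).
rewrite (gI x hx) -/f (fE x x0) mulr1 -/(V x) => ->; congr (_ + _).
apply: eq_Iv => t t0 tx; rewrite (fE t (ltW t0)) (gI t _); last by rewrite (ltW t0) (ltW (lt_le_trans tx xp)).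
rewrite /f /g /Y.
have alg (q e l z z1 : C) : a ^+ 2 = - l ->
   - a * e * (z1 + a * z) + e * ((q - l) * z + a * z1) = q * (e * z).
  move=> h; have -> : l = - a ^+ 2 by rewrite h opprK.
  by ring.
exact: alg.
Qed.

(** The function e^{a x} s is a primitive of e^{2 a x} V, and V is known from [V_eq]. *)
Lemma Y_eq x : 0 <= x <= pi -> nu * Y x = 1 - expm nu x +
  Iv (fun u => expm nu u * Iv (fun t => Q t * (nu * Y t)) 0 (x - u)) 0 x.
Proof.
move=> hx; have /andP[x0 xp] := hx; have [_ _ [M hM] he] := hs.
have mY : Cmeas Y by apply: CmeasM; [exact: Cmeas_expm|exact: ms].
have bY t : 0 <= t -> t <= x -> nc (Y t) <= expR (nc a * x) * M.
  move=> t0 tx; rewrite ncM; apply: ler_pM; [exact: nc_ge0|exact: nc_ge0| |by case: (hM t)].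
  by apply: expm_le; rewrite ger0_norm.
have QY_Cable y : y <= x -> Cable (fun t => oo 0 y t * (Q t * Y t)).
  move=> yx; apply: QM_Cable; first exact: mY.
  by exists (expR (nc a * x) * M) => t t0 tx; apply: bY; [exact: ltW|exact: ltW (lt_le_trans tx yx)].
have mV : Cmeas V.
  apply: CmeasM; first exact: Cmeas_expm.
  by apply: CmeasD; [exact: ms1|apply: CmeasM; [exact: Cmeas_cst|exact: ms]].
have h1 : expm (- a) x * s x = Iv (fun t => expm (- nu) t * V t) 0 x.
  have cf : Cable (fun t => oo 0 x t * (a * expm (- a) t)).
    by apply: Cable_eq (expm_Cable (- a) x) => t; rewrite opprK.
  have fE t : 0 <= t -> 1 + Iv (fun t => a * expm (- a) t) 0 t = expm (- a) t.
    by move=> t0; have := Iv_expm (- a) t0; rewrite opprK => ->; rewrite addrC subrK.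
  have := Iv_prod 1 0 cf (s1_Cable x); rewrite (fE x x0) mulr0 !add0r -(he x hx).1 => ->.
  apply: eq_Iv => t t0 tx; rewrite fE ?ltW // add0r -(he t _).1; last first.
    by rewrite !ltW // (lt_le_trans tx xp).
  have -> : expm (- nu) t * V t = expm (- a) t * (s1 t + a * s t).
    by rewrite /V mulrA expmM /nu opprD addrNK.
  have alg (e z z1 : C) : a * e * z + e * z1 = e * (z1 + a * z) by ring.
  exact: alg.
have h2 : Y x = Iv (fun u => expm nu u * V (x - u)) 0 x.
  have cV : Cable (fun t => oo 0 x t * (expm (- nu) t * V t)).
    apply: oo_Cable; first by apply: CmeasM; [exact: Cmeas_expm|exact: mV].
    exists (expR (nc (- nu) * x) * (expR (nc a * x) * (M + nc a * M))) => t t0 tx.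
    rewrite ncM; apply: ler_pM; [exact: nc_ge0|exact: nc_ge0|exact: expm_le_oo|].
    rewrite ncM; apply: ler_pM; [exact: nc_ge0|exact: nc_ge0|exact: expm_le_oo|].
    apply: le_trans (ncD _ _) _; rewrite ncM; have [b1 b2] := hM t.
    by apply: lerD; [exact: b2|apply: ler_wpM2l; [exact: nc_ge0|exact: b1]].
  have -> : Y x = expm nu x * (expm (- a) x * s x) by rewrite mulrA expmM /nu addrK.
  rewrite h1 /Iv -(CIZ _ cV) -(CI_reflect x (CableZ (expm nu x) cV)).
  apply: eq_CI => u.
  have -> : oo 0 x (x - u) = oo 0 x u :> C.
    by rewrite /oo subr_gt0 ltrBlDr ltrDl andbC.
  have -> : expm nu x = expm nu (x - u) * expm nu u by rewrite -expmD subrK.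
  have e1 : expm nu (x - u) * expm (- nu) (x - u) = 1.
    by rewrite expmM subrr /expm oppr0 mul0r cexp0.
  have alg (o p r m v : C) : p * m = 1 -> p * r * (o * (m * v)) = o * (r * v).
    move=> e; have -> : p * r * (o * (m * v)) = (p * m) * (o * (r * v)) by ring.
    by rewrite e mul1r.
  exact: alg.
have cE : Cable (fun u => oo 0 x u * (nu * expm nu u)).
  by apply: Cable_eq (CableN (expm_Cable nu x)) => u; rewrite mulNr mulrN opprK.
have cI : Cable (fun u => oo 0 x u * (expm nu u * Iv (fun t => Q t * (nu * Y t)) 0 (x - u))).
  have mQY : Cmeas (fun t => Q t * (nu * Y t)).
    by apply: CmeasM; [exact: Cable_meas|apply: CmeasM; [exact: Cmeas_cst|exact: mY]].
  apply: oo_Cable.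
    apply: CmeasM; first exact: Cmeas_expm.
    apply: (Cmeas_comp (Iv_meas mQY)).
    by apply: measurable_funB; [exact: measurable_cst|exact: measurable_id].
  exists (expR (nc nu * x) * ((nc nu * (expR (nc a * x) * M)) * RI (fun x => nc (Q x)))) => u u0 ux.
  rewrite ncM; apply: ler_pM; [exact: nc_ge0|exact: nc_ge0|exact: expm_le_oo|].
  rewrite -RIZ; last exact: Cable_nc.
  apply: CI_le_dom; [by apply: CmeasM; [exact: Cmeas_oo|exact: mQY]|by apply: RableZ; exact: Cable_nc|].
  have B0 : 0 <= nc nu * (expR (nc a * x) * M).
    by apply: mulr_ge0; [exact: nc_ge0|exact: le_trans (nc_ge0 _) (bY 0 (lexx _) x0)].
  move=> t; have [/andP[t0 tx]|ht] := boolP ((0 < t) && (t < x - u)); last first.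
    by rewrite /oo (negPf ht) mul0r nc0; apply: mulr_ge0; [exact: B0|exact: nc_ge0].
  rewrite /oo t0 tx mul1r ncM mulrC; apply: ler_wpM2r; first exact: nc_ge0.
  rewrite ncM; apply: ler_wpM2l; first exact: nc_ge0.
  by apply: bY; lra.
have -> : 1 - expm nu x = Iv (fun u => nu * expm nu u) 0 x.
  have := Iv_expm nu x0; move/(congr1 (fun z => - z)); rewrite opprB => <-.
  rewrite /Iv -(CIN (expm_Cable nu x)); apply: eq_CI => u.
  by rewrite mulNr mulrN opprK.
rewrite h2 /Iv -(CID cE cI).
have cEV : Cable (fun u => oo 0 x u * (expm nu u * V (x - u))).
  apply: oo_Cable.
    apply: CmeasM; first exact: Cmeas_expm.
    apply: (Cmeas_comp mV).
    by apply: measurable_funB; [exact: measurable_cst|exact: measurable_id].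
  exists (expR (nc nu * x) * (expR (nc a * x) * (M + nc a * M))) => u u0 ux.
  rewrite ncM; apply: ler_pM; [exact: nc_ge0|exact: nc_ge0|exact: expm_le_oo|].
  rewrite ncM; apply: ler_pM; [exact: nc_ge0|exact: nc_ge0| |].
    by apply: expm_le; rewrite ger0_norm; lra.
  apply: le_trans (ncD _ _) _; rewrite ncM; have [b1 b2] := hM (x - u).
  by apply: lerD; [exact: b2|apply: ler_wpM2l; [exact: nc_ge0|exact: b1]].
rewrite -(CIZ nu cEV); apply: eq_CI => u.
have [/andP[u0 ux]|hu] := boolP ((0 < u) && (u < x)); last first.
  have oz : oo 0 x u = 0 :> C by rewrite /oo (negPf hu).
  by rewrite oz !mul0r mulr0 addr0.
have xu : x - u <= x by lra.
have xup : 0 <= x - u <= pi by apply/andP; split; lra.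
have -> : Iv (fun t => Q t * (nu * Y t)) 0 (x - u) = nu * Iv (fun t => Q t * Y t) 0 (x - u).
  rewrite /Iv -(CIZ nu (QY_Cable (x - u) xu)); apply: eq_CI => t.
  have alg (o q n y : C) : o * (q * (n * y)) = n * (o * (q * y)) by ring.
  exact: alg.
rewrite (V_eq xup).
have alg (o n e i : C) : n * (o * (e * (1 + i))) = o * (n * e) + o * (e * (n * i)) by ring.
exact: alg.
Qed.

End Solves.
End Solutions.

(** * Representation of the solutions at the right end point *)

Section Characteristic.
Variable R : realType.
Local Notation C := R[i].
Local Notation nc := (@Normc.normc R).

(** By [Wker_eq] and [Y_eq] the difference of the two sides satisfies a homogeneous
    Volterra equation. *)
Lemma solution_kernel (Q : R -> C) (b : R * R -> C) (B : R) (lam a : C) (s s1 : R -> C) :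
  potential Q -> Cmeas b -> (forall p, nc (b p) <= B) ->
  (forall x s, tri (x, s) -> b (x, s) = Gam Q (x - s) - Gam Q s + J Q b x s) ->
  solves Q lam s s1 -> a ^+ 2 = - lam ->
  forall x, 0 <= x <= pi -> Wker b (a + a) x = (a + a) * (expm a x * s x).
Proof.
move=> pQ mb hb eb hs ha; have [mQ iQ sQ] := pQ; have cQ := potential_Cable pQ.
have [ms ms1 [M hM] he] := hs.
set nu := a + a.
pose D x := Wker b nu x - nu * (expm a x * s x).
have mY : Cmeas (fun x => nu * (expm a x * s x)).
  by apply: CmeasM; [exact: Cmeas_cst|apply: CmeasM; [exact: Cmeas_expm|exact: ms]].
have mW := Wker_meas mb nu.
have mD : Cmeas D by apply: CmeasB; [exact: mW|exact: mY].
have [MW hW] := Wker_le mb hb nu.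
pose MY := nc nu * (expR (nc a * pi) * M).
have hY x : 0 <= x <= pi -> nc (nu * (expm a x * s x)) <= MY.
  move=> /andP[x0 xp]; rewrite ncM; apply: ler_wpM2l; first exact: nc_ge0.
  rewrite ncM; apply: ler_pM; [exact: nc_ge0|exact: nc_ge0| |by case: (hM x)].
  by apply: expm_le; rewrite ger0_norm.
have hD x : 0 <= x <= pi -> nc (D x) <= MW + MY.
  by move=> hx; apply: le_trans (ncB _ _) _; apply: lerD; [exact: hW|exact: hY].
pose EB := expR (nc nu * pi); have EB0 : 0 < EB := expR_gt0 _.
have k0 : 0 < EB * pi by rewrite mulr_gt0 // pi_gt0.
have QM_Cable (f : R -> C) (N : R) x : Cmeas f -> (forall t, 0 <= t <= pi -> nc (f t) <= N) ->
    x <= pi -> Cable (fun t => oo 0 x t * (Q t * f t)).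
  move=> mf hN xp; apply: (Cable_dom _ (RableZ `|N| (Cable_nc cQ))).
    apply: CmeasM; first exact: Cmeas_oo.
    by apply: CmeasM; [exact: mQ|exact: mf].
  move=> t; have [/andP[t0 tx]|ht] := boolP ((0 < t) && (t < x)); last first.
    by rewrite /oo (negPf ht) mul0r nc0 mulr_ge0 // nc_ge0.
  rewrite /oo t0 tx mul1r ncM mulrC ler_wpM2r ?nc_ge0 //.
  apply: le_trans (hN t _) (ler_norm _).
  by rewrite (ltW t0) (ltW (lt_le_trans tx xp)).
have Ieq x : 0 <= x <= pi -> Iv (fun t => Q t * D t) 0 x =
    Iv (fun t => Q t * Wker b nu t) 0 x - Iv (fun t => Q t * (nu * (expm a t * s t))) 0 x.
  move=> /andP[x0 xp].
  rewrite /Iv -(CIB (QM_Cable _ _ x mW hW xp) (QM_Cable _ _ x mY hY xp)).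
  by apply: eq_CI => t; rewrite /D -!mulrBr.
have Ibd (f : R -> C) (N : R) x : Cmeas f -> (forall t, 0 <= t <= pi -> nc (f t) <= N) ->
    0 <= x <= pi -> nc (Iv (fun t => Q t * f t) 0 x) <= `|N| * RI (fun t => nc (Q t)).
  move=> mf hN /andP[x0 xp]; rewrite -RIZ; last exact: Cable_nc.
  apply: CI_le_dom; [exact: Cable_meas (QM_Cable _ _ x mf hN xp)|by apply: RableZ; exact: Cable_nc|].
  move=> t; have [/andP[t0 tx]|ht] := boolP ((0 < t) && (t < x)); last first.
    by rewrite /oo (negPf ht) mul0r nc0 mulr_ge0 // nc_ge0.
  rewrite /oo t0 tx mul1r ncM mulrC ler_wpM2r ?nc_ge0 //.
  apply: le_trans (hN t _) (ler_norm _).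
  by rewrite (ltW t0) (ltW (lt_le_trans tx xp)).
have EI_Cable (f : R -> C) (N : R) x : Cmeas f -> (forall t, 0 <= t <= pi -> nc (f t) <= N) ->
    0 <= x <= pi -> Cable (fun u => oo 0 x u * (expm nu u * Iv (fun t => Q t * f t) 0 (x - u))).
  move=> mf hN /andP[x0 xp].
  apply: (Cable_bd (B := EB * (`|N| * RI (fun t => nc (Q t))))).
    apply: CmeasM; first exact: Cmeas_expm.
    apply: (Cmeas_comp (Iv_meas (CmeasM mQ mf))).
    by apply: measurable_funB; [exact: measurable_cst|exact: measurable_id].
  move=> u u0 ux; rewrite ncM; apply: ler_pM; [exact: nc_ge0|exact: nc_ge0| |].
    by apply: expm_le; rewrite ger0_norm; lra.
  by apply: Ibd => //; apply/andP; split; lra.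
have Deq x : 0 <= x <= pi -> D x = Iv (fun u => expm nu u * Iv (fun t => Q t * D t) 0 (x - u)) 0 x.
  move=> hx; have /andP[x0 xp] := hx.
  rewrite /D (Wker_eq pQ mb hb eb nu hx) (Y_eq pQ hs ha hx) -/nu.
  rewrite opprD addrACA subrr add0r.
  rewrite /Iv -(CIB (EI_Cable _ _ x mW hW hx) (EI_Cable _ _ x mY hY hx)).
  apply: eq_CI => u; rewrite -mulrBr -mulrBr.
  have [/andP[u0 ux]|hu] := boolP ((0 < u) && (u < x)); last first.
    have oz : oo 0 x u = 0 :> C by rewrite /oo (negPf hu).
    by rewrite oz [LHS]mul0r [RHS]mul0r.
  have hxu : 0 <= x - u <= pi by apply/andP; split; lra.
  by congr (_ * (_ * _)); exact: (esym (Ieq (x - u) hxu)).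
suff H : forall x, 0 <= x <= pi -> D x = 0.
  by move=> x hx; apply/eqP; rewrite -subr_eq0 -/(D x) (H x hx).
have sg x : ~~ ((0 < x) && (x < pi)) -> nc (Q x) = 0 by move=> hx; rewrite sQ // nc0.
apply: (volterra_zero (measurable_nc mQ) (fun x => nc_ge0 (Q x)) sg iQ k0 hD).
move=> m N N0 hR hN x hx; have /andP[x0 xp] := hx.
rewrite (Deq x hx).
set r := RI _.
have r0 : 0 <= r.
  by apply: RI_ge0 => t; rewrite mulr_ge0 // mulr_ge0 ?nc_ge0 // expR_ge0.
apply: (le_trans (Iv_le (B := EB * (N * r)) x0 _ _)).
- apply: CmeasM; first exact: Cmeas_expm.
  apply: (Cmeas_comp (Iv_meas (CmeasM mQ mD))).
  by apply: measurable_funB; [exact: measurable_cst|exact: measurable_id].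
- move=> u u0 ux; rewrite ncM; apply: ler_pM; [exact: nc_ge0|exact: nc_ge0| |].
    by apply: expm_le; rewrite ger0_norm; lra.
  rewrite /r -(RIZ N (hR x)); apply: CI_le_dom.
  + apply: CmeasM; first exact: Cmeas_oo.
    by apply: CmeasM; [exact: mQ|exact: mD].
  + exact: RableZ (hR x).
  + move=> t; have [/andP[t0 tx]|ht] := boolP ((0 < t) && (t < x - u)); last first.
      rewrite /oo (negPf ht) mul0r nc0; apply: mulr_ge0 => //.
      by rewrite mulr_ge0 // mulr_ge0 ?nc_ge0 // expR_ge0.
    rewrite /oo t0 tx mul1r ncM; have -> : t < x by lra.
    rewrite mul1r mulrCA; apply: ler_wpM2l; first exact: nc_ge0.
    by apply: hN; apply/andP; split; lra.
- rewrite subr0 mulrAC; apply: ler_wpM2r; first by rewrite mulr_ge0.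
  by apply: ler_wpM2l; [exact: ltW|exact: xp].
Qed.

(** All that the values of the solutions at pi retain of the potential, apart from its
    mean, see [solves_char]. *)
Definition dens (Q : R -> C) (b : R * R -> C) (y : R) : C := Q y - PJ Q b (pi - y) y.

Lemma dens_Cable (Q : R -> C) (b : R * R -> C) (B : R) : potential Q -> Cmeas b ->
  (forall p, nc (b p) <= B) -> Cable (fun y => oo 0 pi y * dens Q b y).
Proof.
move=> pQ mb hb; have cQ := potential_Cable pQ.
have mF : Cmeas (fun y : R => PJ Q b (pi - y) y).
  apply: (Cmeas_comp (g := fun y : R => (pi - y, y)) (PJ_meas cQ mb)).
  apply: measurable_fun_pair; last exact: measurable_id.
  by apply: measurable_funB; [exact: measurable_cst|exact: measurable_id].
have c2 : Cable (fun y => oo 0 pi y * PJ Q b (pi - y) y).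
  apply: (Cable_bd mF (B := B * RI (fun x => nc (Q x)))) => y _ _.
  exact: (PJ_le cQ mb hb).
by apply: Cable_eq (CableB (Cable_ooM 0 pi cQ) c2) => y; rewrite -mulrBr.
Qed.

(** This is [V_eq] at the point pi, with the unknown solution replaced by exponentials
    through [solution_kernel] and [Iv_QWker]. *)
Lemma representation (Q : R -> C) (b : R * R -> C) (B : R) (lam a : C) (s s1 : R -> C) :
  potential Q -> Cmeas b -> (forall p, nc (b p) <= B) ->
  (forall x s, tri (x, s) -> b (x, s) = Gam Q (x - s) - Gam Q s + J Q b x s) ->
  solves Q lam s s1 -> a ^+ 2 = - lam ->
  (a + a) * (s1 pi + a * s pi) = (a + a) * expm (- a) pi + Gam Q pi * expm (- a) pi -
    Iv (fun y => expm (- a) (pi - 2 * y) * dens Q b y) 0 pi.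
Proof.
move=> pQ mb hb eb hs ha; have cQ := potential_Cable pQ.
have pp : 0 <= (pi : R) <= pi by apply/andP; split; [exact: pi_ge0|exact: lexx].
have [mQ _ _] := pQ; have [ms _ [M hM] _] := hs.
have cz := dens_Cable pQ mb hb.
set nu := a + a.
have h1 := V_eq pQ hs ha pp.
have cez : Cable (fun y => oo 0 pi y * (expm nu y * dens Q b y)).
  apply: Cable_eq (oo_expm_Cable nu (pi_ge0 R) cz) => y.
  have oid : oo 0 pi y * oo 0 pi y = oo 0 pi y :> C by rewrite /oo -natrM mulnb andbb.
  have alg (o e d : C) : o * o = o -> o * (e * (o * d)) = o * (e * d).
    by move=> h; rewrite -{3}h; ring.
  exact: alg.
have h2 : nu * Iv (fun t => Q t * (expm a t * s t)) 0 pi = Gam Q pi - Iv (fun y => expm nu y * dens Q b y) 0 pi.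
  have cQs : Cable (fun t => oo 0 pi t * (Q t * (expm a t * s t))).
    apply: (Cable_dom _ (RableZ (expR (nc a * pi) * M) (Cable_nc cQ))).
      apply: CmeasM; first exact: Cmeas_oo.
      apply: CmeasM; first exact: mQ.
      by apply: CmeasM; [exact: Cmeas_expm|exact: ms].
    have M0 : 0 <= M := le_trans (nc_ge0 _) (hM 0).1.
    move=> t; have [/andP[t0 tx]|ht] := boolP ((0 < t) && (t < pi)); last first.
      by rewrite /oo (negPf ht) mul0r nc0; apply: mulr_ge0; [apply: mulr_ge0; [exact: expR_ge0|exact: M0]|exact: nc_ge0].
    rewrite /oo t0 tx mul1r ncM mulrC; apply: ler_wpM2r; first exact: nc_ge0.
    rewrite ncM; apply: ler_pM; [exact: nc_ge0|exact: nc_ge0|exact: expm_le_oo|by case: (hM t)].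
  have -> : nu * Iv (fun t => Q t * (expm a t * s t)) 0 pi = Iv (fun u => Q u * Wker b nu u) 0 pi.
    rewrite /Iv -(CIZ nu cQs); apply: eq_CI => t.
    have [/andP[t0 tx]|ht] := boolP ((0 < t) && (t < pi)); last first.
      have oz : oo 0 pi t = 0 :> C by rewrite /oo (negPf ht).
      by rewrite oz !mul0r mulr0.
    rewrite (solution_kernel pQ mb hb eb hs ha); last by rewrite !ltW.
    have alg (o q n e z : C) : n * (o * (q * (e * z))) = o * (q * (n * (e * z))) by ring.
    exact: alg.
  rewrite (Iv_QWker pQ mb hb nu (pi_ge0 R)); congr (_ + _).
  rewrite /Iv -(CIN cez); apply: eq_CI => y.
  by rewrite /dens -[in RHS]mulrN -[in RHS]mulrN opprB.
have ee : expm (- a) pi * expm a pi = 1.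
  by rewrite expmM addNr /expm oppr0 mul0r cexp0.
have -> : Iv (fun y => expm (- a) (pi - 2 * y) * dens Q b y) 0 pi =
    expm (- a) pi * Iv (fun y => expm nu y * dens Q b y) 0 pi.
  rewrite /Iv -(CIZ _ cez); apply: eq_CI => y.
  have -> : expm (- a) (pi - 2 * y) = expm (- a) pi * expm nu y.
    rewrite expmD; congr (_ * _); rewrite /expm /nu; congr cexp.
    have -> : (- (2 * y))%:C = - (y%:C + y%:C) :> C.
      by rewrite -rmorphD -rmorphN; congr (_%:C); ring.
    have alg (c d : C) : - - c * - (d + d) = - (c + c) * d by ring.
    exact: alg.
  have alg (o e n d : C) : o * (e * n * d) = e * (o * (n * d)) by ring.
  exact: alg.
have alg (e e' n S G I q : C) : e' * e = 1 -> e * S = 1 + q -> n * q = G - I ->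
    n * S = n * e' + G * e' - e' * I.
  move=> k1 k2 k3; have -> : n * S = e' * (n * (e * S)).
    by have -> : e' * (n * (e * S)) = e' * e * (n * S) by [ring]; rewrite k1 mul1r.
  by rewrite k2 mulrDr mulr1 k3; ring.
exact: alg ee h1 h2.
Qed.
End Characteristic.

(** * Trigonometric functions of a square root *)

Section TrigFunctions.
Variable R : realType.
Local Notation C := R[i].
Local Notation Re := (@complex.Re R).
Local Notation Im := (@complex.Im R).
Local Notation nc := (@Normc.normc R).
Local Notation ii := (0 +i* 1 : C).

Lemma arg_a (l : C) : (ii * sqrtc l) ^+ 2 = - l.
Proof. by rewrite exprMn sqr_sqrtc expr2 ii2 mulN1r. Qed.

Lemma c_funE (x : R) (l : C) : c_fun x l = (expm (- (ii * sqrtc l)) x + expm (ii * sqrtc l) x) / 2.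
Proof.
rewrite /c_fun /ccos /expm opprK; congr ((cexp _ + cexp _) / 2); first by rewrite mulrA.
by rewrite mulrA mulNr.
Qed.

Lemma s_funE (x : R) (l : C) : s_fun x l =
  - (ii * sqrtc l) * (expm (- (ii * sqrtc l)) x - expm (ii * sqrtc l) x) / 2.
Proof.
rewrite /s_fun /csin /expm opprK.
have -> : ii * (sqrtc l * x%:C) = ii * sqrtc l * x%:C by rewrite mulrA.
rewrite [- _ * x%:C]mulNr; move: (cexp _) (cexp _) => u v.
have i1 : ii^-1 = - ii.
  have h : ii != 0 := ii_neq0 R.
  by apply: (mulfI h); rewrite divff // mulrN ii2 opprK.
rewrite invfM i1.
have alg (i r e f : C) : r * ((e - f) * (2^-1 * - i)) = - (i * r) * (e - f) / 2 by ring.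
exact: alg.
Qed.

Lemma c_funN (x : R) (l : C) : c_fun (- x) l = c_fun x l.
Proof.
rewrite /c_fun /ccos rmorphN !mulrN opprK; congr (_ / 2); exact: addrC.
Qed.

Lemma s_funN (x : R) (l : C) : s_fun (- x) l = - s_fun x l.
Proof.
rewrite /s_fun /csin rmorphN !mulrN opprK -opprB mulNr mulrN.
by [].
Qed.

Lemma sqrtc_le (w : C) : nc (sqrtc w) <= 1 + nc w.
Proof.
have h : nc (sqrtc w) ^+ 2 = nc w by rewrite -ncX sqr_sqrtc.
have := nc_ge0 (sqrtc w); nra.
Qed.

Lemma trig_expm_le (x : R) (w : C) : `|x| <= pi ->
  nc (expm (ii * sqrtc w) x) <= expR ((1 + nc w) * pi) /\
  nc (expm (- (ii * sqrtc w)) x) <= expR ((1 + nc w) * pi).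
Proof.
move=> hx.
have key (c : C) : nc c = nc (sqrtc w) -> nc (expm c x) <= expR ((1 + nc w) * pi).
  move=> hc; apply: le_trans (expm_le c hx) _; rewrite ler_expR hc.
  by apply: ler_wpM2r; [exact: pi_ge0|exact: sqrtc_le].
by split; apply: key; rewrite ?ncN ncM nc_ii mul1r.
Qed.

Lemma c_fun_le (x : R) (w : C) : `|x| <= pi -> nc (c_fun x w) <= expR ((1 + nc w) * pi).
Proof.
move=> hx; have [h1 h2] := trig_expm_le w hx.
rewrite c_funE ncM ncV nc_nat ler_pdivrMr // (_ : _ * 2 = expR ((1 + nc w) * pi) + expR ((1 + nc w) * pi)); last by ring.
by apply: le_trans (ncD _ _) (lerD h2 h1).
Qed.

Lemma s_fun_le (x : R) (w : C) : `|x| <= pi ->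
  nc (s_fun x w) <= (1 + nc w) * expR ((1 + nc w) * pi).
Proof.
move=> hx; have [h1 h2] := trig_expm_le w hx.
rewrite s_funE ncM ncV nc_nat ler_pdivrMr // -mulrA ncM ncN ncM nc_ii mul1r.
apply: ler_pM; [exact: nc_ge0|exact: nc_ge0|exact: sqrtc_le|].
rewrite (_ : _ * 2 = expR ((1 + nc w) * pi) + expR ((1 + nc w) * pi)); last by ring.
by apply: le_trans (ncB _ _) (lerD h2 h1).
Qed.

(** The square root jumps across the negative axis, so its measurability is read off the
    explicit formula. *)
Lemma Cmeas_sqrtc d (T : measurableType d) (f : T -> C) : Cmeas f -> Cmeas (fun t => sqrtc (f t)).
Proof.
move=> mf; have [a b] := mf; have mn := measurable_nc mf.
have ms (u : T -> R) : measurable_fun setT u -> measurable_fun setT (fun t => Num.sqrt (u t)).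
  move=> mu'; apply: (@measurable_comp _ _ _ _ _ _ setT (@Num.sqrt R)) => //.
  by apply: continuous_measurable_fun; exact: sqrt_continuous.
split.
  apply: (@eq_measurable_fun _ _ _ _ _ (fun t => Num.sqrt ((nc (f t) + Re (f t)) * 2^-1))).
    by move=> t _ /=; move: (f t) => [u v].
  by apply: ms; apply: measurable_funM; [exact: measurable_funD|exact: measurable_cst].
apply: (@eq_measurable_fun _ _ _ _ _
  (fun t => (if Im (f t) < 0 then -1 else 1) * Num.sqrt ((nc (f t) - Re (f t)) * 2^-1))).
  move=> t _ /=; move: (f t) => [u v] /=; congr (_ * _).
  have [v0|v0|v0] := ltrgt0P v; last by [].
    by rewrite gtr0_sg.
  by rewrite ltr0_sg.
apply: measurable_funM.
  apply: measurable_fun_ifT; [|exact: measurable_cst|exact: measurable_cst].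
  by apply: measurable_fun_ltr; [exact: b|exact: measurable_cst].
by apply: ms; apply: measurable_funM; [exact: measurable_funB|exact: measurable_cst].
Qed.

Section Meas.
Context d (T : measurableType d) (x : T -> R) (w : T -> C).
Hypotheses (mx : measurable_fun setT x) (mw : Cmeas w).

Lemma Cmeas_expm2 (c : T -> C) : Cmeas c -> Cmeas (fun t => expm (c t) (x t)).
Proof.
move=> mc; apply: Cmeas_cexp; apply: CmeasM; first exact: CmeasN.
exact: Cmeas_real.
Qed.

Let mi : Cmeas (fun t => ii * sqrtc (w t)).
Proof. by apply: CmeasM; [exact: Cmeas_cst|exact: Cmeas_sqrtc]. Qed.

Lemma Cmeas_c_fun : Cmeas (fun t => c_fun (x t) (w t)).
Proof.
apply: (Cmeas_eq (f := fun t => (expm (- (ii * sqrtc (w t))) (x t) + expm (ii * sqrtc (w t)) (x t)) * 2^-1)).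
  by move=> t; rewrite c_funE.
apply: CmeasM; last exact: Cmeas_cst.
by apply: CmeasD; apply: Cmeas_expm2; [exact: CmeasN|exact: mi].
Qed.

Lemma Cmeas_s_fun : Cmeas (fun t => s_fun (x t) (w t)).
Proof.
apply: (Cmeas_eq (f := fun t => - (ii * sqrtc (w t)) *
    (expm (- (ii * sqrtc (w t))) (x t) - expm (ii * sqrtc (w t)) (x t)) * 2^-1)).
  by move=> t; rewrite s_funE.
apply: CmeasM; last exact: Cmeas_cst.
apply: CmeasM; first exact: CmeasN.
by apply: CmeasB; apply: Cmeas_expm2; [exact: CmeasN|exact: mi].
Qed.
End Meas.

Lemma ent_cexp_CI (c : C) (x : R -> R) (k : R -> C) (B : R) : measurable_fun setT x ->
  (forall t, `|x t| <= B) -> Cable k -> ent (fun r => CI (fun t => cexp (c * (x t)%:C * r) * k t)).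
Proof.
move=> mx hB ck.
have mc : Cmeas (fun t => c * (x t)%:C) by apply: CmeasM; [exact: Cmeas_cst|exact: Cmeas_real].
have me z : Cmeas (fun t => cexp (0 + c * (x t)%:C * z)).
  apply: Cmeas_cexp; apply: CmeasD; first exact: Cmeas_cst.
  by apply: CmeasM; [exact: mc|exact: Cmeas_cst].
have dexp z : derK (@cexp R) z = cexp z by have [] := Cd_derivable (@Cd_cexp R z).
have h := @ent_CI R (@cexp R) (fun=> 0) (fun t => c * (x t)%:C) k 0 (nc c * B) (@derivable_cexp R).
have -> : (fun r => CI (fun t => cexp (c * (x t)%:C * r) * k t)) =
    (fun r => CI (fun t => cexp (0 + c * (x t)%:C * r) * k t)).
  by apply/funext => r; apply: eq_CI => t; rewrite add0r.
apply: h.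
- by move=> t; rewrite nc0.
- by move=> t; rewrite ncM nc_real; apply: ler_wpM2l; [exact: nc_ge0|exact: hB].
- exact: ck.
- exact: mc.
- exact: me.
- by move=> z; apply: Cmeas_eq (me z) => t; rewrite dexp.
Qed.

Lemma cexp_CI_Cable (c : C) (x : R -> R) (k : R -> C) (B : R) r : measurable_fun setT x ->
  (forall t, `|x t| <= B) -> Cable k -> Cable (fun t => cexp (c * (x t)%:C * r) * k t).
Proof.
move=> mx hB ck.
have mc : Cmeas (fun t => c * (x t)%:C) by apply: CmeasM; [exact: Cmeas_cst|exact: Cmeas_real].
apply: (CableM (B := expR (nc c * B * nc r))); last exact: ck.
  by apply: Cmeas_cexp; apply: CmeasM; [exact: mc|exact: Cmeas_cst].
move=> t; apply: le_trans (cexp_nc_le _) _; rewrite ler_expR !ncM nc_real.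
apply: ler_wpM2r; first exact: nc_ge0.
by apply: ler_wpM2l; [exact: nc_ge0|exact: hB].
Qed.

Lemma ent_eq (f g : C -> C) : f =1 g -> ent f -> ent g.
Proof. by move=> /funext ->. Qed.

Arguments cexp_CI_Cable c {x k B} r.

Section EntireTrig.
Variables (x : R -> R) (k : R -> C) (B : R).
Hypotheses (mx : measurable_fun setT x) (hB : forall t, `|x t| <= B) (ck : Cable k).

Let G (c r : C) : C := CI (fun t => cexp (c * (x t)%:C * r) * k t).
Let eG c : ent (G c). Proof. exact: ent_cexp_CI mx hB ck. Qed.
Let GN c r : G c (- r) = G (- c) r.
Proof. by apply: eq_CI => t; rewrite mulrN mulNr mulNr. Qed.

(** The integral is an even entire function of the square root of l. *)
Lemma ent_c_int : ent (fun l => CI (fun t => c_fun (x t) l * k t)).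
Proof.
pose g r := (G ii r + G (- ii) r) / 2.
have eg : ent g.
  move=> z; apply: derivableKM; last exact: derivableK_cst.
  by apply: derivableKD; exact: eG.
have ev z : g (- z) = g z by rewrite /g !GN opprK addrC.
apply: (ent_eq _ (ent_even_sqrt eg ev)) => l.
rewrite /g /G -(CID (cexp_CI_Cable ii _ mx hB ck) (cexp_CI_Cable (- ii) _ mx hB ck)).
rewrite mulrC -(CIZ _ (CableD (cexp_CI_Cable ii _ mx hB ck) (cexp_CI_Cable (- ii) _ mx hB ck))).
apply: eq_CI => t; rewrite /c_fun /ccos -mulrDl.
have -> : ii * (x t)%:C * sqrtc l = ii * (sqrtc l * (x t)%:C).
  have alg (i s y : C) : i * y * s = i * (s * y) by ring.
  exact: alg.
have -> : - ii * (x t)%:C * sqrtc l = - (ii * (sqrtc l * (x t)%:C)).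
  have alg (i s y : C) : - i * y * s = - (i * (s * y)) by ring.
  exact: alg.
have alg (u h w : C) : h * (u * w) = u * h * w by ring.
exact: alg.
Qed.

Lemma ent_s_int : ent (fun l => CI (fun t => s_fun (x t) l * k t)).
Proof.
pose g r := r * ((G ii r - G (- ii) r) / (2 * ii)).
have eg : ent g.
  move=> z; apply: derivableKM; first exact: derivableK_id.
  apply: derivableKM; last exact: derivableK_cst.
  by apply: derivableKB; exact: eG.
have ev z : g (- z) = g z by rewrite /g !GN opprK mulNr -mulrN -mulNr opprB.
apply: (ent_eq _ (ent_even_sqrt eg ev)) => l.
rewrite /g /G -(CIB (cexp_CI_Cable ii _ mx hB ck) (cexp_CI_Cable (- ii) _ mx hB ck)).
rewrite [_ / _]mulrC mulrA -(CIZ _ (CableB (cexp_CI_Cable ii _ mx hB ck) (cexp_CI_Cable (- ii) _ mx hB ck))).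
apply: eq_CI => t; rewrite /s_fun /csin -mulrBl.
have -> : ii * (x t)%:C * sqrtc l = ii * (sqrtc l * (x t)%:C).
  have alg (i s y : C) : i * y * s = i * (s * y) by ring.
  exact: alg.
have -> : - ii * (x t)%:C * sqrtc l = - (ii * (sqrtc l * (x t)%:C)).
  have alg (i s y : C) : - i * y * s = - (i * (s * y)) by ring.
  exact: alg.
have alg (s i u w : C) : s * i * (u * w) = s * (u * i) * w by ring.
exact: alg.
Qed.
End EntireTrig.

Lemma CI_oo01 : CI (oo 0 1) = 1 :> C.
Proof.
apply: complex_ext.
  rewrite Re_CI -[RHS]/(1 : R) -[RHS]subr0 -(RI_oo (@ler01 R)); congr RI.
  by apply/funext => t; rewrite Re_bool.
by rewrite Im_CI -[RHS]/(0 : R) -[RHS](@RI0 R); congr RI; apply/funext => t; rewrite Im_bool.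
Qed.

Lemma ent_c_fun (x : R) : ent (c_fun x).
Proof.
have h := @ent_c_int (fun=> x) (oo 0 1) `|x| (measurable_cst _) (fun=> lexx _) (Cable_oo 0 1).
by apply: ent_eq h => l; rewrite (CIZ (c_fun x l) (Cable_oo 0 1)) [CI _]CI_oo01 mulr1.
Qed.
Lemma ent_s_fun (x : R) : ent (s_fun x).
Proof.
have h := @ent_s_int (fun=> x) (oo 0 1) `|x| (measurable_cst _) (fun=> lexx _) (Cable_oo 0 1).
by apply: ent_eq h => l; rewrite (CIZ (s_fun x l) (Cable_oo 0 1)) [CI _]CI_oo01 mulr1.
Qed.

End TrigFunctions.

(** * Entire dependence on the spectral parameter *)

Section EntireSolution.
Variable R : realType.
Local Notation C := R[i].
Local Notation nc := (@Normc.normc R).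
Local Notation ii := (0 +i* 1 : C).

Definition kernel_of (Q : R -> C) (b : R * R -> C) (B : R) :=
  [/\ Cmeas b, forall p, nc (b p) <= B &
    forall x s, tri (x, s) -> b (x, s) = Gam Q (x - s) - Gam Q s + J Q b x s].

(** The frequency pi - 2 t of [representation], cut off outside (0, pi) to make it
    bounded. *)
Definition fold_pi (t : R) : R := ((0 < t) && (t < pi))%:R * (pi - 2 * t).

Lemma measurable_fold : measurable_fun setT fold_pi.
Proof.
apply: measurable_funM; last first.
  by apply: measurable_funB; [exact: measurable_cst|apply: measurable_funM; [exact: measurable_cst|exact: measurable_id]].
exact: Rable_meas (Rable_oo 0 pi).
Qed.

Lemma fold_le t : `|fold_pi t| <= pi.
Proof.
rewrite /fold_pi; have := pi_ge0 R; case: (ltP 0 t) => t0; case: (ltP t pi) => tp p0 /=;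
  rewrite ?mul0r ?normr0 // mul1r ler_norml; apply/andP; split; lra.
Qed.

Definition dens0 Q (b : R * R -> C) (y : R) : C := oo 0 pi y * dens Q b y.

(** The expressions for lam S(pi, lam) and lam S'(pi, lam), see [solves_char]. *)
Definition PsiS Q b (l : C) : C := s_fun pi l - Gam Q pi / 2 * c_fun pi l +
  2^-1 * CI (fun y => c_fun (fold_pi y) l * dens0 Q b y).
Definition PsiS1 Q b (l : C) : C := l * c_fun pi l + Gam Q pi / 2 * s_fun pi l -
  2^-1 * CI (fun y => s_fun (fold_pi y) l * dens0 Q b y).

(** [representation] for both square roots of - lam is a linear system for s pi and s1
    pi. *)
Lemma solves_char Q b B lam (s s1 : R -> C) : potential Q -> kernel_of Q b B ->
  solves Q lam s s1 -> lam * s pi = PsiS Q b lam /\ lam * s1 pi = PsiS1 Q b lam.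
Proof.
move=> pQ [mb hb eb] hs; have ck : Cable (dens0 Q b) := dens_Cable pQ mb hb.
set a := ii * sqrtc lam; have ha : a ^+ 2 = - lam := arg_a lam.
have hNa : (- a) ^+ 2 = - lam by rewrite sqrrN.
have h1 := representation pQ mb hb eb hs ha.
have h2 := representation pQ mb hb eb hs hNa.
rewrite opprK in h2.
pose I (c : C) := CI (fun y => expm c (fold_pi y) * dens0 Q b y).
have IE c : Iv (fun y => expm c (pi - 2 * y) * dens Q b y) 0 pi = I c.
  apply: eq_CI => y; rewrite /dens0 mulrCA.
  have [/andP[y0 yp]|hy] := boolP ((0 < y) && (y < pi)); last first.
    have oz : oo 0 pi y = 0 :> C by rewrite /oo (negPf hy).
    by rewrite oz !mul0r !mulr0.
  by rewrite /fold_pi y0 yp mul1r.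
rewrite (IE (- a)) in h1; rewrite (IE a) in h2.
have cI c : Cable (fun y => expm c (fold_pi y) * dens0 Q b y).
  apply: (CableM (B := expR (nc c * pi))); last exact: ck.
    apply: Cmeas_expm2; first exact: measurable_fold.
    exact: Cmeas_cst.
  by move=> y; apply: expm_le; exact: fold_le.
have Ic : CI (fun y => c_fun (fold_pi y) lam * dens0 Q b y) = (I (- a) + I a) / 2.
  rewrite /I -(CID (cI (- a)) (cI a)) mulrC -(CIZ _ (CableD (cI (- a)) (cI a))).
  apply: eq_CI => y; rewrite c_funE -/a.
  have alg (e f d : C) : (e + f) / 2 * d = 2^-1 * (e * d + f * d) by ring.
  exact: alg.
have Is : CI (fun y => s_fun (fold_pi y) lam * dens0 Q b y) = - a * (I (- a) - I a) / 2.
  rewrite /I -(CIB (cI (- a)) (cI a)) mulrAC -(CIZ _ (CableB (cI (- a)) (cI a))).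
  apply: eq_CI => y; rewrite s_funE -/a.
  have alg (c e f d : C) : - c * (e - f) / 2 * d = - c / 2 * (e * d - f * d) by ring.
  exact: alg.
rewrite /PsiS /PsiS1 Ic Is c_funE s_funE -/a.
move: h1 h2; move: (I (- a)) (I a) (expm _ pi) (expm _ pi) (Gam Q pi) (s pi) (s1 pi).
move=> Ip Im' ep em G S S1 h1 h2.
have lamE : lam = - a ^+ 2 by rewrite ha opprK.
have alg1 (l c x y X Y : C) : l = - c ^+ 2 -> (c + c) * (y + c * x) = X ->
    (- c + - c) * (y + - c * x) = Y -> l * x = - (X + Y) / 4 /\ l * y = - c * (X - Y) / 4.
  by move=> -> <- <-; split; field.
have [-> ->] := alg1 _ _ _ _ _ _ lamE h1 h2.
have alg2 (c e f g i j : C) :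
  - ((c + c) * e + g * e - i + ((- c + - c) * f + g * f - j)) / 4 =
  - c * (e - f) / 2 - g / 2 * ((e + f) / 2) + 2^-1 * ((i + j) / 2) by field.
have alg3 (c e f g i j l : C) : l = - c ^+ 2 ->
  - c * ((c + c) * e + g * e - i - ((- c + - c) * f + g * f - j)) / 4 =
  l * ((e + f) / 2) + g / 2 * (- c * (e - f) / 2) - 2^-1 * (- c * (i - j) / 2).
  by move=> ->; field.
by split; [exact: alg2|exact: alg3 lamE].
Qed.

Lemma ent_Psi Q b B : potential Q -> kernel_of Q b B -> ent (PsiS Q b) /\ ent (PsiS1 Q b).
Proof.
move=> pQ [mb hb eb]; have ck : Cable (dens0 Q b) := dens_Cable pQ mb hb.
have ec := ent_c_int measurable_fold fold_le ck.
have es := ent_s_int measurable_fold fold_le ck.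
split => z.
  apply: derivableKD.
    apply: derivableKB; first exact: ent_s_fun.
    by apply: derivableKM; [exact: derivableK_cst|exact: ent_c_fun].
  by apply: derivableKM; [exact: derivableK_cst|exact: ec].
apply: derivableKB.
  apply: derivableKD.
    by apply: derivableKM; [exact: derivableK_id|exact: ent_c_fun].
  by apply: derivableKM; [exact: derivableK_cst|exact: ent_s_fun].
by apply: derivableKM; [exact: derivableK_cst|exact: es].
Qed.

Lemma potential_cst (c : C) : potential (fun x => oo 0 pi x * c).
Proof.
split.
- by apply: CmeasM; [exact: Cmeas_oo|exact: Cmeas_cst].
- apply: Rable_eq (RableZ (nc c ^+ 2) (Rable_oo 0 pi)) => x.
  by rewrite ncM nc_oo mulrC exprMn; case: (_ && _); rewrite ?expr1n // expr0n.
- by move=> x /negPf h; rewrite /oo h mul0r.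
Qed.

Section Problem.
Variables (q : R -> C) (S S1 : R -> C -> C).
Hypotheses (Lq : L2 q) (HS : is_S q S S1).
Let Q (x : R) : C := oo 0 pi x * q x.

Lemma is_S_char b B l : kernel_of Q b B ->
  l * S pi l = PsiS Q b l /\ l * S1 pi l = PsiS1 Q b l.
Proof.
move=> hk; have [sol s0 s10] := HS l.
have [s [s1 [hs <- <-]]] := SL_solves Lq sol s0 s10.
exact: (solves_char (L2_potential Lq) hk hs).
Qed.

(** The factor l - (z - 1) equals 1 at z, hence can be divided out near z. *)
Lemma ent_near (f P : C -> C) (z : C) : ent P ->
  (forall l, (l - (z - 1)) * f l = P (l - (z - 1))) -> derivableK f z.
Proof.
move=> eP hf; pose c := z - 1.
have zc : z - c = 1 by rewrite /c opprB addrC subrK.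
have dc : derivableK (fun w => w - c) z by apply: derivableKB; [exact: derivableK_id|exact: derivableK_cst].
have dF : derivableK (fun w => P (w - c) * (w - c)^-1) z.
  apply: derivableKM; first exact: (derivable_comp (f := P) (G := fun w => w - c) (eP (z - c)) dc).
  by apply: derivableKV; [rewrite zc oner_eq0|exact: dc].
have [] := Cd_derivable (Cd_near (f := f) ltr01 _ (derivable_Cd dF)); last by [].
move=> h hh; have h0 : z + h - c != 0.
  rewrite addrAC zc; apply/eqP => e.
  have : nc h = 1 by rewrite -ncN -[X in nc X]add0r -e addrK nc1.
  by move=> e1; rewrite e1 ltxx in hh.
by rewrite -(hf (z + h)) mulrC mulKf.
Qed.

(** The function lam S(pi, lam) is entire by [solves_char], which settles all lam except
    0; shifting the potential by a constant moves the exceptional point. *)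
Lemma ent_S : ent (S pi) /\ ent (S1 pi).
Proof.
have shift c : exists P P1, [/\ ent P, ent P1 & forall l, (l - c) * S pi l = P (l - c) /\
    (l - c) * S1 pi l = P1 (l - c)].
  have pQ : potential (fun x => Q x - oo 0 pi x * c).
    by apply: potentialB; [exact: L2_potential|exact: potential_cst].
  have [b [B [mb hb _ eb]]] := antisymmetric_kernel pQ.
  have hk : kernel_of (fun x => Q x - oo 0 pi x * c) b B by [].
  have [e1 e2] := ent_Psi pQ hk.
  exists (PsiS (fun x => Q x - oo 0 pi x * c) b), (PsiS1 (fun x => Q x - oo 0 pi x * c) b).
  split; [exact: e1|exact: e2|] => l.
  have [sol s0 s10] := HS l; have [s [s1 [hs <- <-]]] := SL_solves Lq sol s0 s10.
  exact: (solves_char pQ hk (solves_shift c hs)).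
split=> z; have [P [P1 [eP eP1 h]]] := shift (z - 1).
  by apply: (ent_near eP) => l; case: (h l).
by apply: (ent_near eP1) => l; case: (h l).
Qed.

End Problem.
End EntireSolution.

(** * Completeness and folding of the interval *)

Section Complete.
Variable R : realType.
Local Notation C := R[i].
Local Notation Re := (@complex.Re R).
Local Notation nc := (@Normc.normc R).
Local Notation mu := (@lebesgue_measure R).

Lemma integral_oo (u : R -> R) : (\int[mu]_(x in `]0%R, pi[) (u x)%:E)%E =
  (\int[mu]_x (((0 < x) && (x < pi))%:R * u x)%:E)%E.
Proof.
rewrite integral_mkcond; apply: eq_integral => x _; rewrite /patch; case: ifP => [|].
  by rewrite inE /= in_itv /= => ->; rewrite mul1r.
by move/negP; rewrite inE /= in_itv /= => /negP/negPf ->; rewrite mul0r.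
Qed.

Lemma potential_L2 (P : R -> C) : potential P -> L2 P.
Proof.
move=> [mP iP sP]; split.
  by split; apply: measurable_funTS; [exact: mP.1|exact: mP.2].
rewrite /sqL2 integral_oo (_ : (fun x => _) = (fun x => (nc (P x) ^+ 2)%:E)).
  by rewrite -RI_fin // ltry.
apply/funext => x; rewrite -nc_sqr.
have [h|h] := boolP ((0 < x) && (x < pi)); first by rewrite mul1r.
by rewrite (sP x h) nc0 expr0n mulr0.
Qed.

Lemma potential_conj (P : R -> C) : potential P -> potential (fun x => (P x)^*%C).
Proof.
move=> [mP iP sP]; split; first exact: Cmeas_conj.
- by apply: Rable_eq iP => x; rewrite nc_conj.
- by move=> x hx; rewrite (sP x hx) conjc0.
Qed.

Lemma potentialD (P P' : R -> C) : potential P -> potential P' -> potential (fun x => P x + P' x).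
Proof.
move=> pP [a b c]; have pN : potential (fun x => - P' x).
  split; first exact: CmeasN.
    by apply: Rable_eq b => x; rewrite ncN.
  by move=> x hx; rewrite (c x hx) oppr0.
by have := potentialB pP pN; congr potential; apply/funext => x; rewrite opprK.
Qed.

(** Let h be the conjugate of (N, K). Its pairing with any linear combination of the v k
    vanishes, so the squared norm of h is bounded by the norm of h times its distance to
    the span. *)
Lemma complete_orth (v : nat -> R -> C * C) (N K : R -> C) : completeH v ->
  (forall k, Cmeas (fun t => (v k t).1) /\ Cmeas (fun t => (v k t).2)) ->
  (forall k, exists M, forall t, 0 < t -> t < pi -> nc (v k t).1 <= M /\ nc (v k t).2 <= M) ->
  potential N -> potential K ->
  (forall k, CI (fun t => (v k t).1 * N t + (v k t).2 * K t) = 0) ->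
  RI (fun t => nc (N t) ^+ 2 + nc (K t) ^+ 2) = 0.
Proof.
move=> hv mv bv pN pK orth; have [mN iN sN] := pN; have [mK iK sK] := pK.
pose e t := nc (N t) ^+ 2 + nc (K t) ^+ 2.
have ie : Rable e by exact: RableD.
have A0 : 0 <= RI e by apply: RI_ge0 => t; rewrite addr_ge0 // sqr_ge0.
have cF k : Cable (fun t => (v k t).1 * N t + (v k t).2 * K t).
  have [M hM] := bv k; have [m1 m2] := mv k.
  have cut (f P : R -> C) : Cmeas f -> (forall t, 0 < t -> t < pi -> nc (f t) <= M) ->
      potential P -> Cable (fun t => f t * P t).
    move=> mf hf pP; have [mP _ sP] := pP.
    apply: (Cable_dom _ (RableZ `|M| (Cable_nc (potential_Cable pP)))); first exact: CmeasM.
    move=> t; have [/andP[t0 tp]|ht] := boolP ((0 < t) && (t < pi)); last first.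
      by rewrite (sP t ht) mulr0 nc0 mulr0.
    rewrite ncM; apply: ler_wpM2r; first exact: nc_ge0.
    exact: le_trans (hf t t0 tp) (ler_norm _).
  by apply: CableD; apply: cut => // t t0 tp; case: (hM t t0 tp).
have span n (a : 'I_n -> C) :
  [/\ Cmeas (fun t => \sum_(k < n) a k * (v k t).1), Cmeas (fun t => \sum_(k < n) a k * (v k t).2) &
    Cable (fun t => (\sum_(k < n) a k * (v k t).1) * N t + (\sum_(k < n) a k * (v k t).2) * K t) /\
    CI (fun t => (\sum_(k < n) a k * (v k t).1) * N t + (\sum_(k < n) a k * (v k t).2) * K t) = 0].
  elim: n a => [|n IH] a.
    have s0 (F : 'I_0 -> C) : \sum_(k < 0) F k = 0 by rewrite big_ord0.
    split.
    - by apply: (Cmeas_eq (f := fun=> 0)); [move=> t; rewrite s0|exact: Cmeas_cst].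
    - by apply: (Cmeas_eq (f := fun=> 0)); [move=> t; rewrite s0|exact: Cmeas_cst].
    - split; first by apply: Cable_eq (@Cable0 R) => t; rewrite !s0 !mul0r addr0.
      by rewrite -[RHS](@CI0 R); apply: eq_CI => t; rewrite !s0 !mul0r addr0.
  have [m1 m2 [c ci]] := IH (fun k => a (widen_ord (leqnSn n) k)).
  have [w1 w2] := mv n.
  split.
  - apply: (Cmeas_eq (f := fun t => \sum_(k < n) a (widen_ord (leqnSn n) k) * (v k t).1 + a ord_max * (v n t).1)).
      by move=> t; rewrite big_ord_recr.
    by apply: CmeasD => //; apply: CmeasM => //; exact: Cmeas_cst.
  - apply: (Cmeas_eq (f := fun t => \sum_(k < n) a (widen_ord (leqnSn n) k) * (v k t).2 + a ord_max * (v n t).2)).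
      by move=> t; rewrite big_ord_recr.
    by apply: CmeasD => //; apply: CmeasM => //; exact: Cmeas_cst.
  - have alg (s1 s2 x x1 x2 N0 K0 : C) : s1 * N0 + s2 * K0 + x * (x1 * N0 + x2 * K0) =
      (s1 + x * x1) * N0 + (s2 + x * x2) * K0 by ring.
    have c2 := CableD c (CableZ (a ord_max) (cF n)).
    have ce := CID c (CableZ (a ord_max) (cF n)).
    rewrite (CIZ (a ord_max) (cF n)) ci orth mulr0 addr0 in ce.
    split; first by apply: Cable_eq c2 => t /=; rewrite !big_ord_recr /=; exact: alg.
    by rewrite -[RHS]ce; apply: eq_CI => t /=; rewrite !big_ord_recr /=; exact: esym (alg _ _ _ _ _ _ _).
apply/eqP; rewrite eq_le A0 andbT.
apply/ler_addgt0Pr => eps eps0; rewrite add0r -/e.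
pose h t : C * C := ((N t)^*%C, (K t)^*%C).
have hH : inH h by split; apply: potential_L2; exact: potential_conj.
have se0 : 0 < Num.sqrt eps by rewrite sqrtr_gt0.
have [n [a hu0]] := hv h hH (Num.sqrt eps) se0.
have se : Num.sqrt eps ^+ 2 = eps by rewrite sqr_sqrtr // ltW.
rewrite se in hu0.
pose l1 t := (lincomb a v t).1; pose l2 t := (lincomb a v t).2.
pose u t := ((0 < t) && (t < pi))%:R * (sqnorm ((h t).1 - l1 t) + sqnorm ((h t).2 - l2 t)).
have hu : ((\int[mu]_x (u x)%:E) < eps%:E)%E.
  rewrite -(integral_oo (fun t => sqnorm ((h t).1 - l1 t) + sqnorm ((h t).2 - l2 t))).
  exact: hu0.
have [ml1 ml2 [cL CL]] := span n a.
have mu' : measurable_fun setT u.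
  apply: measurable_funM; first exact: Rable_meas (Rable_oo 0 pi).
  have sq (f : R -> C) : Cmeas f -> measurable_fun setT (fun t => sqnorm (f t)).
    by move=> [f1 f2]; apply: measurable_funD; exact: measurable_funX.
  by apply: measurable_funD; apply: sq; apply: CmeasB => //; exact: Cmeas_conj.
have u0 t : 0 <= u t.
  by rewrite mulr_ge0 // addr_ge0 // -nc_sqr sqr_ge0.
have iu : Rable u by apply: Rable_ge0 => //; apply: lt_trans hu _; exact: ltry.
have hu' : RI u < eps by rewrite -lte_fin RI_fin.
have L0 : RI (fun t => Re (l1 t * N t + l2 t * K t)) = 0 by rewrite -Re_CI CL.
have iL := cL.1.
have ih : Rable (fun t => 2^-1 * (e t + u t)) by apply: RableZ; exact: RableD.
have le : RI (fun t => e t - Re (l1 t * N t + l2 t * K t)) <= RI (fun t => 2^-1 * (e t + u t)).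
  apply: RI_le => [||t]; [exact: RableB|exact: ih|].
  have [ht|ht] := boolP ((0 < t) && (t < pi)); last first.
    rewrite /e /u (sN t ht) (sK t ht) nc0 expr0n /= !mulr0 !addr0 subr0.
    by rewrite (negPf ht) mul0r addr0 mulr0.
  rewrite /e /u ht mul1r !nc_sqr /h /=.
  move: (N t) (K t) (l1 t) (l2 t) => [x y] [x' y'] [p q] [p' q'].
  rewrite /sqnorm /=.
  have := sqr_ge0 p; have := sqr_ge0 q; have := sqr_ge0 p'; have := sqr_ge0 q'.
  by nra.
rewrite (RIB ie iL) L0 subr0 (RIZ _ (RableD ie iu)) (RID ie iu) in le.
by lra.
Qed.

(** The two halves of (0, pi) are both mapped onto (0, pi); this turns integrals over
    the frequency pi - 2 y into integrals over the variable of the vectors v k. *)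
Lemma fold_CI (f : R -> C) : Cable f -> (forall x, ~~ ((0 < x) && (x < pi)) -> f x = 0) ->
  CI f = 2^-1 * CI (fun t => oo 0 pi t * (f ((pi - t) / 2) + f ((pi + t) / 2))).
Proof.
move=> cf sf.
have p0 := pi_gt0 R.
have c1 := Cable_ooM 0 (pi / 2) cf; have c2 := Cable_ooM (pi / 2) pi cf.
have n1 : - (2^-1) != 0 :> R by rewrite oppr_eq0 invr_eq0 pnatr_eq0.
have n2 : 2^-1 != 0 :> R by rewrite invr_eq0 pnatr_eq0.
have d1 := Cable_affine (pi / 2) n1 c1; have d2 := Cable_affine (pi / 2) n2 c2.
have e0 : CI f = Iv f 0 pi.
  apply: eq_CI => x; rewrite /oo; have [h|h] := boolP ((0 < x) && (x < pi)); first by rewrite mul1r.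
  by rewrite mul0r sf.
rewrite e0 (@Iv_split R f 0 (pi / 2) pi); last 3 first.
- by lra.
- by lra.
- exact: Cable_ooM.
rewrite /Iv (CI_affine (pi / 2) n1 c1) (CI_affine (pi / 2) n2 c2).
rewrite normrN ger0_norm ?invr_ge0 // -mulrDr -(CID d1 d2).
rewrite fmorphV rmorphD /= -[1 + 1]/(2%:R); congr (_ * _).
apply: eq_CI => t.
have -> : (pi - t) / 2 = - (2^-1) * t + pi / 2 by lra.
have -> : (pi + t) / 2 = 2^-1 * t + pi / 2 by lra.
rewrite mulrDr; congr (_ * _ + _ * _); rewrite /oo; congr (_%:R); congr nat_of_bool.
  have -> : (0 < - 2^-1 * t + pi / 2) = (t < pi) by apply/idP/idP; lra.
  have -> : (- 2^-1 * t + pi / 2 < pi / 2) = (0 < t) by apply/idP/idP; lra.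
  by rewrite andbC.
have -> : (pi / 2 < 2^-1 * t + pi / 2) = (0 < t) by apply/idP/idP; lra.
by have -> : (2^-1 * t + pi / 2 < pi) = (t < pi) by apply/idP/idP; lra.
Qed.

Lemma CI_real (u : R -> R) : CI (fun t => (u t)%:C) = (RI u)%:C.
Proof. by apply: complex_ext => //; rewrite Im_CI [RHS]/= -[RHS](@RI0 R). Qed.

Lemma fold_RI (f : R -> R) : Rable f -> (forall x, ~~ ((0 < x) && (x < pi)) -> f x = 0) ->
  RI f = 2^-1 * RI (fun t => ((0 < t) && (t < pi))%:R * (f ((pi - t) / 2) + f ((pi + t) / 2))).
Proof.
move=> rf sf; have cf : Cable (fun x => (f x)%:C) by split; [exact: rf|exact: Rable0].
have := fold_CI cf (fun x hx => congr1 (fun z => z%:C) (sf x hx)).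
have -> : (fun t => oo 0 pi t * ((f ((pi - t) / 2))%:C + (f ((pi + t) / 2))%:C)) =
    fun t => (((0 < t) && (t < pi))%:R * (f ((pi - t) / 2) + f ((pi + t) / 2)))%:C.
  apply/funext => t; rewrite /oo; case: (_ && _); last by rewrite !mul0r.
  by rewrite !mul1r rmorphD.
have -> : (2^-1 : C) = (2^-1 : R)%:C by rewrite fmorphV rmorphD.
by rewrite !CI_real -rmorphM => /complexI.
Qed.

End Complete.

(** * Orthogonality to the complete system *)

Section Orthogonality.
Variable R : realType.
Local Notation C := R[i].
Local Notation nc := (@Normc.normc R).
Local Notation tau := (2 * pi : R).

Lemma potential_bd (f : R -> C) (M : R) : Cmeas f -> (forall x, nc (f x) <= M) ->
  potential (fun x => oo 0 pi x * f x).
Proof.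
move=> mf hf; have M0 : 0 <= M := le_trans (nc_ge0 _) (hf 0).
have m : Cmeas (fun x => oo 0 pi x * f x) by apply: CmeasM; [exact: Cmeas_oo|exact: mf].
split; [exact: m| |by move=> x /negPf h; rewrite /oo h mul0r].
apply: (Rable_dom _ (RableZ (M ^+ 2) (Rable_oo 0 pi))).
  by apply: measurable_funX; exact: measurable_nc.
move=> x; rewrite ger0_norm ?sqr_ge0 // ncM nc_oo exprMn.
case: (_ && _) => /=; last by rewrite expr0n mul0r mulr0.
by rewrite expr1n mul1r mulr1 !expr2; apply: ler_pM; rewrite ?nc_ge0 ?hf.
Qed.

Lemma potential_eq (P P' : R -> C) : P =1 P' -> potential P -> potential P'.
Proof. by move=> /funext ->. Qed.

Lemma potentialZ (c : C) (P : R -> C) : potential P -> potential (fun x => c * P x).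
Proof.
move=> [mP iP sP]; split.
- by apply: CmeasM; [exact: Cmeas_cst|exact: mP].
- by apply: Rable_eq (RableZ (nc c ^+ 2) iP) => x; rewrite ncM exprMn.
- by move=> x hx; rewrite (sP x hx) mulr0.
Qed.

Lemma potential_affine (c d : R) (P : R -> C) : c != 0 -> potential P ->
  potential (fun x => oo 0 pi x * P (c * x + d)).
Proof.
move=> c0 [mP iP sP].
have m : Cmeas (fun x => oo 0 pi x * P (c * x + d)).
  apply: CmeasM; first exact: Cmeas_oo.
  by apply: (Cmeas_comp mP); exact: measurable_affine.
split; [exact: m| |by move=> x /negPf h; rewrite /oo h mul0r].
apply: (Rable_dom _ (Rable_affine d c0 iP)).
  by apply: measurable_funX; exact: measurable_nc.
move=> x; rewrite ger0_norm ?sqr_ge0 // ncM nc_oo exprMn.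
by case: (_ && _) => /=; rewrite ?expr1n ?mul1r // expr0n mul0r sqr_ge0.
Qed.

Lemma dens0_potential (Q : R -> C) b B : potential Q -> kernel_of Q b B -> potential (dens0 Q b).
Proof.
move=> pQ [mb hb _]; have cQ := potential_Cable pQ.
have mF : Cmeas (fun y : R => PJ Q b (pi - y) y).
  apply: (Cmeas_comp (g := fun y : R => (pi - y, y)) (PJ_meas cQ mb)).
  apply: measurable_fun_pair; last exact: measurable_id.
  by apply: measurable_funB; [exact: measurable_cst|exact: measurable_id].
have pF := potential_bd mF (fun y => PJ_le cQ mb hb (pi - y) y).
apply: potential_eq (potentialB pQ pF) => y.
rewrite /dens0 /dens mulrBr; congr (_ - _).
have [_ _ sQ] := pQ; rewrite /oo; have [h|h] := boolP ((0 < y) && (y < pi)); first by rewrite mul1r.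
by rewrite mul0r sQ.
Qed.

Lemma Tc_lin2 j (A B : C -> C) (n k z : C) : ent A -> ent B ->
  Tc j (fun w => A w * n + B w * k) z = Tc j A z * n + Tc j B z * k.
Proof.
move=> eA eB.
have c1 : Cable (fun t => oo 0 tau t * (A (z + circ t) * circ (- t) ^+ j)).
  by apply: Cable_cont => t; apply: Rcont_Tc; exact: ent_cont.
have c2 : Cable (fun t => oo 0 tau t * (B (z + circ t) * circ (- t) ^+ j)).
  by apply: Cable_cont => t; apply: Rcont_Tc; exact: ent_cont.
rewrite /Tc -!mulrA -mulrDr; congr (_ * _).
rewrite /Iv [CI _ * n]mulrC [CI _ * k]mulrC -(CIZ n c1) -(CIZ k c2) -(CID (CableZ n c1) (CableZ k c2)).
apply: eq_CI => t; have alg (o a b x c d : C) : o * ((a * x + b * c) * d) = x * (o * (a * d)) + c * (o * (b * d)) by ring.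
exact: alg.
Qed.

(** The conditions under which Taylor coefficients can be exchanged with integrals over
    the parameter t. *)
Definition entire_family (phi : R -> C -> C) := [/\ forall t, ent (phi t),
  forall z, Cmeas (fun p : R * R => phi p.2 (z + circ p.1)) &
  forall r, exists M, forall t w, 0 < t -> t < pi -> nc w <= r -> nc (phi t w) <= M].

Lemma entire_family_s : entire_family (@s_fun R).
Proof.
split; first exact: ent_s_fun.
  move=> z; apply: Cmeas_s_fun; first exact: measurable_snd.
  have mz : Cmeas (fun t : R => z + circ t) by apply: Rcont_meas => t; exact: Rcont_addcirc.
  by apply: (Cmeas_comp mz); exact: measurable_fst.
move=> r; exists ((1 + `|r|) * expR ((1 + `|r|) * pi)) => t w t0 tp hw.
have htp : `|t| <= pi by rewrite gtr0_norm // ltW.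
have hr : nc w <= `|r| := le_trans hw (ler_norm r).
apply: le_trans (s_fun_le w htp) _; apply: ler_pM.
- by rewrite addr_ge0 // nc_ge0.
- exact: expR_ge0.
- by rewrite lerD2l.
- by rewrite ler_expR; apply: ler_wpM2r; [exact: pi_ge0|rewrite lerD2l].
Qed.

Lemma entire_family_c : entire_family (@c_fun R).
Proof.
split; first exact: ent_c_fun.
  move=> z; apply: Cmeas_c_fun; first exact: measurable_snd.
  have mz : Cmeas (fun t : R => z + circ t) by apply: Rcont_meas => t; exact: Rcont_addcirc.
  by apply: (Cmeas_comp mz); exact: measurable_fst.
move=> r; exists (expR ((1 + `|r|) * pi)) => t w t0 tp hw.
have htp : `|t| <= pi by rewrite gtr0_norm // ltW.
have hr : nc w <= `|r| := le_trans hw (ler_norm r).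
apply: le_trans (c_fun_le w htp) _.
by rewrite ler_expR; apply: ler_wpM2r; [exact: pi_ge0|rewrite lerD2l].
Qed.

Lemma entire_familyM f (phi : R -> C -> C) : ent f -> entire_family phi -> entire_family (fun t w => f w * phi t w).
Proof.
move=> ef [e m bd]; split.
- by move=> t z; apply: derivableKM; [exact: ef|exact: e].
- move=> z; apply: CmeasM; last exact: m.
  have mz : Cmeas (fun t : R => f (z + circ t)).
    by apply: Rcont_meas => t; apply: Rcont_comp; [exact: ent_cont|exact: Rcont_addcirc].
  by apply: (Cmeas_comp mz); exact: measurable_fst.
move=> r; have [M hM] := bd r; have [M' M'0 hM'] := locally_bounded r (ent_cont ef).
exists (M' * M) => t w t0 tp hw; rewrite ncM; apply: ler_pM; [exact: nc_ge0|exact: nc_ge0|exact: hM'|exact: hM].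
Qed.

Lemma entire_family_Tc j (phi : R -> C -> C) z : entire_family phi ->
  Cmeas (fun t => Tc j (phi t) z) /\
  exists M, forall t, 0 < t -> t < pi -> nc (Tc j (phi t) z) <= M.
Proof.
move=> [e m bd]; split.
  apply: CmeasM; first exact: Cmeas_cst.
  suff mF : Cmeas (fun p : R * R => oo 0 tau p.2 * (phi p.1 (z + circ p.2) * circ (- p.2) ^+ j)).
    exact: (Cmeas_CI mF).
  apply: CmeasM; first by apply: (Cmeas_comp (Cmeas_oo 0 tau)); exact: measurable_snd.
  apply: CmeasM.
    by apply: (Cmeas_comp (g := fun p : R * R => (p.2, p.1)) (m z)); exact: measurable_swap.
  have mc : Cmeas (fun t : R => circ (- t) ^+ j : C) by apply: Rcont_meas => t; exact: Rcont_circN.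
  by apply: (Cmeas_comp mc); exact: measurable_snd.
have [M hM] := bd (nc z + 1); exists M => t t0 tp.
by apply: Tc_le => [|w hw]; [exact: ent_cont|exact: hM].
Qed.

Lemma entire_family_Tc_CI j (phi psi : R -> C -> C) (N K : R -> C) z : entire_family phi -> entire_family psi ->
  potential N -> potential K ->
  Tc j (fun w => CI (fun t => phi t w * N t + psi t w * K t)) z =
  CI (fun t => Tc j (phi t) z * N t + Tc j (psi t) z * K t).
Proof.
move=> [e1 m1 b1] [e2 m2 b2] pN pK.
have [M1 h1] := b1 (nc z + 1); have [M2 h2] := b2 (nc z + 1).
have [mN _ sN] := pN; have [mK _ sK] := pK.
have cN := Cable_nc (potential_Cable pN); have cK := Cable_nc (potential_Cable pK).
rewrite (@Tc_CI R j (fun t w => phi t w * N t + psi t w * K t) z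
    (fun t => `|M1| * nc (N t) + `|M2| * nc (K t))).
- by apply: eq_CI => t; exact: Tc_lin2.
- apply: CmeasD; apply: CmeasM; [exact: m1| |exact: m2|].
    by apply: (Cmeas_comp mN); exact: measurable_snd.
  by apply: (Cmeas_comp mK); exact: measurable_snd.
- by apply: RableD; exact: RableZ.
- move=> t y; have hw : nc (z + circ t) <= nc z + 1.
    by apply: le_trans (ncD _ _) _; rewrite nc_circ.
  have [/andP[y0 yp]|hy] := boolP ((0 < y) && (y < pi)); last first.
    by rewrite (sN y hy) (sK y hy) !mulr0 addr0 nc0 !mulr0 addr0.
  apply: le_trans (ncD _ _) _; rewrite !ncM; apply: lerD; apply: ler_wpM2r; rewrite ?nc_ge0 //.
    exact: le_trans (h1 y _ y0 yp hw) (ler_norm _).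
  exact: le_trans (h2 y _ y0 yp hw) (ler_norm _).
Qed.

Section Uniqueness.
Variables (f1 f2 : C -> C) (q qt : R -> C) (S S1 St St1 : R -> C -> C) (lam lamt : nat -> C).
Hypotheses (ef1 : ent f1) (ef2 : ent f2) (Lq : L2 q) (Lqt : L2 qt)
  (HS : is_S q S S1) (HSt : is_S qt St St1)
  (lam0 : lam 0%N = 0) (lamc : numbered_consecutively lam)
  (sub : subspectrum (Delta f1 f2 S S1) lam) (subt : subspectrum (Delta f1 f2 St St1) lamt)
  (vc : completeH (vseq f1 f2 lam))
  (lam_eq : forall n : nat, (1 <= n)%N -> lam n = lamt n).
Let Q (x : R) : C := oo 0 pi x * q x.
Let Qt (x : R) : C := oo 0 pi x * qt x.
Hypothesis GamE : Gam Q pi = Gam Qt pi.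
Variables (b bt : R * R -> C) (B Bt : R).
Hypotheses (hk : kernel_of Q b B) (hkt : kernel_of Qt bt Bt).

Let dz (y : R) : C := dens0 Q b y - dens0 Qt bt y.
Let pQ : potential Q. Proof. exact: L2_potential. Qed.
Let pQt : potential Qt. Proof. exact: L2_potential. Qed.
Let pz : potential dz. Proof. by apply: potentialB; [exact: dens0_potential hk|exact: dens0_potential hkt]. Qed.

Let D (l : C) : C := Delta f1 f2 S S1 l - Delta f1 f2 St St1 l.
Let eDelta T T1 : ent (T pi) -> ent (T1 pi) -> ent (Delta f1 f2 T T1).
Proof.
by move=> e e1 z; apply: derivableKD; apply: derivableKM.
Qed.
Let eD1 : ent (Delta f1 f2 S S1). Proof. by have [e e1] := ent_S Lq HS; exact: eDelta. Qed.
Let eD2 : ent (Delta f1 f2 St St1). Proof. by have [e e1] := ent_S Lqt HSt; exact: eDelta. Qed.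
Let eD : ent D. Proof. by move=> z; apply: derivableKB; [exact: eD1|exact: eD2]. Qed.

Let zp (t : R) : C := oo 0 pi t * dz (2^-1 * t + pi / 2).
Let zm (t : R) : C := oo 0 pi t * dz (- 2^-1 * t + pi / 2).
Let pzp : potential zp. Proof. by apply: potential_affine => //; rewrite invr_eq0 pnatr_eq0. Qed.
Let pzm : potential zm. Proof. by apply: potential_affine => //; rewrite oppr_eq0 invr_eq0 pnatr_eq0. Qed.
(** Up to a factor, N and K are the odd and the even part of dz with respect to the
    midpoint of (0, pi). *)
Let N (t : R) : C := 4^-1 * (zp t - zm t).
Let K (t : R) : C := 4^-1 * (zm t + zp t).
Let pN : potential N. Proof. by apply: potentialZ; exact: potentialB. Qed.
Let pK : potential K. Proof. by apply: potentialZ; exact: potentialD. Qed.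

Let fold_trig (phi : R -> C -> C) (sg l : C) : (forall t, phi (- t) l = sg * phi t l) ->
  Cable (fun y => phi (fold_pi y) l * dz y) ->
  CI (fun y => phi (fold_pi y) l * dz y) = 2^-1 * CI (fun t => phi t l * (zm t + sg * zp t)).
Proof.
move=> hphi cg; have [_ _ sz] := pz; rewrite fold_CI //; last by move=> x hx; rewrite (sz x hx) mulr0.
congr (_ * _); apply: eq_CI => t.
have [/andP[t0 tp]|ht] := boolP ((0 < t) && (t < pi)); last first.
  have oz : oo 0 pi t = 0 :> C by rewrite /oo (negPf ht).
  by rewrite /zm /zp oz !mul0r mulr0 addr0 mulr0.
have o1 : oo 0 pi t = 1 :> C by rewrite /oo t0 tp.
have -> : (pi - t) / 2 = - (2^-1) * t + pi / 2 by lra.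
have -> : (pi + t) / 2 = 2^-1 * t + pi / 2 by lra.
have -> : fold_pi (- (2^-1) * t + pi / 2) = t.
  rewrite /fold_pi; have -> : (0 < - 2^-1 * t + pi / 2) = true by apply/idP; lra.
  by have -> : (- 2^-1 * t + pi / 2 < pi) = true by [apply/idP; lra]; rewrite mul1r; lra.
have -> : fold_pi (2^-1 * t + pi / 2) = - t.
  rewrite /fold_pi; have -> : (0 < 2^-1 * t + pi / 2) = true by apply/idP; lra.
  by have -> : (2^-1 * t + pi / 2 < pi) = true by [apply/idP; lra]; rewrite mul1r; lra.
rewrite hphi /zm /zp o1.
have alg (p g x y : C) : 1 * (p * x + g * p * y) = p * (1 * x + g * (1 * y)) by ring.
exact: alg.
Qed.

Let trig_Cable (phi : R -> C -> C) (x : R -> R) (P : R -> C) (l : C) (M : R) :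
  Cmeas (fun y => phi (x y) l) -> (forall y, nc (phi (x y) l) <= M) -> potential P ->
  Cable (fun y => phi (x y) l * P y).
Proof. by move=> m h pP; apply: (CableM m h); exact: potential_Cable. Qed.

Let s_Cable (P : R -> C) l : potential P -> Cable (fun y => s_fun (fold_pi y) l * P y).
Proof.
apply: trig_Cable; last by move=> y; exact: s_fun_le (fold_le y).
by apply: Cmeas_s_fun; [exact: measurable_fold|exact: Cmeas_cst].
Qed.
Let c_Cable (P : R -> C) l : potential P -> Cable (fun y => c_fun (fold_pi y) l * P y).
Proof.
apply: trig_Cable; last by move=> y; exact: c_fun_le (fold_le y).
by apply: Cmeas_c_fun; [exact: measurable_fold|exact: Cmeas_cst].
Qed.
Let in_Cable (phi : R -> C -> C) (P : R -> C) l : Cmeas (fun t => phi t l) ->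
  (exists M, forall t, 0 < t -> t < pi -> nc (phi t l) <= M) -> potential P ->
  Cable (fun t => phi t l * P t).
Proof.
move=> m [M h] pP; have [mP _ sP] := pP.
apply: (Cable_dom _ (RableZ `|M| (Cable_nc (potential_Cable pP)))); first exact: CmeasM.
move=> t; have [/andP[t0 tp]|ht] := boolP ((0 < t) && (t < pi)); last first.
  by rewrite (sP t ht) mulr0 nc0 mulr0.
rewrite ncM; apply: ler_wpM2r; first exact: nc_ge0.
exact: le_trans (h t t0 tp) (ler_norm _).
Qed.
Let s_Cable' (P : R -> C) (l : C) : potential P -> Cable (fun t => s_fun t l * P t).
Proof.
apply: in_Cable; first by apply: Cmeas_s_fun; [exact: measurable_id|exact: Cmeas_cst].
have [_ _ bd] := entire_family_s; have [M hM] := bd (nc l); exists M => t t0 tp; exact: hM.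
Qed.
Let c_Cable' (P : R -> C) (l : C) : potential P -> Cable (fun t => c_fun t l * P t).
Proof.
apply: in_Cable; first by apply: Cmeas_c_fun; [exact: measurable_id|exact: Cmeas_cst].
have [_ _ bd] := entire_family_c; have [M hM] := bd (nc l); exists M => t t0 tp; exact: hM.
Qed.

(** Only the integrals against the densities survive in the difference, as the means
    agree. *)
Lemma lam_dS l : l * (S pi l - St pi l) = CI (fun t => c_fun t l * K t).
Proof.
have p1 := dens0_potential pQ hk; have p2 := dens0_potential pQt hkt.
rewrite mulrBr (is_S_char Lq HS l hk).1 (is_S_char Lqt HSt l hkt).1 /PsiS -/Q -/Qt GamE.
have alg (u v x y : C) : u - v + 2^-1 * x - (u - v + 2^-1 * y) = 2^-1 * (x - y) by ring.
rewrite alg -(CIB (c_Cable l p1) (c_Cable l p2)).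
transitivity (2^-1 * CI (fun y => c_fun (fold_pi y) l * dz y)).
  by congr (_ * _); apply: eq_CI => y; rewrite /dz mulrBr.
rewrite (fold_trig (sg := 1)); [|by move=> t; rewrite c_funN mul1r|exact: c_Cable].
rewrite mulrA -(CIZ _ _); last first.
  by apply: c_Cable'; apply: potentialD; [exact: pzm|apply: potentialZ; exact: pzp].
apply: eq_CI => t; rewrite /K.
have h4 : (2^-1 * 2^-1 : C) = 4^-1 by rewrite -invfM -natrM.
rewrite h4 mul1r; exact: mulrCA.
Qed.

Lemma lam_dS1 l : l * (S1 pi l - St1 pi l) = CI (fun t => s_fun t l * N t).
Proof.
have p1 := dens0_potential pQ hk; have p2 := dens0_potential pQt hkt.
rewrite mulrBr (is_S_char Lq HS l hk).2 (is_S_char Lqt HSt l hkt).2 /PsiS1 -/Q -/Qt GamE.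
have alg (u v x y : C) : u + v - 2^-1 * x - (u + v - 2^-1 * y) = - 2^-1 * (x - y) by ring.
rewrite alg -(CIB (s_Cable l p1) (s_Cable l p2)).
transitivity (- 2^-1 * CI (fun y => s_fun (fold_pi y) l * dz y)).
  by congr (_ * _); apply: eq_CI => y; rewrite /dz mulrBr.
rewrite (fold_trig (sg := -1)); [|by move=> t; rewrite s_funN mulN1r|exact: s_Cable].
rewrite mulrA -(CIZ _ _); last first.
  by apply: s_Cable'; apply: potentialD; [exact: pzm|apply: potentialZ; exact: pzp].
apply: eq_CI => t; rewrite /N.
have h4 : (2^-1 * 2^-1 : C) = 4^-1 by rewrite -invfM -natrM.
rewrite mulNr h4 mulN1r.
have alg2 (c s x y : C) : - c * (s * (x - y)) = s * (c * (y - x)) by ring.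
exact: alg2.
Qed.

(** The right-hand side is the pairing of (N, K) with the vectors that generate the
    system v k. *)
Lemma lam_D l : l * D l = CI (fun t => f1 l * s_fun t l * N t + f2 l * c_fun t l * K t).
Proof.
rewrite /D /Delta.
have alg (w g1 g2 x x' y y' : C) : w * (g1 * x + g2 * y - (g1 * x' + g2 * y')) =
   g1 * (w * (x - x')) + g2 * (w * (y - y')) by ring.
rewrite alg lam_dS lam_dS1 -(CIZ (f1 l) (s_Cable' l pN)) -(CIZ (f2 l) (c_Cable' l pK)).
rewrite -(CID (CableZ _ (s_Cable' l pN)) (CableZ _ (c_Cable' l pK))).
by apply: eq_CI => t; rewrite !mulrA.
Qed.

Let n1 := entire_familyM ef1 entire_family_s.
Let n2 := entire_familyM ef2 entire_family_c.

Lemma vseqE k t : (0 < k)%N -> vseq f1 f2 lam k t =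
  (Tc (k - first_index lam k) (fun w => f1 w * s_fun t w) (lam (first_index lam k)),
   Tc (k - first_index lam k) (fun w => f2 w * c_fun t w) (lam (first_index lam k))).
Proof.
case: k => // k _; have [e1 _ _] := n1; have [e2 _ _] := n2.
by rewrite -(taylor_coefE _ _ (e1 t)) -(taylor_coefE _ _ (e2 t)).
Qed.

Lemma first_indexP k : (first_index lam k <= k)%N /\ lam (first_index lam k) = lam k.
Proof.
have hin : lam k \in mkseq lam k.+1 by apply: map_f; rewrite mem_iota /= add0n ltnS leqnn.
have h1 : (first_index lam k < k.+1)%N by rewrite /first_index -{2}(size_mkseq lam k.+1) index_mem.
split; first by [].
have := nth_index 0 hin; rewrite -/(first_index lam k) nth_mkseq //.
Qed.

Lemma D_zero (z : C) (m c : nat) : (0 < m)%N -> (forall i, (m <= i < m + c)%N -> lam i = z) ->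
  forall j, (j < c)%N -> Tc j D z = 0.
Proof.
move=> m0 hi j jc; rewrite (TcB _ _ (ent_cont eD1) (ent_cont eD2)).
rewrite -(taylor_coefE _ _ eD1) -(taylor_coefE _ _ eD2).
rewrite (sub (z := z) (s := iota m c)) ?(subt (z := z) (s := iota m c)) ?subrr ?iota_uniq ?size_iota //.
  move=> i; rewrite mem_iota => hm; have i0 : (0 < i)%N by case/andP: hm => h _; exact: leq_trans m0 h.
  by split => //; rewrite -lam_eq // hi.
move=> i; rewrite mem_iota => hm; have i0 : (0 < i)%N by case/andP: hm => h _; exact: leq_trans m0 h.
by split => //; exact: hi.
Qed.

(** The pairing with the k-th vector is a Taylor coefficient of l * D l at lam k. The
    order of vanishing of D is at least the multiplicity in the subspectrum, and the
    factor l accounts for lam 0. *)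
Lemma orthogonal k : CI (fun t => (vseq f1 f2 lam k t).1 * N t + (vseq f1 f2 lam k t).2 * K t) = 0.
Proof.
case: (posnP k) => [->|k0].
  transitivity (CI (fun t => c_fun t 0 * K t)).
    apply: eq_CI => t; rewrite /= mul0r add0r; congr (_ * _).
    by rewrite /c_fun /ccos sqrtc0 mul0r mulr0 oppr0 cexp0 -[1 + 1]/(2%:R) divff // pnatr_eq0.
  by rewrite -lam_dS mul0r.
set n := first_index lam k; have [nk nz] := first_indexP k; rewrite -/n in nk nz.
have -> : CI (fun t => (vseq f1 f2 lam k t).1 * N t + (vseq f1 f2 lam k t).2 * K t) =
    Tc (k - n) (fun w => w * D w) (lam n).
  have -> : (fun w => w * D w) = (fun w => CI (fun t => f1 w * s_fun t w * N t + f2 w * c_fun t w * K t)).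
    by apply/funext => w; exact: lam_D.
  rewrite (entire_family_Tc_CI _ _ n1 n2 pN pK); apply: eq_CI => t.
  by rewrite (vseqE t k0).
have idx i : (n <= i <= k)%N -> lam i = lam n by move=> hi; exact: (lamc hi nz).
have eW : ent (fun w => w * D w) by move=> z; apply: derivableKM; [exact: derivableK_id|exact: eD].
case En : n => [|n'].
  (* the value 0: lam 0 is not a member of the subspectrum, the factor w replaces it *)
  rewrite lam0 subn0 -(prednK k0) (Tc_mulz _ _ (ent_cont eD)) mul0r add0r.
  apply: (@D_zero 0 1 k) => //; last by rewrite prednK.
  move=> i /andP[i0 ik]; rewrite -lam0 -En; apply: idx.
  by rewrite En /= -ltnS -add1n.
have h := @D_zero (lam n) n (k - n).+1; rewrite -En.
have {}h j : (j < (k - n).+1)%N -> Tc j D (lam n) = 0.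
  apply: h; first by rewrite En.
  move=> i /andP[i1 i2]; apply: idx; rewrite i1 /=; move: i2; rewrite addnS ltnS subnKC //.
case Em : (k - n)%N => [|m].
  by rewrite -(cauchy0 _ eW) (cauchy0 _ eD) h ?mulr0.
by rewrite (Tc_mulz _ _ (ent_cont eD)) !h ?mulr0 ?addr0 // Em // ltnS leqnSn.
Qed.

(** [complete_orth] together with the parallelogram identity, which returns from N and K
    to the difference of the densities. *)
Theorem density_diff_eq0 : RI (fun y => nc (dz y) ^+ 2) = 0.
Proof.
have [mz iz sz] := pz.
have e0 : RI (fun t => nc (N t) ^+ 2 + nc (K t) ^+ 2) = 0.
  apply: (complete_orth vc _ _ pN pK orthogonal).
    move=> k; case: (posnP k) => [->|k0]; first by split; exact: Cmeas_cst.
    split.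
      apply: Cmeas_eq (entire_family_Tc (k - first_index lam k) (lam (first_index lam k)) n1).1 => t.
      by rewrite (vseqE t k0).
    apply: Cmeas_eq (entire_family_Tc (k - first_index lam k) (lam (first_index lam k)) n2).1 => t.
    by rewrite (vseqE t k0).
  move=> k; case: (posnP k) => [->|k0].
    exists 1 => t _ _; change (nc 0 <= 1 /\ nc 1 <= 1); rewrite nc0 nc1.
    by split; [exact: ler01|exact: lexx].
  have [_ [M1 h1]] := entire_family_Tc (k - first_index lam k) (lam (first_index lam k)) n1.
  have [_ [M2 h2]] := entire_family_Tc (k - first_index lam k) (lam (first_index lam k)) n2.
  exists (Num.max M1 M2) => t t0 tp; rewrite (vseqE t k0) /= !le_max.
  by rewrite (h1 t t0 tp) (h2 t t0 tp) orbT.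
have sz2 x : ~~ ((0 < x) && (x < pi)) -> nc (dz x) ^+ 2 = 0.
  by move=> hx; rewrite (sz x hx) nc0 expr0n.
rewrite (fold_RI iz sz2).
have [iN iK] : Rable (fun t => nc (N t) ^+ 2) /\ Rable (fun t => nc (K t) ^+ 2).
  by case: pN => _ ? _; case: pK.
rewrite (_ : (fun t => _) = fun t => 8 * (nc (N t) ^+ 2 + nc (K t) ^+ 2)).
  by rewrite (RIZ 8 (RableD iN iK)) e0 !mulr0.
apply/funext => t; rewrite /N /K !ncM !exprMn ncV nc_nat.
have [/andP[t0 tp]|ht] := boolP ((0 < t) && (t < pi)); last first.
  have oz : oo 0 pi t = 0 :> C by rewrite /oo (negPf ht).
  by rewrite /zm /zp oz !mul0r subr0 addr0 nc0 expr0n /= !mulr0 addr0 mulr0.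
have o1 : oo 0 pi t = 1 :> C by rewrite /oo t0 tp.
have -> : (pi - t) / 2 = - (2^-1) * t + pi / 2 by lra.
have -> : (pi + t) / 2 = 2^-1 * t + pi / 2 by lra.
rewrite /zm /zp o1 !mul1r !nc_sqr.
move: (dz _) (dz _) => [x y] [x' y']; rewrite /sqnorm /=.
by field.
Qed.

End Uniqueness.
End Orthogonality.

(** * Recovery of the potential from the density *)

Section Recovery.
Variable R : realType.
Local Notation C := R[i].
Local Notation nc := (@Normc.normc R).
Local Notation mu := (@lebesgue_measure R).

(** The mirror image of [weight], for integration from pi downwards. *)
Lemma weight_back (g : R -> R) (th : R) : measurable_fun setT g -> (forall x, 0 <= g x) ->
  (forall x, ~~ ((0 < x) && (x < pi)) -> g x = 0) -> Rable (fun x => g x ^+ 2) -> 0 < th ->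
  exists2 m : R, 0 < m & forall a : R,
    Rable (fun t => (a < t)%R%:R * (g t * expR (- (m * t)))) /\
    RI (fun t => (a < t)%R%:R * (g t * expR (- (m * t)))) <= th * expR (- (m * a)).
Proof.
move=> mg g0 sg ig th0.
have n1 : -1 != 0 :> R by rewrite oppr_eq0 oner_neq0.
have m1 : measurable_fun setT (fun x : R => g (-1 * x + pi)).
  by apply: (measurableT_comp mg); exact: measurable_affine.
have s1 (x : R) : ~~ ((0 < x) && (x < pi)) -> g (-1 * x + pi) = 0.
  move=> hx; apply: sg; apply: contra hx => /andP[h1 h2]; apply/andP; split; lra.
have [m m0 hm] := weight m1 (fun x => g0 _) s1 (Rable_affine pi n1 ig) th0.
exists m => // a; have [h1 h2] := hm (pi - a).
pose k (t : R) := (t < pi - a)%R%:R * (g (-1 * t + pi) * expR (m * t)).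
have e (t : R) : (a < t)%R%:R * (g t * expR (- (m * t))) = expR (- (m * pi)) * k (-1 * t + pi).
  rewrite /k; have -> : (-1 * t + pi < pi - a) = (a < t) by apply/idP/idP; lra.
  have -> : -1 * (-1 * t + pi) + pi = t by ring.
  have -> : expR (- (m * t)) = expR (- (m * pi)) * expR (m * (-1 * t + pi)).
    by rewrite -expRD; congr expR; ring.
  by ring.
have hk := Rable_affine pi n1 h1.
split; first by apply: Rable_eq (RableZ (expR (- (m * pi))) hk) => t; rewrite e.
rewrite (_ : (fun t => _) = fun t => expR (- (m * pi)) * k (-1 * t + pi)); last by apply/funext.
rewrite RIZ; last exact: hk.
have eR : RI k = RI (fun t => k (-1 * t + pi)).
  by rewrite (RI_affine pi n1 h1) normrN1 mul1r.
rewrite -eR; apply: le_trans (ler_wpM2l (expR_ge0 _) h2) _.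
rewrite mulrCA; apply: ler_wpM2l; first exact: ltW.
by rewrite -expRD ler_expR; lra.
Qed.

Lemma RI_sqr_ae0 (f : R -> C) : Cmeas f -> Rable (fun x => nc (f x) ^+ 2) ->
  RI (fun x => nc (f x) ^+ 2) = 0 -> {ae mu, forall x, f x = 0}.
Proof.
move=> mf rf e.
have m2 : measurable_fun setT (fun x => (nc (f x) ^+ 2)%:E).
  by apply/measurable_EFinP; exact: Rable_meas.
have i0 : (\int[mu]_x `|(nc (f x) ^+ 2)%:E|)%E = 0%E.
  rewrite (_ : (fun x => _) = fun x => (nc (f x) ^+ 2)%:E); first by rewrite -(RI_fin rf) e.
  by apply/funext => x; rewrite gee0_abs // lee_fin sqr_ge0.
have := (ae_eq_integral_abs mu measurableT m2).1 i0.
apply: (@filterS _ _ (ae_filter_ringOfSetsType mu)) => x /(_ I) [] /eqP.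
by rewrite expf_eq0 /= => /eqP; exact: nc_eq0.
Qed.

Variables (Q Qt : R -> C) (b bt : R * R -> C) (B Bt : R).
Hypotheses (pQ : potential Q) (pQt : potential Qt)
  (hk : kernel_of Q b B) (hkt : kernel_of Qt bt Bt)
  (anti : forall x s, b (x, x - s) = - b (x, s))
  (antit : forall x s, bt (x, x - s) = - bt (x, s))
  (GamE : Gam Q pi = Gam Qt pi)
  (hz : RI (fun y => nc (dens0 Q b y - dens0 Qt bt y) ^+ 2) = 0).

Let r (y : R) : C := Q y - Qt y.
Let db (p : R * R) : C := b p - bt p.
(** A bounded representative of r, see [r_rs]. *)
Let rs (y : R) : C := oo 0 pi y * (PJ Q b (pi - y) y - PJ Qt bt (pi - y) y).
(** The integrand Q b - Qt bt, written linearly in the unknowns r and db. *)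
Let gs (p : R * R) : C := rs p.1 * b p + Qt p.1 * db p.
Let G (y a : R) : C := CI (fun u => oo a pi u * gs (u, y)).

Let cQ : Cable Q. Proof. exact: potential_Cable. Qed.
Let cQt : Cable Qt. Proof. exact: potential_Cable. Qed.
Let mb : Cmeas b. Proof. by case: hk. Qed.
Let mbt : Cmeas bt. Proof. by case: hkt. Qed.
Let hb p : nc (b p) <= B. Proof. by case: hk. Qed.
Let hbt p : nc (bt p) <= Bt. Proof. by case: hkt. Qed.
Let B0 : 0 <= B. Proof. exact: le_trans (nc_ge0 _) (hb (0, 0)). Qed.
Let Bt0 : 0 <= Bt. Proof. exact: le_trans (nc_ge0 _) (hbt (0, 0)). Qed.
Let pr : potential r. Proof. exact: potentialB. Qed.
Let cr : Cable r. Proof. exact: potential_Cable. Qed.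
Let mr : Cmeas r. Proof. exact: Cable_meas. Qed.
Let mdb : Cmeas db. Proof. exact: CmeasB. Qed.
Let hdb p : nc (db p) <= B + Bt. Proof. by apply: le_trans (ncB _ _) (lerD (hb p) (hbt p)). Qed.

Let mPJd (P : R -> C) (k : R * R -> C) : Cable P -> Cmeas k -> Cmeas (fun y : R => PJ P k (pi - y) y).
Proof.
move=> cP mk; apply: (Cmeas_comp (g := fun y : R => (pi - y, y)) (PJ_meas cP mk)).
apply: measurable_fun_pair; last exact: measurable_id.
by apply: measurable_funB; [exact: measurable_cst|exact: measurable_id].
Qed.
Let mrs : Cmeas rs.
Proof. by apply: CmeasM; [exact: Cmeas_oo|apply: CmeasB; exact: mPJd]. Qed.
Let MR := B * RI (fun x => nc (Q x)) + Bt * RI (fun x => nc (Qt x)).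
Let MR0 : 0 <= MR.
Proof. by apply: addr_ge0; apply: mulr_ge0 => //; apply: RI_ge0 => x; exact: nc_ge0. Qed.
Let hrs y : nc (rs y) <= MR.
Proof.
rewrite /rs /oo; have [hy|hy] := boolP ((0 < y) && (y < pi)); last by rewrite mul0r nc0.
rewrite mul1r; apply: le_trans (ncB _ _) _; apply: lerD.
  exact: (PJ_le cQ mb hb).
exact: (PJ_le cQt mbt hbt).
Qed.
Let srs y : ~~ ((0 < y) && (y < pi)) -> rs y = 0.
Proof. by move=> /negPf h; rewrite /rs /oo h mul0r. Qed.

Let r_rs : {ae mu, forall y, r y = rs y}.
Proof.
have pz : potential (fun y => dens0 Q b y - dens0 Qt bt y).
  by apply: potentialB; [exact: dens0_potential hk|exact: dens0_potential hkt].
have [mz iz _] := pz.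
apply: (@filterS _ _ (ae_filter_ringOfSetsType mu) _ _ _ (RI_sqr_ae0 mz iz hz)) => y e.
have [_ _ sr] := pr.
have [hy|hy] := boolP ((0 < y) && (y < pi)); last by rewrite (sr y hy) (srs hy).
apply/eqP; rewrite -subr_eq0; apply/eqP; rewrite -[RHS]e.
rewrite /rs /r /dens0 /dens /oo hy !mul1r.
have alg (u v p w : C) : u - v - (p - w) = u - p - (v - w) by ring.
exact: alg.
Qed.

Let mgs : Cmeas gs.
Proof.
apply: CmeasD; apply: CmeasM; [|exact: mb| |exact: mdb].
  by apply: (Cmeas_comp mrs); exact: measurable_fst.
by apply: (Cmeas_comp (Cable_meas cQt)); exact: measurable_fst.
Qed.
Let hh (u : R) : R := MR * B * ((0 < u) && (u < pi))%:R + (B + Bt) * nc (Qt u).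
Let ihh : Rable hh.
Proof. by apply: RableD; apply: RableZ; [exact: Rable_oo|exact: Cable_nc]. Qed.
Let hgs u y : nc (gs (u, y)) <= hh u.
Proof.
have -> : gs (u, y) = rs u * b (u, y) + Qt u * db (u, y) by [].
apply: le_trans (ncD _ _) _; rewrite [nc (rs u * _)]ncM [nc (Qt u * _)]ncM; apply: lerD; last first.
  by rewrite mulrC; apply: ler_wpM2r; [exact: nc_ge0|exact: hdb].
have [hu|hu] := boolP ((0 < u) && (u < pi)); last by rewrite (srs hu) nc0 mul0r mulr0.
by rewrite mulr1; apply: ler_pM; [exact: nc_ge0|exact: nc_ge0|exact: hrs|exact: hb].
Qed.
Let gs_Cable a c y : Cable (fun u => oo a c u * gs (u, y)).
Proof.
apply: (CableM (Cmeas_oo a c) (fun x => nc_oo_le1 a c x)).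
exact: (Cable_dom (Cmeas_pair1 y mgs) ihh (fun u => hgs u y)).
Qed.
Let gs_anti u y : gs (u, u - y) = - gs (u, y).
Proof.
rewrite /gs /db /= anti antit.
have alg (x z p q : C) : x * - p + z * (- p - - q) = - (x * p + z * (p - q)) by ring.
exact: alg.
Qed.

Lemma PJ_diff w y : PJ Q b w y - PJ Qt bt w y = Iv (fun u => gs (u, y)) y (w + y).
Proof.
have c1 := PJ_Cable cQ mb hb y (w + y) y; have c2 := PJ_Cable cQt mbt hbt y (w + y) y.
rewrite /PJ -(CIB c1 c2); apply: CI_ae.
- by apply: CmeasB; exact: Cable_meas.
- exact: Cable_meas (gs_Cable _ _ _).
apply: (@filterS _ _ (ae_filter_ringOfSetsType mu) _ _ _ r_rs) => u e.
rewrite /gs /= -e /r /db.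
have alg (o q q' k k' : C) : o * (q * k) - o * (q' * k') = o * ((q - q') * k + q' * (k - k')) by ring.
exact: alg.
Qed.

Lemma rsE y : 0 < y -> y < pi -> rs y = G y y.
Proof. by move=> y0 yp; rewrite /rs /oo y0 yp mul1r PJ_diff subrK. Qed.

Let mG : Cmeas (fun p : R * R => G p.1 p.2).
Proof.
suff mF : Cmeas (fun p : (R * R) * R => oo p.1.2 pi p.2 * gs (p.2, p.1.1)) by exact: (Cmeas_CI mF).
have m11 : measurable_fun setT (fun p : (R * R) * R => p.1.1).
  exact: (measurableT_comp measurable_fst measurable_fst).
have m12 : measurable_fun setT (fun p : (R * R) * R => p.1.2).
  exact: (measurableT_comp measurable_snd measurable_fst).
have m2 : measurable_fun setT (fun p : (R * R) * R => p.2) by exact: measurable_snd.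
apply: CmeasM; first by apply: Cmeas_oo3; [exact: m12|exact: measurable_cst|exact: m2].
by apply: (Cmeas_comp (g := fun p : (R * R) * R => (p.2, p.1.1)) mgs); apply: measurable_fun_pair.
Qed.
Let G_le y a : nc (G y a) <= RI hh.
Proof.
apply: CI_le_dom; [exact: Cable_meas (gs_Cable _ _ _)|exact: ihh|] => u.
rewrite ncM; apply: le_trans (hgs u y).
by rewrite ler_piMl ?nc_ge0 // nc_oo_le1.
Qed.
Let mGw (w : R) : Cmeas (fun y : R => G y (w + y)).
Proof.
apply: (Cmeas_comp (g := fun y : R => (y, w + y)) mG).
apply: measurable_fun_pair; first exact: measurable_id.
by apply: measurable_funD; [exact: measurable_cst|exact: measurable_id].
Qed.
Let G_Cable (w s t : R) : Cable (fun y => oo s t y * G y (w + y)).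
Proof. by apply: (Cable_bd (mGw w) (B := RI hh)) => y _ _; exact: G_le. Qed.

Let rs_Iv (s t : R) : Iv rs s t = Iv r s t.
Proof.
apply: CI_ae.
- by apply: CmeasM; [exact: Cmeas_oo|exact: mrs].
- by apply: CmeasM; [exact: Cmeas_oo|exact: mr].
by apply: (@filterS _ _ (ae_filter_ringOfSetsType mu) _ _ _ r_rs) => y ->.
Qed.
Let GamB x : Gam Q x - Gam Qt x = Gam r x.
Proof.
rewrite /Gam -(CIB (Gam_Cable x cQ) (Gam_Cable x cQt)).
by apply: eq_CI => t; rewrite mulrBr.
Qed.

(** In the kernel equation the integral over y < u < x - s + y is the integral over y <
    u < pi, which is rs y, minus the one over x - s + y < u < pi. Integrating rs over
    (0, s) cancels the term Gam r s. *)
Lemma db_eq x s : tri (x, s) -> db (x, s) = Gam r (x - s) - Iv (fun y => G y (x - s + y)) 0 s.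
Proof.
move=> hxs; have /and3P[/= s0 sx xp] := hxs.
have [_ _ eb] := hk; have [_ _ ebt] := hkt.
rewrite /db (eb _ _ hxs) (ebt _ _ hxs).
have alg (g1 g2 h1 h2 j1 j2 : C) : g1 - h1 + j1 - (g2 - h2 + j2) = (g1 - g2) - (h1 - h2) + (j1 - j2) by ring.
rewrite alg (GamB (x - s)) (GamB s).
have crs : Cable (fun y => oo 0 s y * rs y).
  by apply: (Cable_bd mrs (B := MR)) => y _ _; exact: hrs.
have -> : J Q b x s - J Qt bt x s = Iv rs 0 s - Iv (fun y => G y (x - s + y)) 0 s.
  rewrite /J -(CIB (J_Cable cQ mb hb (x - s) s) (J_Cable cQt mbt hbt (x - s) s)).
  rewrite /Iv -(CIB crs (G_Cable (x - s) 0 s)).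
  apply: eq_CI => y; rewrite -mulrBr -mulrBr.
  have [/andP[y0 ys]|hy] := boolP ((0 < y) && (y < s)); last first.
    have oz : oo 0 s y = 0 :> C by rewrite /oo (negPf hy).
    by rewrite oz [LHS]mul0r [RHS]mul0r.
  congr (_ * _); rewrite PJ_diff.
  have yp : y < pi by lra.
  have h1 : y <= x - s + y by lra.
  have h2 : x - s + y <= pi by lra.
  rewrite (rsE y0 yp) /G -/(Iv (fun u => gs (u, y)) y pi).
  by rewrite (Iv_split h1 h2 (gs_Cable y pi y)) addrK.
by rewrite rs_Iv (Iv_Gam pr) addrA subrK.
Qed.

(** Reflecting y to u - y maps the region 0 < y < u - w onto w < y < u and changes the
    sign of gs. Over that region the integral in u is rs y, and r has total integral 0.
    *)
Lemma Iv_G_total (w : R) : 0 <= w <= pi -> Iv (fun y => G y (w + y)) 0 (pi - w) = Gam r w.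
Proof.
move=> /andP[w0 wp].
pose P (p : R * R) : C := oo 0 (pi - w) p.1 * (oo (w + p.1) pi p.2 * gs (p.2, p.1)).
pose P2 (p : R * R) : C := oo w pi p.1 * (oo p.1 pi p.2 * gs (p.2, p.1)).
have m1 : measurable_fun setT (fun p : R * R => p.1) by exact: measurable_fst.
have m2 : measurable_fun setT (fun p : R * R => p.2) by exact: measurable_snd.
have mg : Cmeas (fun p : R * R => gs (p.2, p.1)).
  by apply: (Cmeas_comp (g := fun p : R * R => (p.2, p.1)) mgs); exact: measurable_swap.
have mP : Cmeas P.
  apply: CmeasM; first by apply: Cmeas_oo3; [exact: measurable_cst|exact: measurable_cst|exact: m1].
  apply: CmeasM; last exact: mg.
  apply: Cmeas_oo3; [|exact: measurable_cst|exact: m2].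
  by apply: measurable_funD; [exact: measurable_cst|exact: m1].
have mP2 : Cmeas P2.
  apply: CmeasM; first by apply: Cmeas_oo3; [exact: measurable_cst|exact: measurable_cst|exact: m1].
  apply: CmeasM; last exact: mg.
  by apply: Cmeas_oo3; [exact: m1|exact: measurable_cst|exact: m2].
have dom c d y (o : C) u : nc o <= 1 -> nc (oo c d y * (o * gs (u, y))) <= ((c < y) && (y < d))%:R * hh u.
  move=> ho; rewrite ncM nc_oo; apply: ler_wpM2l => //.
  rewrite ncM; apply: le_trans (hgs u y); by rewrite ler_piMl // nc_ge0.
have dP y u : nc (P (y, u)) <= ((0 < y) && (y < pi - w))%:R * hh u by apply: dom; exact: nc_oo_le1.
have dP2 y u : nc (P2 (y, u)) <= ((w < y) && (y < pi))%:R * hh u by apply: dom; exact: nc_oo_le1.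
have -> : Iv (fun y => G y (w + y)) 0 (pi - w) = CI (fun y => CI (fun u => P (y, u))).
  by apply: eq_CI => y; rewrite -(CIZ _ (gs_Cable (w + y) pi y)).
rewrite (CI_fubini mP (Rable_oo 0 (pi - w)) ihh dP).
have e2 : Iv rs w pi = CI (fun y => CI (fun u => P2 (y, u))).
  apply: eq_CI => y; have [/andP[y0 yp]|hy] := boolP ((w < y) && (y < pi)); last first.
    have oz : oo w pi y = 0 :> C by rewrite /oo (negPf hy).
    rewrite oz mul0r -[LHS](@CI0 R); apply: eq_CI => u; by rewrite /P2 /= oz mul0r.
  rewrite rsE //; last exact: le_lt_trans w0 y0.
  by rewrite -(CIZ _ (gs_Cable y pi y)).
rewrite (CI_fubini mP2 (Rable_oo w pi) ihh dP2) in e2.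
have cP2 u : Cable (fun y => P2 (y, u)).
  apply: (Cable_dom (Cmeas_pair1 u mP2) (RableZ (hh u) (Rable_oo w pi))) => y.
  by rewrite mulrC; exact: dP2.
have cP u : Cable (fun y => P (y, u)).
  apply: (Cable_dom (Cmeas_pair1 u mP) (RableZ (hh u) (Rable_oo 0 (pi - w)))) => y.
  by rewrite mulrC; exact: dP.
have cCI : Cable (fun u => CI (fun y => P2 (y, u))).
  apply: (Cable_CI (F := fun p => P2 (p.2, p.1)) _ ihh (Rable_oo w pi)).
    by apply: (Cmeas_comp (g := fun p : R * R => (p.2, p.1)) mP2); exact: measurable_swap.
  by move=> u y; rewrite mulrC; exact: dP2.
have -> : CI (fun u => CI (fun y => P (y, u))) = - CI (fun u => CI (fun y => P2 (y, u))).
  rewrite -(CIN cCI); apply: eq_CI => u.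
  rewrite -(CIN (cP2 u)) -(CI_reflect u (cP u)); apply: eq_CI => y.
  rewrite /P /P2 /= gs_anti !mulrN !mulrA -!natrM !mulnb; congr (- (_%:R * _)).
  have -> : (0 < u - y) = (y < u) by rewrite subr_gt0.
  have -> : (w + (u - y) < u) = (w < y) by apply/idP/idP; lra.
  have [yu|yu] := ltP y u; have [wy|wy] := ltP w y; have [up|up] := ltP u pi; rewrite ?andbF ?andbT //=.
  have -> : (u - y < pi - w) by lra.
  by have -> : y < pi by lra.
rewrite -e2 rs_Iv.
have c0 : Cable (fun y => oo 0 pi y * r y) by exact: Cable_ooM.
have e := Iv_split w0 wp c0.
have z0 : Gam r pi = 0 by rewrite -GamB GamE subrr.
rewrite !(Iv_Gam pr) z0 in e.
by apply/eqP; rewrite -subr_eq0 -opprD addrC -e oppr0.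
Qed.

(** By [Iv_G_total] the primitive of r cancels. Now db (x, s), like r, is an integral of
    gs over points (u, y) with u > x. *)
Lemma db_back x s : tri (x, s) -> db (x, s) = Iv (fun y => G y (x - s + y)) s (pi - (x - s)).
Proof.
move=> hxs; have /and3P[/= s0 sx xp] := hxs.
have hw : 0 <= x - s <= pi by apply/andP; split; lra.
have h2 : s <= pi - (x - s) by lra.
rewrite (db_eq hxs) -(Iv_G_total hw) (Iv_split s0 h2 (G_Cable (x - s) 0 (pi - (x - s)))).
by rewrite addrAC subrr add0r.
Qed.

(** [rsE] and [db_back] form a homogeneous linear Volterra system for (r, db),
    integrated from pi downwards; in the weight of [weight_back] each application halves
    a bound on its solution. *)
Theorem potential_eq_ae : {ae mu, forall y, Q y = Qt y}.
Proof.
pose gw (u : R) : R := B * ((0 < u) && (u < pi))%:R + nc (Qt u).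
have [mQt iQt sQt] := pQt.
have mgw : measurable_fun setT gw.
  apply: measurable_funD; last exact: measurable_nc.
  exact: Rable_meas (RableZ B (Rable_oo 0 pi)).
have gw0 u : 0 <= gw u by rewrite addr_ge0 ?nc_ge0 // mulr_ge0.
have sgw u : ~~ ((0 < u) && (u < pi)) -> gw u = 0.
  by move=> hu; rewrite /gw (sQt u hu) (negPf hu) mulr0 nc0 addr0.
have igw : Rable (fun u => gw u ^+ 2).
  apply: (Rable_dom _ (RableD (RableZ (2 * B ^+ 2) (Rable_oo 0 pi)) (RableZ 2 iQt))).
    exact: measurable_funX.
  move=> u; rewrite ger0_norm ?sqr_ge0 // /gw.
  case: (_ && _); rewrite /= ?mulr1 ?mulr0.
    by have := sqr_ge0 (B - nc (Qt u)); nra.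
  by have := sqr_ge0 (nc (Qt u)); nra.
have p0 := pi_gt0 R.
(* th <= 1/2 serves the single integral for rs, th * pi <= 1/2 the double one for db *)
pose th : R := (2 * (1 + pi))^-1.
have th0 : 0 < th by rewrite invr_gt0 mulr_gt0 // addr_gt0.
have [m mp hm] := weight_back mgw gw0 sgw igw th0.
have the : 2 * th + 2 * (th * pi) = 1.
  have n0 : 1 + (pi : R) != 0 by rewrite gt_eqF // addr_gt0.
  rewrite /th; move: (pi : R) n0 => p n0; by field.
have thp : 0 < th * pi by rewrite mulr_gt0.
have th1 : th <= 1 / 2 by lra.
have th2 : th * pi <= 1 / 2 by lra.
(* the factor offsets the smallest value of the weight on (0, pi) *)
pose M0 := (MR + (B + Bt)) * expR (m * pi).
have MB0 : 0 <= MR + (B + Bt) := addr_ge0 MR0 (addr_ge0 B0 Bt0).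
have M00 : 0 <= M0 := mulr_ge0 MB0 (expR_ge0 _).
pose P (M : R) := (forall y, 0 < y -> y < pi -> nc (rs y) <= M * expR (- (m * y))) /\
  (forall x s, tri (x, s) -> nc (db (x, s)) <= M * expR (- (m * x))).
have step M : 0 <= M -> P M -> P (M / 2).
  move=> M_ge0 [h1 h2].
  have Gle y a : 0 < y -> y <= a -> nc (G y a) <= M * (th * expR (- (m * a))).
    move=> y0 ya; have [k1 k2] := hm a.
    apply: le_trans (ler_wpM2l M_ge0 k2); rewrite -(RIZ M k1).
    apply: CI_le_dom; [exact: Cable_meas (gs_Cable _ _ _)|exact: RableZ|] => u.
    have [/andP[au up]|hu] := boolP ((a < u) && (u < pi)); last first.
      rewrite /oo (negPf hu) mul0r nc0; apply: mulr_ge0 => //; apply: mulr_ge0 => //.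
      by apply: mulr_ge0; [exact: gw0|exact: expR_ge0].
    have u0 : 0 < u by lra.
    rewrite /oo au up !mul1r (_ : gs (u, y) = rs u * b (u, y) + Qt u * db (u, y)) //.
    apply: le_trans (ncD _ _) _; rewrite [nc (rs u * _)]ncM [nc (Qt u * _)]ncM /gw u0 up mulr1.
    have t_uy : tri (u, y) by apply/and3P; split => /=; lra.
    have k3 := h1 u u0 up; have k4 := h2 u y t_uy; have k5 := hb (u, y).
    have e1 : nc (rs u) * nc (b (u, y)) <= M * expR (- (m * u)) * B.
      by apply: ler_pM; rewrite ?nc_ge0.
    have e2 : nc (Qt u) * nc (db (u, y)) <= nc (Qt u) * (M * expR (- (m * u))).
      by apply: ler_wpM2l; rewrite ?nc_ge0.
    apply: le_trans (lerD e1 e2) _.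
    rewrite le_eqVlt; apply/orP; left; apply/eqP; ring.
  split=> [y y0 yp|x s hxs].
    rewrite (rsE y0 yp); apply: le_trans (Gle y y y0 (lexx y)) _.
    rewrite mulrA; apply: ler_wpM2r; first exact: expR_ge0.
    by apply: ler_wpM2l; [exact: M_ge0|rewrite -[2^-1]mul1r].
  have /and3P[/= s0 sx xp] := hxs.
  have h3 : s <= pi - (x - s) by lra.
  rewrite (db_back hxs).
  apply: le_trans (Iv_le (B := M * (th * expR (- (m * x)))) h3 (mGw _) _) _.
    move=> y sy yp; have y0 : 0 < y by lra.
    have hy : y <= x - s + y by lra.
    apply: le_trans (Gle y _ y0 hy) _.
    apply: ler_wpM2l => //; apply: ler_wpM2l; first exact: ltW.
    by rewrite ler_expR lerN2; apply: ler_wpM2l; [exact: ltW|lra].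
  have E0 := expR_ge0 (- (m * x)).
  have k1 : pi - (x - s) - s <= pi by lra.
  have k2 : 0 <= M * (th * expR (- (m * x))) by rewrite !mulr_ge0 // ltW.
  apply: le_trans (ler_wpM2l k2 k1) _.
  have k3 : 0 <= M * expR (- (m * x)) by rewrite mulr_ge0.
  have alg (A E t p : R) : A * (t * E) * p = A * E * (t * p) by ring.
  rewrite alg; apply: le_trans (ler_wpM2l k3 th2) _.
  by rewrite mul1r mulrAC.
have Pn n : P (M0 / 2 ^+ n).
  elim: n => [|n IH].
    rewrite expr0 divr1; have E1 y : y <= pi -> 1 <= expR (m * pi) * expR (- (m * y)).
      by move=> yp; rewrite -expRD -expR0 ler_expR subr_ge0; apply: ler_wpM2l; [exact: ltW|exact: yp].
    split=> [y y0 yp|x s /and3P[/= s0 sx xp]].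
      apply: le_trans (hrs y) _; rewrite /M0 -mulrA.
      apply: le_trans (ler_wpM2l MB0 (E1 y (ltW yp))); rewrite mulr1 lerDl; exact: addr_ge0 B0 Bt0.
    apply: le_trans (hdb _) _; rewrite /M0 -mulrA.
    by apply: le_trans (ler_wpM2l MB0 (E1 x xp)); rewrite mulr1 lerDr.
  have -> : M0 / 2 ^+ n.+1 = M0 / 2 ^+ n / 2 by rewrite exprS invfM [_^-1 * _]mulrC mulrA.
  by apply: step => //; rewrite divr_ge0 // exprn_ge0.
have rs0 y : rs y = 0.
  have [/andP[y0 yp]|hy] := boolP ((0 < y) && (y < pi)); last exact: srs.
  apply: nc_eq0; apply/eqP; rewrite eq_le nc_ge0 andbT.
  apply: (@le_geometric0 R _ M0) => n; have [h _] := Pn n.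
  apply: le_trans (h y y0 yp) _; rewrite ler_piMr ?divr_ge0 ?exprn_ge0 //.
  by rewrite -expR0 ler_expR oppr_le0 mulr_ge0 // ltW.
apply: (@filterS _ _ (ae_filter_ringOfSetsType mu) _ _ _ r_rs) => y.
by rewrite rs0 /r => /eqP; rewrite subr_eq0 => /eqP.
Qed.

End Recovery.

(** * The uniqueness theorem *)

Lemma Gam_omega (R : realType) (q : R -> R[i]) : L2 q ->
  Gam (fun x => oo 0 pi x * q x) pi = 2 * omega q.
Proof.
move=> Lq; rewrite -(Iv_Gam (L2_potential Lq)) /omega mulrC divfK ?pnatr_eq0 //.
by rewrite -Iv_Cintegral; apply: eq_Iv => x x0 xp; rewrite /oo x0 xp mul1r.
Qed.

Unset Implicit Arguments.

Theorem theorem2p2 (R : realType) (f1 f2 : R[i] -> R[i])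
  (q qt : R -> R[i]) (Sq Sq1 Sqt Sqt1 : R -> R[i] -> R[i])
  (lam lamt : nat -> R[i])
  (entire_f1 : entire f1) (entire_f2 : entire f2)
  (L2_q : L2 q) (L2_qt : L2 qt)
  (S_q : is_S q Sq Sq1) (S_qt : is_S qt Sqt Sqt1)
  (lam0 : lam 0%N = 0) (lamt0 : lamt 0%N = 0)
  (lam_consec : numbered_consecutively lam)
  (lamt_consec : numbered_consecutively lamt)
  (lam_sub : subspectrum (Delta f1 f2 Sq Sq1) lam)
  (lamt_sub : subspectrum (Delta f1 f2 Sqt Sqt1) lamt)
  (v_complete : completeH (vseq f1 f2 lam))
  (lam_eq : forall n : nat, (1 <= n)%N -> lam n = lamt n)
  (omega_eq : omega q = omega qt) :
  eqL2 q qt.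
Proof.
have [b [B [mb hb anti eb]]] := antisymmetric_kernel (L2_potential L2_q).
have [bt [Bt [mbt hbt antit ebt]]] := antisymmetric_kernel (L2_potential L2_qt).
have hk : kernel_of (fun x => oo 0 pi x * q x) b B := And3 mb hb eb.
have hkt : kernel_of (fun x => oo 0 pi x * qt x) bt Bt := And3 mbt hbt ebt.
have GamE : Gam (fun x => oo 0 pi x * q x) pi = Gam (fun x => oo 0 pi x * qt x) pi.
  by rewrite (Gam_omega L2_q) (Gam_omega L2_qt) omega_eq.
have hz := density_diff_eq0 entire_f1 entire_f2 L2_q L2_qt S_q S_qt lam0 lam_consec
  lam_sub lamt_sub v_complete lam_eq GamE hk hkt.
have := potential_eq_ae (L2_potential L2_q) (L2_potential L2_qt) hk hkt anti antit GamE hz.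
apply: (@filterS _ _ (ae_filter_ringOfSetsType (@lebesgue_measure R))) => x e.
by rewrite in_itv /= => /andP[x0 xp]; move: e; rewrite /oo x0 xp !mul1r.
Qed.
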